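(* There is an algorithm which, given a set $R$ of requests in a bidirected tree $T$, returns a maximum independent set of the interference graph $\mathcal{I}(R,T)$ in $O(|R|\log|R|+|T|)$ time.
   Context: A bidirected tree $T$ is a digraph obtained from a finite undirected tree by replacing each edge $uv$ by the two arcs $(u,v)$ and $(v,u)$. A request in $T$ is a directed path in $T$ with at least one arc. For a directed path $r$, $s_r$ is its first vertex, $t_r$ its last vertex, $s_r^+$ its second vertex, $t_r^-$ its penultimate vertex; its emission arc is $(s_r,s_r^+)$ and its reception arc is $(t_r^-,t_r)$. $T[x,y]$ denotes the unique directed path from $x$ to $y$ in $T$. A request $r$ interferes on $r'$ if $T[s_r,t_{r'}]$ has first arc the emission arc of $r$ and last arc the reception arc of $r'$; two requests interfere if one interferes on the other. The interference graph $\mathcal{I}(R,T)$ has vertex set $R$ and an edge between two distinct requests iff they interfere. *)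

(* Defs.v *)
From mathcomp Require Import all_boot.

Set Implicit Arguments.
Unset Strict Implicit.
Unset Printing Implicit Defensive.

(* ** Bidirected trees, requests, interference *)

Section Requests.
Variable V : finType.

(* The arc relation of a bidirected tree is the (symmetric) adjacency relation
   of the underlying undirected tree: the arcs are the ordered pairs (x, y)
   with T x y. The last clause is acyclicity of the undirected graph; simple
   closed walks of length 2 only go back and forth along one edge. *)
Definition bidirected_tree (T : rel V) : Prop :=
  [/\ 0 < #|V|, symmetric T, irreflexive T,
      forall x y, connect T x y
    & forall c : seq V, ucycle T c -> size c <= 2].

(* A directed path is stored as its first vertex and the sequence of the
   following ones. *)
Definition dpath : Type := (V * seq V)%type.

Implicit Type r : dpath.

Definition verts r : seq V := r.1 :: r.2.
Definition source r : V := r.1.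
Definition target r : V := last r.1 r.2.

Definition dipath (T : rel V) r : bool := path T r.1 r.2 && uniq (verts r).

Definition request (T : rel V) r : bool := dipath T r && (0 < size r.2).

(* Only meaningful for paths with at least one arc. *)
Definition emission_arc r : V * V := (source r, nth r.1 (verts r) 1).
Definition reception_arc r : V * V :=
  (nth r.1 (verts r) (size r.2).-1, target r).

(* [q] plays the part of T[s_r, t_r'], the only directed path of a bidirected
   tree with these ends; it must have an arc for its first and last arcs to
   make sense. *)
Definition interferes_on (T : rel V) r r' : Prop :=
  exists q : dpath,
    [/\ request T q, source q = source r, target q = target r',
        emission_arc q = emission_arc r
      & reception_arc q = reception_arc r'].

Definition interference_graph (T : rel V) r r' : Prop :=
  r <> r' /\ (interferes_on T r r' \/ interferes_on T r' r).

End Requests.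

(* Finite vertex sets are represented by duplicate-free sequences. *)
Definition independent_set (X : eqType) (adj : X -> X -> Prop)
    (R S : seq X) : Prop :=
  [/\ uniq S, {subset S <= R} & {in S &, forall r r', ~ adj r r'}].

Definition maximum_independent_set (X : eqType) (adj : X -> X -> Prop)
    (R S : seq X) : Prop :=
  independent_set adj R S /\
  forall S', independent_set adj R S' -> size S' <= size S.

(* ** Random access machine

   Structured programs for a word RAM: registers and one-dimensional arrays of
   natural numbers (a program mentions finitely many of each), addition and
   truncated subtraction. A number is true when it is nonzero. *)

Inductive expr : Type :=
| Const of nat
| Reg of nat
| Cell of nat & expr
| Plus of expr & expr
| Minus of expr & expr.

Inductive cmd : Type :=
| Skip
| SetReg of nat & expr
| SetCell of nat & expr & expr
| Seq of cmd & cmd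
| If of expr & cmd & cmd
| While of expr & cmd.

Record store : Type := Store { reg : nat -> nat; arr : nat -> nat -> nat }.

Fixpoint eval (s : store) (e : expr) : nat :=
  match e with
  | Const k => k
  | Reg x => reg s x
  | Cell a e1 => arr s a (eval s e1)
  | Plus e1 e2 => eval s e1 + eval s e2
  | Minus e1 e2 => eval s e1 - eval s e2
  end.

Definition set_reg (s : store) (x v : nat) : store :=
  Store (fun y => if y == x then v else reg s y) (arr s).

Definition set_cell (s : store) (a i v : nat) : store :=
  Store (reg s)
    (fun b j => if (b == a) && (j == i) then v else arr s b j).

(* [exec W c s k s'] : started in [s], the program [c] halts in [s'] after [k]
   steps, without ever storing a number greater than [W] (a program that would
   do so has no execution). Assignments and tests count as one step: an
   expression is part of the fixed program text, so its evaluation takes a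
   number of operations bounded by a constant. *)
Inductive exec (W : nat) : cmd -> store -> nat -> store -> Prop :=
| exec_skip s : exec W Skip s 1 s
| exec_reg s x e of eval s e <= W :
    exec W (SetReg x e) s 1 (set_reg s x (eval s e))
| exec_cell s a e1 e2 of eval s e2 <= W :
    exec W (SetCell a e1 e2) s 1 (set_cell s a (eval s e1) (eval s e2))
| exec_seq c1 c2 s1 k1 s2 k2 s3 of
    exec W c1 s1 k1 s2 & exec W c2 s2 k2 s3 :
    exec W (Seq c1 c2) s1 (k1 + k2) s3
| exec_if e c1 c2 s k s' of
    exec W (if eval s e != 0 then c1 else c2) s k s' :
    exec W (If e c1 c2) s k.+1 s'
| exec_while_stop e c s of eval s e = 0 : exec W (While e c) s 1 s
| exec_while_loop e c s1 k1 s2 k2 s3 of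
    eval s1 e != 0 & exec W c s1 k1 s2 & exec W (While e c) s2 k2 s3 :
    exec W (While e c) s1 (k1 + k2).+1 s3.

(* ** Input and output *)

(* The sequence [A] lists the arcs of [T] once each, in any order. *)
Definition arc_list (V : finType) (T : rel V) (A : seq (V * V)) : Prop :=
  uniq A /\ forall x y, ((x, y) \in A) = T x y.

(* Vertices are numbers below [n]; a request, being determined by its ends, is
   given as the pair of its first and last vertices. Registers 0, 1, 2 hold
   [n] and the numbers of arcs and of requests; arrays 0 and 1 the tails and
   heads of the arcs; arrays 2 and 3 the first and last vertices of the
   requests. Everything else is 0. *)
Definition input (n : nat) (A : seq ('I_n * 'I_n))
    (R : seq (dpath 'I_n)) : store :=
  Store (nth 0 [:: n; size A; size R])
    (fun a => nth 0 (nth [::]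
       [:: [seq nat_of_ord u.1 | u <- A];
           [seq nat_of_ord u.2 | u <- A];
           [seq nat_of_ord (source r) | r <- R];
           [seq nat_of_ord (target r) | r <- R]] a)).

(* Array 4 holds the characteristic vector of the returned subset of [R]. *)
Definition output (X : Type) (R : seq X) (s : store) : seq X :=
  mask [seq arr s 4 i != 0 | i <- iota 0 (size R)] R.

(* Main.v *)
Require Import Defs.
From mathcomp Require Import all_boot zify.

(* Removing an edge (u, v) of the tree splits it in two half-spaces. Let a_r be
   the one behind the emission arc of r (containing its source) and b_r the one
   beyond its reception arc (containing its target). Then r interferes on r'
   iff a_r and b_r' are disjoint. Half-spaces are cross-free: two of them are
   nested, disjoint or cover the tree. It follows that in an independent set
   of at least three requests the complements of the a_r are pairwise disjoint,
   or the complements of the b_r are; conversely either condition implies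
   independence. Hence a maximum independent set is the best of: a largest
   family with disjoint complements of the a_r, the same for the b_r, and a
   pair of compatible requests.

   Number the vertices in depth-first order, so that the vertices below v form
   an interval I(v); then each a_r and b_r is some I(v) or its complement. A
   largest disjoint family of such sets consists of the minimal I(v), plus one
   complement of some I(v) containing all of these if there is one. Requests r
   and r' are compatible iff the rectangles a_r * b_r and b_r' * a_r'
   intersect; the number of rectangles meeting a given one is a signed sum of
   four counts of dominated points, found by a sweep with a binary tree of
   counters in O(log n) per request. Finally
   |R| log n = O(|R| log |R| + n). *)

Set Implicit Arguments.
Unset Strict Implicit.
Unset Printing Implicit Defensive.

(** * Running programs *)


(** If the complements of a_r and a_r' are disjoint, the nonempty b_r' lies in the complement of
    a_r', hence inside a_r, and symmetrically: this is why either condition gives independence. For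
    the converse, independence forbids inclusions between the sets (complements of the a_r, and b_r)
    of distinct requests, so any two of them are disjoint or cover the tree, and a third request
    forces one and the same alternative throughout. Two requests alone may mix the alternatives,
    whence the separate search for a pair. A disjoint family has at most one complement of some I(v)
    because all of these contain the root. A request is given by its ends only, and its first arc
    must be found in constant amortised time: requests are bucketed by one end and answered during a
    scan of the labels that maintains the current child of every vertex. The factor log n is
    harmless: either n is polynomially bounded in |R|, and log n = O(log |R|), or |R| log n =
    O(n). *)

Fixpoint wregs (c : cmd) : seq nat :=
  match c with
  | SetReg x _ => [:: x]
  | Seq c1 c2 | If _ c1 c2 => wregs c1 ++ wregs c2
  | While _ c1 => wregs c1
  | _ => [::]
  end.

Fixpoint warrs (c : cmd) : seq nat :=
  match c with
  | SetCell a _ _ => [:: a]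
  | Seq c1 c2 | If _ c1 c2 => warrs c1 ++ warrs c2
  | While _ c1 => warrs c1
  | _ => [::]
  end.

Definition agree (rs bs : seq nat) (s s' : store) : Prop :=
  (forall x, x \notin rs -> reg s' x = reg s x) /\
  (forall a, a \notin bs -> arr s' a =1 arr s a).

Lemma agree_refl rs bs s : agree rs bs s s.
Proof. by split. Qed.

Lemma agree_trans rs bs s1 s2 s3 :
  agree rs bs s1 s2 -> agree rs bs s2 s3 -> agree rs bs s1 s3.
Proof.
move=> [r12 a12] [r23 a23]; split=> [x xrs|a abs j]; first by rewrite r23 ?r12.
by rewrite a23 ?a12.
Qed.

Lemma agree_sub rs bs rs' bs' s s' :
  {subset rs <= rs'} -> {subset bs <= bs'} ->
  agree rs bs s s' -> agree rs' bs' s s'.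
Proof.
move=> srs sbs [Hr Ha]; split=> [x|a] /negP nin; first by apply: Hr; apply/negP=> /srs.
by apply: Ha; apply/negP=> /sbs.
Qed.

Lemma agree_set_reg s x v : agree [:: x] [::] s (set_reg s x v).
Proof. by split=> // y; rewrite inE /= => /negbTE ->. Qed.

(** The frame rule. The sets of written registers and arrays are computed from the syntax, so that
    preservation of the rest is settled by evaluation in the rest of the proof. *)
Lemma exec_agree W c s k s' : exec W c s k s' -> agree (wregs c) (warrs c) s s'.
Proof.
elim=> {c s k s'} /=.
- by move=> s; apply: agree_refl.
- by move=> s x e _; apply: agree_set_reg.
- move=> s a e1 e2 _; split=> // b.
  by rewrite inE /= => /negbTE nb j; rewrite nb.
- move=> c1 c2 s1 k1 s2 k2 s3 _ A1 _ A2; apply: (agree_trans (s2 := s2)).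
    by apply: agree_sub A1 => x; rewrite mem_cat => ->.
  by apply: agree_sub A2 => x; rewrite mem_cat => ->; rewrite orbT.
- move=> e c1 c2 s k s' _; case: ifP => _ A; apply: agree_sub A => x;
    by rewrite mem_cat => ->; rewrite ?orbT.
- by move=> e c s _; apply: agree_refl.
- by move=> e c s1 k1 s2 k2 s3 _ _ A1 _ A2; apply: agree_trans A1 A2.
Qed.

Definition run (W : nat) (c : cmd) (s : store) (b : nat) (Q : store -> Prop) :
    Prop :=
  exists k s', [/\ exec W c s k s', k <= b & Q s'].

Lemma run_mono W c s b b' (Q Q' : store -> Prop) :
  b <= b' -> (forall s', agree (wregs c) (warrs c) s s' -> Q s' -> Q' s') ->
  run W c s b Q -> run W c s b' Q'.
Proof.
move=> bb' QQ' [k [s' [ex kb Qs']]]; exists k, s'; split=> //.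
  exact: leq_trans kb bb'.
exact: QQ' (exec_agree ex) Qs'.
Qed.

Lemma run_le W c s b b' Q : b <= b' -> run W c s b Q -> run W c s b' Q.
Proof. by move=> bb'; apply: run_mono. Qed.

Lemma run_seq W c1 c2 s b1 b2 Q :
  run W c1 s b1 (fun s' => run W c2 s' b2 Q) ->
  run W (Seq c1 c2) s (b1 + b2) Q.
Proof.
move=> [k1 [s1 [ex1 kb1 [k2 [s2 [ex2 kb2 Qs2]]]]]].
exists (k1 + k2), s2; split=> //; first exact: exec_seq ex1 ex2.
exact: leq_add.
Qed.

(** The invariant carries the remaining step budget [b]. Each round must strictly decrease it beyond
    the cost of the body, the missing unit paying for the test; termination and running time come
    out together. *)
Lemma run_while W e c (I : nat -> store -> Prop) s b Q :
  I b s ->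
  (forall b s, I b s -> eval s e = 0 -> 0 < b /\ Q s) ->
  (forall b s, I b s -> eval s e != 0 ->
     exists b1 b2, b1 + b2 < b /\ run W c s b1 (I b2)) ->
  run W (While e c) s b Q.
Proof.
move=> Is stop loop; have [m mb] := ubnP b.
elim: m => // m IH in b s Is mb *.
have [e0|e1] := eqVneq (eval s e) 0.
  have [b0 Qs] := stop _ _ Is e0.
  by exists 1, s; split=> //; apply: exec_while_stop.
have [b1 [b2 [b12 [k1 [s1 [ex1 kb1 Is1]]]]]] := loop _ _ Is e1.
have [|k2 [s2 [ex2 kb2 Qs2]]] := IH b2 s1 Is1; first by lia.
exists (k1 + k2).+1, s2; split=> //; last by lia.
exact: exec_while_loop ex1 ex2.
Qed.

(** Weakest preconditions for loop-free code, with the word-size condition at each assignment; loops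
    go through [run_while]. *)
Fixpoint wp (W : nat) (c : cmd) (s : store) (Q : store -> Prop) : Prop :=
  match c with
  | Skip => Q s
  | SetReg x e => eval s e <= W /\ Q (set_reg s x (eval s e))
  | SetCell a e1 e2 =>
      eval s e2 <= W /\ Q (set_cell s a (eval s e1) (eval s e2))
  | Seq c1 c2 => wp W c1 s (fun s' => wp W c2 s' Q)
  | If e c1 c2 =>
      (eval s e != 0 -> wp W c1 s Q) /\ (eval s e = 0 -> wp W c2 s Q)
  | While _ _ => False
  end.

Fixpoint cost (c : cmd) : nat :=
  match c with
  | Seq c1 c2 => cost c1 + cost c2
  | If _ c1 c2 => (maxn (cost c1) (cost c2)).+1
  | _ => 1
  end.

Lemma run_wp W c s Q : wp W c s Q -> run W c s (cost c) Q.
Proof.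
elim: c s Q => /= [|x e|a e1 e2|c1 IH1 c2 IH2|e c1 IH1 c2 IH2|//] s Q.
- by move=> Qs; exists 1, s; split=> //; apply: exec_skip.
- by move=> [le Qs]; exists 1, (set_reg s x (eval s e)); split=> //; apply: exec_reg.
- move=> [le Qs]; exists 1, (set_cell s a (eval s e1) (eval s e2)).
  by split=> //; apply: exec_cell.
- move=> /IH1 r1; apply: run_seq; apply: run_mono r1 => // s' _; exact: IH2.
- move=> [H1 H2]; have [e0|e1] := eqVneq (eval s e) 0.
    have [k [s' [ex kb Qs']]] := IH2 _ _ (H2 e0).
    exists k.+1, s'; split=> //; first by apply: exec_if; rewrite e0.
    by rewrite ltnS; apply: leq_trans kb (leq_maxr _ _).
  have [k [s' [ex kb Qs']]] := IH1 _ _ (H1 e1).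
  exists k.+1, s'; split=> //; first by apply: exec_if; rewrite e1.
  by rewrite ltnS; apply: leq_trans kb (leq_maxl _ _).
Qed.

(** * Loops over ranges and over linked lists *)

Definition For (x y : nat) (c : cmd) : cmd :=
  Seq (SetReg x (Const 0))
      (While (Minus (Reg y) (Reg x))
             (Seq c (SetReg x (Plus (Reg x) (Const 1))))).

(** A round costs its body, one test and one increment; the final 2 pays for the initialisation and
    the failing test. The bodies need not cost the same, which allows amortised bounds for nested
    loops. *)
Lemma run_for W x y c N (I : nat -> store -> Prop) (f : nat -> nat) s Q :
  [&& x \notin wregs c, y \notin wregs c & x != y] ->
  reg s y = N -> N <= W ->
  I 0 (set_reg s x 0) ->
  (forall i s', i < N -> agree (x :: wregs c) (warrs c) s s' ->
     reg s' x = i -> reg s' y = N -> I i s' ->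
     run W c s' (f i) (fun s'' => I i.+1 (set_reg s'' x i.+1))) ->
  (forall s', agree (x :: wregs c) (warrs c) s s' ->
     reg s' x = N -> I N s' -> Q s') ->
  run W (For x y c) s (\sum_(i < N) (f i + 2) + 2) Q.
Proof.
move=> /and3P[xc yc xy] sy NW I0 step done.
rewrite addnC -addn1 -addnA; apply: run_seq.
exists 1, (set_reg s x 0); split=> //; first exact: (@exec_reg W s x (Const 0)).
pose J b s' := exists i, [/\ i <= N, reg s' x = i, reg s' y = N, I i s' /\
  agree (x :: wregs c) (warrs c) s s' & b = 1 + \sum_(i <= j < N) (f j + 2)].
apply: (@run_while _ _ _ J).
- exists 0; split=> //=; rewrite ?eqxx ?(negPf xy) //.
  + by rewrite eq_sym (negPf xy).
  + split=> //.
    by apply: agree_sub (agree_set_reg _ _ _) => // z; rewrite !inE => ->.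
  + by rewrite big_mkord.
- move=> b s' [i [iN sx sy' [Ii ag] ->]] /=; rewrite sy' sx => Ni; split=> //.
  have Ei : i = N by lia.
  by move: sx Ii; rewrite Ei => sx Ii; apply: done.
- move=> b s' [i [iN sx sy' [Ii ag] ->]] /=; rewrite sy' sx => Ni.
  have {}iN : i < N by lia.
  exists (f i + 1), (1 + \sum_(i.+1 <= j < N) (f j + 2)); split.
    by rewrite (big_ltn iN); move: (\sum_(_ <= _ < _) _) => S; lia.
  apply: run_seq; apply: run_mono (step i s' iN ag sx sy' Ii) => // s1 ag1 I1.
  have [agr1 aga1] := ag1.
  exists 1, (set_reg s1 x i.+1); split=> //.
    have := @exec_reg W s1 x (Plus (Reg x) (Const 1)).
    by rewrite /= (agr1 _ xc) sx addn1; apply; lia.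
  exists i.+1; split=> //=; rewrite ?eqxx //.
  + by rewrite eq_sym (negPf xy) agr1.
  + split=> //; apply: (agree_trans ag); apply: (agree_trans (s2 := s1)).
      by apply: agree_sub ag1 => // z zc; rewrite inE zc orbT.
    by apply: agree_sub (agree_set_reg _ _ _) => // z; rewrite !inE => ->.
Qed.

Lemma run_for_const W x y c N (I : nat -> store -> Prop) d s Q :
  [&& x \notin wregs c, y \notin wregs c & x != y] ->
  reg s y = N -> N <= W ->
  I 0 (set_reg s x 0) ->
  (forall i s', i < N -> agree (x :: wregs c) (warrs c) s s' ->
     reg s' x = i -> reg s' y = N -> I i s' ->
     run W c s' d (fun s'' => I i.+1 (set_reg s'' x i.+1))) ->
  (forall s', agree (x :: wregs c) (warrs c) s s' ->
     reg s' x = N -> I N s' -> Q s') ->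
  run W (For x y c) s (N * (d + 2) + 2) Q.
Proof.
move=> xyc sy NW I0 step fin.
have := @run_for W x y c N I (fun=> d) s Q xyc sy NW I0 step fin.
by rewrite sum_nat_const card_ord.
Qed.

(* Lists of indices are linked through successors, 0 being the end. *)
Fixpoint chain (f : nat -> nat) (p : nat) (l : seq nat) : Prop :=
  if l is k :: l' then p = k.+1 /\ chain f (f k) l' else p = 0.

Lemma eq_chain f g p l : {in l, f =1 g} -> chain f p l -> chain g p l.
Proof.
elim: l p => //= k l IH p fg [-> c]; split=> //.
rewrite -fg ?mem_head //; apply: IH c => x xl; apply: fg.
by rewrite inE xl orbT.
Qed.

Lemma chain_head_le f p l W : chain f p l -> all (fun k => k < W) l -> p <= W.
Proof. by case: l => [->|k l [-> _] /= /andP[]]. Qed.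

Definition ForList (p : nat) (e : expr) (next : nat) (c : cmd) : cmd :=
  Seq (SetReg p e)
      (While (Reg p)
         (Seq c (SetReg p (Cell next (Minus (Reg p) (Const 1)))))).

(** The invariant is indexed by the part of the list already treated. It must hold for every value
    of [p] after a round, as the pointer is then overwritten with the next link. *)
Lemma run_forlist W p e next c l (I : seq nat -> store -> Prop) d s Q :
  p \notin wregs c -> next \notin warrs c ->
  chain (arr s next) (eval s e) l -> all (fun k => k < W) l ->
  I [::] (set_reg s p (eval s e)) ->
  (forall l1 k l2 s', l = l1 ++ k :: l2 ->
     agree (p :: wregs c) (warrs c) s s' -> reg s' p = k.+1 -> I l1 s' ->
     run W c s' d (fun s'' => forall v, I (rcons l1 k) (set_reg s'' p v))) ->
  (forall s', agree (p :: wregs c) (warrs c) s s' -> I l s' -> Q s') ->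
  run W (ForList p e next c) s (size l * (d + 2) + 2) Q.
Proof.
move=> pc nc ch lW I0 step fin.
rewrite addnC -addn1 -addnA; apply: run_seq.
exists 1, (set_reg s p (eval s e)); split=> //.
  by apply: (@exec_reg W s p e); apply: chain_head_le ch lW.
pose J b s' := exists l1 l2, [/\ l = l1 ++ l2, chain (arr s next) (reg s' p) l2,
  I l1 s', agree (p :: wregs c) (warrs c) s s' & b = 1 + size l2 * (d + 2)].
apply: (@run_while _ _ _ J).
- exists [::], l; split=> //=; rewrite ?eqxx //.
  by apply: agree_sub (agree_set_reg _ _ _) => // z; rewrite !inE => ->.
- move=> b s' [l1 [[|k l2] [El ch' I1 ag ->]]] /= p0; last by case: ch'; rewrite p0.
  by split=> //; apply: fin => //; rewrite El cats0.
- move=> b s' [l1 [[|k l2] [El /= ch' I1 ag ->]]] /=; first by rewrite ch'.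
  have [sp ch2] := ch'.
  move=> _; exists (d + 1), (1 + size l2 * (d + 2)); split; first by lia.
  apply: run_seq; apply: run_mono (step l1 k l2 s' El ag sp I1) => // s1 ag1 I2.
  have [agr aga] := agree_trans ag (agree_sub (rs' := p :: wregs c) (fun z zc =>
    (mem_behead (s := p :: wregs c) zc)) (fun z (zc : z \in warrs c) => zc) ag1).
  have sp1 : reg s1 p = k.+1 by case: ag1 => agr1 _; rewrite agr1.
  exists 1, (set_reg s1 p (arr s next k)); split=> //.
    have := @exec_reg W s1 p (Cell next (Minus (Reg p) (Const 1))).
    rewrite /= sp1 subn1 /= aga //; apply; apply: (chain_head_le ch2).
    by move: lW; rewrite El all_cat /= => /and3P[].
  exists (rcons l1 k), l2; split=> //=; rewrite ?eqxx ?cat_rcons //.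
  apply: (agree_trans (s2 := s1)) => //.
  by apply: agree_sub (agree_set_reg _ _ _) => // z; rewrite !inE => ->.
Qed.

(** * Sorting indices into buckets *)

Definition bucket (key head next x bound cnt : nat) : cmd :=
  Seq (For x bound (SetCell head (Reg x) (Const 0)))
      (For x cnt
         (Seq (SetCell next (Reg x) (Cell head (Cell key (Reg x))))
              (SetCell head (Cell key (Reg x)) (Plus (Reg x) (Const 1))))).

(** Insertion is at the head of the linked list, hence the reversal. *)
Definition bucket_of (key : nat -> nat) (K t : nat) : seq nat :=
  rev [seq k <- iota 0 K | key k == t].

Arguments bucket_of : simpl never.

Lemma bucket_ofS key K t :
  bucket_of key K.+1 t = if key K == t then K :: bucket_of key K t
                         else bucket_of key K t.
Proof.
rewrite /bucket_of -addn1 iotaD filter_cat add0n /=.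
by case: ifP => _; rewrite ?cats0 // cats1 rev_rcons.
Qed.

Lemma mem_bucket_of key K t k : (k \in bucket_of key K t) = (k < K) && (key k == t).
Proof. by rewrite mem_rev mem_filter mem_iota andbC. Qed.

Lemma bucket_of_lt key K t W : K <= W -> all (fun k => k < W) (bucket_of key K t).
Proof.
by move=> KW; apply/allP=> k; rewrite mem_bucket_of => /andP[/leq_trans->].
Qed.

(** This makes a loop over all buckets, with an inner loop over each, linear. *)
Lemma sum_bucket_of key K B : (forall k, k < K -> key k < B) ->
  \sum_(t < B) size (bucket_of key K t) = K.
Proof.
elim: K => [|K IH] kB; first by rewrite big1.
rewrite (eq_bigr (fun t : 'I_B => size (bucket_of key K t) + (t == key K :> nat))).
  rewrite big_split /= IH => [|k kK]; last by apply: kB; lia.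
  have KB : key K < B by apply: kB.
  rewrite (bigD1 (Ordinal KB)) //= eqxx big1 ?addn1 ?addn0 // => t.
  by rewrite -val_eqE /= => /negbTE ->.
by move=> t _; rewrite bucket_ofS eq_sym; case: eqP => //=; rewrite ?addn1 ?addn0.
Qed.

Lemma run_bucket W key head next x bound cnt B K s Q :
  uniq [:: key; head; next] -> uniq [:: x; bound; cnt] ->
  reg s bound = B -> reg s cnt = K -> B <= W -> K <= W ->
  (forall k, k < K -> arr s key k < B) ->
  (forall s', (forall t, t < B ->
      chain (arr s' next) (arr s' head t) (bucket_of (arr s key) K t)) -> Q s') ->
  run W (bucket key head next x bound cnt) s (B * 3 + K * 4 + 4) Q.
Proof.
rewrite /= !inE !negb_or !andbT => /andP[/andP[kh kn] hn] /andP[/andP[xb xc] bc].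
move=> sB sK BW KW keyB HQ.
have -> : B * 3 + K * 4 + 4 = (B * (1 + 2) + 2) + (K * (2 + 2) + 2) by lia.
apply: run_seq.
apply: (@run_for_const _ _ _ _ B (fun i s' => forall t, t < i -> arr s' head t = 0))
  => //=; rewrite ?inE //.
  move=> i s' iB ag sx sb I0; apply: (@run_wp _ (SetCell _ _ _)); split=> //= t ti.
  by rewrite eqxx sx /=; case: eqP => // /eqP ne; apply: I0; lia.
move=> s1 [agr1 aga1] _ z1.
have key1 : arr s1 key =1 arr s key by apply: aga1; rewrite inE.
apply: (@run_for_const _ _ _ _ K (fun i s' => forall t, t < B ->
   chain (arr s' next) (arr s' head t) (bucket_of (arr s key) i t))) => //=.
- by rewrite agr1 // inE eq_sym.
- move=> i s' iK [agr aga] sx sb Ih.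
  have keyE : arr s' key i = arr s key i.
    by rewrite aga ?key1 // !inE negb_or kn kh.
  have bW t : t < B -> arr s' head t <= W.
    by move=> tB; apply: chain_head_le (Ih t tB) _; apply: bucket_of_lt; lia.
  apply: (@run_wp _ (Seq _ _)) => /=.
  rewrite sx !(eqxx, negPf hn, negPf kh, negPf kn) /= keyE.
  have kB := keyB _ iK; split; first exact: bW.
  split; first by lia.
  move=> t tB; rewrite bucket_ofS (eq_sym _ t) !(eq_sym next) (negPf hn) /=.
  have nk : chain (fun j => if j == i then arr s' head (arr s key i) else arr s' next j)
         (arr s' head t) (bucket_of (arr s key) i t).
    apply: eq_chain (Ih t tB) => j; rewrite mem_bucket_of => /andP[ji _].
    by rewrite ltn_eqF.
  case: eqP => [Et|_] /=; last exact: nk.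
  by split; [rewrite addn1|rewrite eqxx /= -[arr s key i]Et; move: nk; rewrite -Et].
- move=> s2 _ _ I2; exact: HQ.
Qed.

(** * Depth-first numbering *)


(** The root is a fixed point of [p], so iterating too far stays at the root. *)
Definition anc (p : nat -> nat) (u v : nat) : Prop := exists k, iter k p v = u.

Lemma anc_refl p u : anc p u u. Proof. by exists 0. Qed.

Lemma anc_trans p u v w : anc p u v -> anc p v w -> anc p u w.
Proof. by move=> [k <-] [l <-]; exists (k + l); rewrite iterD. Qed.

Lemma anc_parent p u : anc p (p u) u. Proof. by exists 1. Qed.

Lemma anc_step p u v : anc p u v -> u = v \/ anc p u (p v).
Proof. by move=> [[|k]] <-; [left|right; exists k; rewrite -iterSr]. Qed.

Lemma eq_anc p p' u v :
  (forall i, i <= v -> p i = p' i /\ p i <= i) -> anc p u v -> anc p' u v.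
Proof.
move=> pp' [k]; elim: k v pp' => [|k IH] v pp'; first by move=> <-; apply: anc_refl.
have [pv lev] := pp' v (leqnn v).
rewrite iterSr => /IH A; apply: (@anc_trans _ _ (p v)).
  by apply: A => i ipv; apply: pp'; lia.
by rewrite pv; apply: anc_parent.
Qed.

(** Depth-first numberings without reference to a search: the parent of [i] lies on the branch from
    the root to the previous label [i.-1]. *)
Definition preorder (n : nat) (p : nat -> nat) : Prop :=
  p 0 = 0 /\ forall i, 0 < i < n -> p i < i /\ anc p (p i) i.-1.

Lemma preorder_le n p i : preorder n p -> i < n -> p i <= i.
Proof.
by move=> [p0 pS]; case: i => [|i] iN; [rewrite p0|apply: ltnW; case: (pS i.+1)].
Qed.

(** Descendants stay in the interval since [out] grows towards the root. Conversely, go down from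
    the descendant [(out v).-1]: if [w.+1 > v] is below [v], so is its parent, which is an ancestor
    of [w]; hence [w] is below [v]. *)
Lemma preorder_interval n p out :
  preorder n p ->
  (forall v, v < n -> [/\ v < out v, out v <= n & anc p v (out v).-1]) ->
  (forall v, 0 < v < n -> out v <= out (p v)) ->
  forall v w, v < n -> w < n -> anc p v w <-> v <= w < out v.
Proof.
move=> pp outP outp v w vn wn; have [p0 pS] := pp; split.
  move=> [k]; suff : iter k p w = v -> v <= w /\ out w <= out v.
    by move=> H /H; case: (outP w wn); lia.
  elim: k w wn => [|k IH] w wn; first by move=> /= ->.
  rewrite iterSr => ip; have pw := preorder_le pp wn.
  have {IH ip} := IH (p w) ltac:(lia) ip.
  case: (posnP w) => [->|w0]; first by rewrite p0.
  have := outp w ltac:(lia); lia.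
move=> /andP[vw wo]; have [_ on av] := outP v vn.
have [d Ed] : exists d, w + d = (out v).-1 by exists ((out v).-1 - w); lia.
elim: d w vw wo wn Ed => [|d IH] w vw wo wn Ed; first by rewrite -[w]addn0 Ed.
have aS : anc p v w.+1 by apply: IH; lia.
have [?|aP] := anc_step aS; first by lia.
apply: anc_trans aP _; by have [|_ /=] := pS w.+1 _; first by lia.
Qed.

Lemma preorder_rcons n p p' :
  preorder n p -> (forall i, i < n -> p' i = p i) -> (n = 0 -> p' 0 = 0) ->
  (0 < n -> p' n < n /\ anc p (p' n) n.-1) -> preorder n.+1 p'.
Proof.
move=> pp eqp p'0 p'n; have ext u v : v < n -> anc p u v -> anc p' u v.
  move=> vn; apply: eq_anc => i iv; rewrite eqp; last by lia.
  by split=> //; apply: (preorder_le pp); lia.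
split; first by case: (posnP n) => [/p'0|n0] //; rewrite eqp //; case: pp.
move=> i /andP[i0]; rewrite ltnS leq_eqVlt => /predU1P[Ei|iN].
  have /p'n[lt an] : 0 < n by lia.
  by rewrite Ei; split=> //; apply: ext an; lia.
rewrite eqp //; case: pp => _ /(_ i) [|lt an]; first by lia.
by split=> //; apply: ext an; lia.
Qed.

(** The list starts with the top of the stack, which has the largest index in the array. *)
Fixpoint stack_at (f : nat -> nat) (St : seq nat) : Prop :=
  if St is x :: St' then f (size St') = x /\ stack_at f St' else True.

Lemma eq_stack_at f g St :
  (forall j, j < size St -> f j = g j) -> stack_at f St -> stack_at g St.
Proof.
elim: St => //= x St IH fg [fx st]; split; first by rewrite -fg.
by apply: IH => // j js; apply: fg; lia.
Qed.

(** From the top of the stack downwards, the labels [pl x] of the parents climb the branch from [u]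
    to the root. With [u] the last label given, this is what makes the next vertex popped continue a
    preorder. *)
Fixpoint nested (p pl : nat -> nat) (u : nat) (St : seq nat) : Prop :=
  if St is x :: St' then anc p (pl x) u /\ nested p pl (pl x) St' else True.

(* Arrays of the whole program: 5, 6 heads and links of the adjacency lists, and
   of other buckets later; 7 the stack; 8 marks of the vertices reached; 9 the
   labels; 10, 11 the label of the parent, indexed by labels and by vertices;
   12 the ends of the intervals of descendants; 13, 14 the labels of the ends
   of the requests; 15, 16 the arguments and 17, 18 the results of [side]; 17,
   18 the arguments, 24, 25 the workspace and 26 the result of [disj]; 19 the
   current children; 20, 21 and 22, 23 the tail and head sides of the requests;
   27, 28 the families obtained from these; 29 to 32 the rectangles and 33
   their requests; 34 a table of halves; 35 the tree of counters; 36 to 39 the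
   arguments, 40, 41 buckets and 42 the result of [dom]; 43, 44 the positive
   and negative terms of the numbers of intersecting rectangles. *)
Definition dfs_visit : cmd :=
  Seq (SetReg 6 (Cell 1 (Minus (Reg 4) (Const 1))))
      (If (Cell 8 (Reg 6)) Skip
         (Seq (SetCell 8 (Reg 6) (Const 1))
         (Seq (SetCell 11 (Reg 6) (Reg 8))
         (Seq (SetCell 7 (Reg 7) (Reg 6))
              (SetReg 7 (Plus (Reg 7) (Const 1))))))).

Definition dfs_pop : cmd :=
  Seq (SetReg 7 (Minus (Reg 7) (Const 1)))
  (Seq (SetReg 5 (Cell 7 (Reg 7)))
  (Seq (SetCell 9 (Reg 5) (Reg 8))
       (SetCell 10 (Reg 8) (Cell 11 (Reg 5))))).

Definition dfs_init : cmd :=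
  Seq (SetReg 7 (Const 1))
  (Seq (SetReg 8 (Const 0))
  (Seq (SetCell 7 (Const 0) (Const 0))
       (SetCell 8 (Const 0) (Const 1)))).

Definition dfs_body : cmd :=
  Seq dfs_pop
  (Seq (ForList 4 (Cell 5 (Reg 5)) 6 dfs_visit)
       (SetReg 8 (Plus (Reg 8) (Const 1)))).

Definition dfs_search : cmd :=
  Seq (bucket 0 5 6 3 0 1)
  (Seq dfs_init
  (While (Reg 7) dfs_body)).

Lemma eq_nested n p p' pl pl' u St :
  preorder n p -> (forall i, i < n -> p' i = p i) -> u < n ->
  (forall x, x \in St -> pl' x = pl x /\ pl x < n) ->
  nested p pl u St -> nested p' pl' u St.
Proof.
move=> pp eqp; elim: St u => //= x St IH u un plE [an ns].
have [Ex xn] := plE x (mem_head _ _); rewrite Ex; split.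
  apply: eq_anc an => i iu; rewrite eqp; last by lia.
  by split=> //; apply: (preorder_le pp); lia.
by apply: IH => // y ySt; apply: plE; rewrite inE ySt orbT.
Qed.

Section Dfs.
Variables (W n a : nat) (tl hd : nat -> nat).
Hypothesis tl_lt : forall k, k < a -> tl k < n.
Hypothesis hd_lt : forall k, k < a -> hd k < n.
Hypothesis nW : n < W.
Hypothesis aW : a <= W.
Hypothesis n0 : 0 < n.

Definition edge (x y : nat) : Prop := exists k, [/\ k < a, tl k = x & hd k = y].

(** Reachability of every vertex from 0, as an induction principle. *)
Hypothesis conn : forall X : nat -> Prop,
  X 0 -> (forall x y, X x -> edge x y -> X y) -> forall x, x < n -> X x.

Definition labelling (L : seq nat) (lab p : nat -> nat) : Prop :=
  [/\ uniq L, all (fun x => x < n) L,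
      forall i, i < size L -> lab (nth 0 L i) = i,
      preorder (size L) p
    & forall i, 0 < i < size L -> edge (nth 0 L (p i)) (nth 0 L i)].

Definition adj_at (s : store) : Prop :=
  arr s 1 =1 hd /\
  forall t, t < n -> chain (arr s 6) (arr s 5 t) (bucket_of tl a t).

(* [L] lists the vertices already labelled, [St] is the stack, top first. *)
Definition dfs_inv (L St : seq nat) (s : store) : Prop :=
  [/\ uniq (L ++ St) /\ all (fun x => x < n) (L ++ St),
      forall x, (arr s 8 x != 0) = (x \in L ++ St),
      (forall i, i < size L -> arr s 9 (nth 0 L i) = i) /\
      (preorder (size L) (arr s 10) /\
      forall i, 0 < i < size L -> edge (nth 0 L (arr s 10 i)) (nth 0 L i)),
      forall x y, x \in L -> edge x y -> y \in L ++ St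
    & [/\ stack_at (arr s 7) St, reg s 7 = size St, reg s 8 = size L
        & if L is [::] then St = [:: 0] /\ arr s 11 0 = 0 else
          nested (arr s 10) (arr s 11) (size L).-1 St /\
          forall x, x \in St -> arr s 11 x < size L /\
                                edge (nth 0 L (arr s 11 x)) x]].

(* Midway through the scan of the arcs leaving the last vertex [v] of
   [rcons L v], the arcs in [l1] done; [D] is pushed on the rest [St]. *)
Definition visit_inv (L : seq nat) (v : nat) (St : seq nat) (pl : nat -> nat)
    (l1 : seq nat) (s : store) : Prop :=
  exists D,
  let M := rcons L v ++ D ++ St in
  [/\ uniq M /\ all (fun x => x < n) M,
      forall x, (arr s 8 x != 0) = (x \in M),
      forall k, k \in l1 -> hd k \in M,
      forall x, x \in D -> arr s 11 x = size L /\ edge v x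
    & [/\ forall x, x \in L ++ St -> arr s 11 x = pl x,
          stack_at (arr s 7) (D ++ St), reg s 7 = size (D ++ St) &
          reg s 8 = size L]].

Lemma dfs_visit_step L v St pl l1 k s :
  k < a -> tl k = v -> arr s 1 =1 hd -> reg s 4 = k.+1 ->
  visit_inv L v St pl l1 s ->
  run W dfs_visit s 8 (fun s' => forall x,
    visit_inv L v St pl (rcons l1 k) (set_reg s' 4 x)).
Proof.
move=> ka tk hdE s4 [D /= [[UM ltM] disc done pD [pS st s7 s8]]].
have hk := hd_lt ka.
have szM : size (rcons L v ++ D ++ St) <= n.
  rewrite -[n]card_ord -(size_iota 0 n) card_ord; apply: uniq_leq_size => // x xM.
  by rewrite mem_iota /= add0n; move/allP: ltM; apply.
apply: (@run_mono _ _ _ (cost dfs_visit) _ (fun s' => forall x,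
    visit_inv L v St pl (rcons l1 k) (set_reg s' 4 x))) => //.
apply: run_wp => /=.
rewrite s4 subn1 /= hdE; split; first by lia.
split=> [d|/eqP d].
  move=> x; exists D; split=> //=.
  by move=> j; rewrite mem_rcons inE => /predU1P[->|/done//]; rewrite -disc.
have hnM : hd k \notin rcons L v ++ D ++ St by rewrite -disc d.
move: szM; rewrite !size_cat size_rcons => szM.
split; first by lia.
split; first by lia.
split; first by lia.
rewrite s7; split; first by rewrite size_cat; lia.
move=> x; exists (hd k :: D).
have memM y : (y \in rcons L v ++ (hd k :: D) ++ St) =
              (y == hd k) || (y \in rcons L v ++ D ++ St).
  by rewrite !mem_cat inE; case: (y == hd k); rewrite ?orbT.
split=> /=.
- split; last by apply/allP=> y; rewrite memM => /predU1P[->//|]; apply: (allP ltM).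
  by rewrite -(cat1s (hd k) (D ++ St)) uniq_catCA cat1s cons_uniq hnM.
- by move=> y; rewrite memM; case: (y == hd k) => //=; rewrite disc.
- move=> j; rewrite mem_rcons inE memM => /predU1P[->|/done ->]; first by rewrite eqxx.
  by rewrite orbT.
- move=> y; rewrite inE s8; case: eqP => [->|ne] /=; first by split=> //; exists k.
  exact: pD.
- rewrite s8; split=> //=; last by rewrite addn1.
    move=> y yLS; case: eqP => [Ey|_]; last exact: pS.
    by move: hnM; rewrite -Ey cat_rcons !mem_cat inE !mem_cat; move: yLS; rewrite mem_cat => /orP[->|->]; rewrite ?orbT.
  split; first by rewrite eqxx.
  apply: eq_stack_at st => j jD; case: eqP => // jE; lia.
Qed.

(** By [nested], the parent of [v] is an ancestor of the last label, so giving [v] the next label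
    extends the preorder. The neighbours pushed have [v] as parent, and the older stack is nested
    above the parent of [v]. The cost is linear in the out-degree of [v]. *)
Lemma dfs_step L v St s :
  adj_at s -> dfs_inv L (v :: St) s ->
  run W dfs_body s (size (bucket_of tl a v) * 10 + 7) (fun s' =>
    exists D, adj_at s' /\ dfs_inv (rcons L v) (D ++ St) s').
Proof.
move=> [hdE adj] [[ULS ltLS] disc [lab [pre edg]] clos [[Sv st] s7 s8 LP]].
have szM : size (L ++ v :: St) <= n.
  rewrite -[n]card_ord -(size_iota 0 n) card_ord; apply: uniq_leq_size => // x xM.
  by rewrite mem_iota /= add0n; move/allP: ltLS; apply.
have vn : v < n by apply: (allP ltLS); rewrite mem_cat mem_head orbT.
move: szM; rewrite size_cat /= => szM.
have -> : size (bucket_of tl a v) * 10 + 7 =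
  cost dfs_pop + ((size (bucket_of tl a v) * (8 + 2) + 2) + 1) by rewrite /=; lia.
have plP x : x \in v :: St -> L <> [::] -> arr s 11 x < size L /\
    edge (nth 0 L (arr s 11 x)) x.
  by case: (L) LP => // y L' [_ H] xS _; apply: H.
have plv : arr s 11 v <= n.
  case: (posnP (size L)) => [/size0nil L0|L0].
    by move: LP; rewrite L0 => -[[-> _] ->].
  have [|] := plP v (mem_head _ _); first by move=> E; rewrite E in L0.
  by lia.
apply: run_seq; apply: run_wp; rewrite /= s7 /= subn1 /= Sv.
split; first by lia.
split; first by lia.
split; first by lia.
split; first by lia.
apply: run_seq; apply: (@run_forlist _ _ _ _ _ (bucket_of tl a v)
  (visit_inv L v St (arr s 11))) => //=.
- exact: adj.
- exact: bucket_of_lt.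
- exists [::]; rewrite /= cat_rcons; split=> //; split=> //.
- move=> l1 k l2 s' El [agr aga] s4 I1; apply: dfs_visit_step => //.
  + by have := mem_bucket_of tl a v k; rewrite El mem_cat mem_head orbT => /esym/andP[].
  + by have := mem_bucket_of tl a v k; rewrite El mem_cat mem_head orbT => /esym/andP[_ /eqP].
  + by move=> j; rewrite aga //= hdE.
move=> s2 [agr aga] [D [[UM ltM] disc2 done pD [pS st2 s72 s82]]].
apply: (@run_wp _ (SetReg _ _)); split=> /=; first by rewrite s82; lia.
have A9 j : arr s2 9 j = if j == v then size L else arr s 9 j.
  by rewrite aga //= s8.
have A10 j : arr s2 10 j = if j == size L then arr s 11 v else arr s 10 j.
  rewrite aga //= s8; case: eqP => //= _; by case: eqP.
have U1 : uniq (rcons L v) by move: UM; rewrite cat_uniq => /andP[].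
have p10 i : i < size L -> arr s2 10 i = arr s 10 i.
  by rewrite A10; case: eqP => // ->; rewrite ltnn.
have nthL i : i < size L -> nth 0 (rcons L v) i = nth 0 L i.
  by move=> iL; rewrite nth_rcons iL.
have nthv : nth 0 (rcons L v) (size L) = v by rewrite nth_rcons ltnn eqxx.
exists D; split; first split.
- by move=> j /=; rewrite aga //= hdE.
- move=> t tn /=; apply: (@eq_chain (arr s 6)) => [j _|]; first by rewrite aga.
  by rewrite !aga //=; apply: adj.
split=> //=.
- split; last split.
  + move=> i; rewrite size_rcons ltnS leq_eqVlt A9 => /predU1P[->|iL].
      by rewrite nthv eqxx.
    rewrite nthL // lab // ifN //; apply: contraTneq U1 => Ev.
    by rewrite rcons_uniq -Ev mem_nth.
  + rewrite size_rcons; apply: (preorder_rcons pre p10).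
      by move=> L0; move: LP; rewrite A10 L0 (size0nil L0) eqxx => -[[-> _] ->].
    move=> L0; rewrite A10 eqxx; have LN : L <> [::] by move=> E; rewrite E in L0.
    by split; [case: (plP v (mem_head _ _) LN)|case: (L) LP LN => // y L' [[]]].
  + move=> i /andP[i0]; rewrite size_rcons ltnS leq_eqVlt => /predU1P[Ei|iL].
      have LN : L <> [::] by move=> E; move: Ei; rewrite E /=; lia.
      have [lt ed] := plP v (mem_head _ _) LN.
      by rewrite Ei nthv A10 eqxx nthL.
    have [pi _] : arr s 10 i < i /\ anc (arr s 10) (arr s 10 i) i.-1.
      by case: pre => _; apply; lia.
    by rewrite p10 // !nthL //; [apply: edg; lia|lia].
- move=> x y; rewrite mem_rcons inE => /predU1P[->|xL] xy.
    have [k [ka tk <-]] := xy; apply: done.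
    by rewrite mem_bucket_of ka tk eqxx.
  have := clos x y xL xy; rewrite !mem_cat mem_rcons !inE.
  by case/orP=> [->|/orP[->|->]]; rewrite ?orbT.
- split=> //; first by rewrite size_rcons s82 addn1.
  have rc (P Q : Prop) : Q -> match rcons L v with [::] => P | _ => Q end by case: (L).
  apply: rc; rewrite size_rcons /=.
  have pSt x : x \in St -> arr s2 11 x = arr s 11 x.
    by move=> xSt; apply: pS; rewrite mem_cat xSt orbT.
  split.
    (* The rest of the stack was nested with respect to the parent of [v], an ancestor of the new
       label [size L]. *)
    have nD : nested (arr s2 10) (arr s2 11) (size L) St.
      case: (posnP (size L)) => [/size0nil L0|L0].
        by move: LP; rewrite L0 => -[[_ ->]].
      have LN : L <> [::] by move=> E; rewrite E in L0.
      have [ltv _] := plP v (mem_head _ _) LN.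
      have : nested (arr s 10) (arr s 11) (arr s 11 v) St.
        by case: (L) LP LN => // y L' [[_ ns] _] _.
      move/(eq_nested (pl' := arr s2 11) pre p10 ltv) => ns.
      have {}ns : nested (arr s2 10) (arr s2 11) (arr s 11 v) St.
        apply: ns => x xSt; rewrite pSt //; split=> //.
        by case: (plP x _ LN) => //; rewrite inE xSt orbT.
      case: (St) ns => //= x St' [an ns]; split=> //; apply: anc_trans an _.
      by have := anc_parent (arr s2 10) (size L); rewrite A10 eqxx.
    elim: (D) pD => //= x D' IH pD; have [-> _] := pD x (mem_head _ _).
    split; first exact: anc_refl.
    by apply: IH => y yD; apply: pD; rewrite inE yD orbT.
  move=> x; rewrite mem_cat => /orP[/pD[-> ed]|xSt]; first by rewrite ltnS nthv.
  case: (posnP (size L)) => [/size0nil L0|L0].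
    by move: LP xSt; rewrite L0 => -[[_ ->]].
  have LN : L <> [::] by move=> E; rewrite E in L0.
  have [|lt ed] := plP x _ LN; first by rewrite inE xSt orbT.
  by rewrite pSt // nthL //; split=> //; lia.
Qed.

Lemma run_dfs s :
  reg s 0 = n -> reg s 1 = a -> arr s 0 =1 tl -> arr s 1 =1 hd ->
  arr s 8 =1 (fun=> 0) -> arr s 10 =1 (fun=> 0) -> arr s 11 =1 (fun=> 0) ->
  run W dfs_search s (n * 11 + a * 14 + 9) (fun s' =>
    exists L, size L = n /\ labelling L (arr s' 9) (arr s' 10)).
Proof.
move=> s0 s1 tlE hdE z8 z10 z11.
have -> : n * 11 + a * 14 + 9 =
  (n * 3 + a * 4 + 4) + (cost dfs_init + (n * 8 + a * 10 + 1)) by rewrite /=; lia.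
have keyB k : k < a -> arr s 0 k < n by move=> ka; rewrite tlE; apply: tl_lt.
apply: run_seq; apply: run_mono (@run_bucket W 0 5 6 3 0 1 n a s _ isT isT s0 s1
  (ltnW nW) aW keyB (fun s' H => H)) => //.
move=> s2 [agr aga] ch; apply: run_seq; apply: run_wp => /=.
split; first by lia.
split=> //; split=> //; split; first by lia.
pose deg x := size (bucket_of tl a x).
(* The budget charges each unlabelled vertex for scanning its arcs, plus one unit for the last
   test. *)
apply: (@run_while _ _ _ (fun b s' => exists L St, adj_at s' /\ dfs_inv L St s' /\
  0 \in L ++ St /\ b = 1 + \sum_(x < n | val x \notin L) (deg x * 10 + 8))).
- exists [::], [:: 0]; split; first split.
  + by move=> j /=; rewrite aga // hdE.
  + move=> t tn /=; have := ch t tn; congr (chain _ _ _).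
    by rewrite /bucket_of; congr rev; apply: eq_filter => k; rewrite tlE.
  split; first split=> //=.
  + by rewrite n0.
  + by move=> x; rewrite inE; case: (x == 0) => //=; rewrite aga // z8.
  + split=> //; split; last by move=> i; lia.
    by split=> [|i]; [rewrite aga // z10|lia].
  + by split=> //; rewrite aga // z11.
  split=> //; rewrite (eq_bigl xpredT) // big_split /= -big_distrl /= sum_bucket_of //.
  by rewrite sum_nat_const card_ord; lia.
- move=> b s' [L [St [ad [[[UL ltL] disc [lab [pre edg]] clos [st s7 s8 LP]] [L0 ->]]]]].
  rewrite /= s7 => /size0nil E; rewrite E !cats0 in UL ltL disc clos LP L0.
  split=> //; exists L.
  have cL x y : x \in L -> edge x y -> y \in L by move=> xL /(clos _ _ xL).
  (* With an empty stack, the labelled vertices are closed under arcs and contain 0. *)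
  have allL x : x < n -> x \in L by move: x; apply: conn => //; rewrite -[L]cats0.
  have szL : size L = n.
    apply/eqP; rewrite eqn_leq; apply/andP; split.
      rewrite -(size_iota 0 n); apply: uniq_leq_size => // x xL.
      by rewrite mem_iota /= add0n; move/allP: ltL; apply.
    rewrite -{1}(size_iota 0 n); apply: uniq_leq_size; first exact: iota_uniq.
    by move=> x; rewrite mem_iota /= add0n; apply: allL.
  by split=> //.
- move=> b s' [L [[|v St] [ad [inv [L0 ->]]]]] /=.
    by case: inv => _ _ _ _ [_ -> _ _].
  move=> _; have [[ULS ltLS] _ _ _ _] := inv.
  have vn : v < n by apply: (allP ltLS); rewrite mem_cat mem_head orbT.
  have vL : v \notin L.
    by move: ULS; rewrite cat_uniq /= negb_or => /and3P[_ /andP[]].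
  exists (deg v * 10 + 7), (1 + \sum_(x < n | val x \notin rcons L v) (deg x * 10 + 8)).
  split.
    have -> : \sum_(x < n | val x \notin L) (deg x * 10 + 8) =
      deg v * 10 + 8 + \sum_(x < n | val x \notin rcons L v) (deg x * 10 + 8).
      rewrite (bigD1 (Ordinal vn)) //=; congr (_ + _); apply: eq_bigl => x.
      by rewrite mem_rcons inE negb_or -val_eqE andbC.
    by move: (\sum_(_ < _ | _) _) => S; lia.
  apply: run_mono (dfs_step ad inv) => // s3 _ [D [ad3 inv3]].
  exists (rcons L v), (D ++ St); split=> //; split=> //; split=> //.
  move: L0; rewrite !mem_cat mem_rcons !inE.
  by case/orP=> [->|/orP[->|->]]; rewrite ?orbT.
Qed.
End Dfs.

(** * Ends of the intervals of descendants *)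

Definition outs : cmd :=
  Seq (For 3 0 (SetCell 12 (Reg 3) (Plus (Reg 3) (Const 1))))
      (For 3 0
        (Seq (SetReg 5 (Minus (Minus (Reg 0) (Const 1)) (Reg 3)))
             (If (Minus (Cell 12 (Reg 5)) (Cell 12 (Cell 10 (Reg 5))))
                 (SetCell 12 (Cell 10 (Reg 5)) (Cell 12 (Reg 5))) Skip))).

(** Labels are treated in decreasing order, so the entry of a label is final when it is propagated
    to its parent. The entry always ends at a true descendant, as [preorder_interval] asks. *)
Lemma run_outs W n p s :
  n < W -> reg s 0 = n -> arr s 10 =1 p -> preorder n p ->
  run W outs s (n * 8 + 4) (fun s' =>
    (forall v, v < n -> v < arr s' 12 v <= n) /\
    forall v w, v < n -> w < n -> anc p v w <-> v <= w < arr s' 12 v).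
Proof.
move=> nW s0 pE pp; have -> : n * 8 + 4 = (n * (1 + 2) + 2) + (n * (3 + 2) + 2) by lia.
apply: run_seq; apply: (@run_for_const _ _ _ _ n (fun i s' =>
  forall v, v < i -> arr s' 12 v = v.+1)) => //; first exact: ltnW.
  move=> i s' iN ag s3 _ I0; apply: (@run_wp _ (SetCell _ _ _)); split=> /=; first by lia.
  move=> v vi; rewrite s3; case: eqP => [->|ne]; first by rewrite addn1.
  by apply: I0; lia.
move=> s1 [agr1 aga1] _ o1.
have p1 : arr s1 10 =1 p by move=> j; rewrite aga1.
apply: (@run_for_const _ _ _ _ n (fun i s' =>
  (forall v, v < n ->
     [/\ v < arr s' 12 v, arr s' 12 v <= n & anc p v (arr s' 12 v).-1]) /\
  forall v, n - i <= v -> 0 < v < n -> arr s' 12 v <= arr s' 12 (p v))) => //.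
- by rewrite agr1.
- exact: ltnW.
- split=> [v vn|v]; last by lia.
  by rewrite o1 //; split=> //; apply: anc_refl.
- move=> i s' iN [agr aga] s3 s0' [I1 I2].
  have p' : arr s' 10 =1 p by move=> j; rewrite aga.
  apply: (@run_wp _ (Seq _ _)) => /=; rewrite s0' s3 p'.
  set v := n - 1 - i; have vn : v < n by lia.
  have pv := preorder_le pp vn; split; first by lia.
  have [lv nv av] := I1 _ vn.
  split=> [lt|ge]; last first.
    split=> [u|u iu /andP[u0 un]] /=; first exact: I1.
    have [->|ne] := eqVneq u v; first by lia.
    by apply: I2; lia.
  split; first by lia.
  (* At the root, where [p 0 = 0], the test compares a cell with itself and fails. *)
  have pv' : p v < v.
    have [v0|v0] := posnP v; last by have [_ /(_ v) []] := pp; rewrite ?v0.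
    by move: lt; rewrite v0; case: pp => ->; rewrite subnn.
  split=> [u un|u iu /andP[u0 un]] /=.
    case: eqP => [->|_]; last exact: I1.
    by split; [lia|lia|apply: anc_trans av; apply: anc_parent].
  rewrite (_ : u == p v = false); last by lia.
  case: (eqVneq (p u) (p v)) => [Ep|ne2].
    have [->//|ne] := eqVneq u v; have := I2 u ltac:(lia) ltac:(lia).
    by rewrite Ep; lia.
  have [Ev|ne] := eqVneq u v; first by rewrite Ev eqxx in ne2.
  by apply: I2; lia.
- move=> s2 _ _ [I1 I2]; split=> [v vn|v w vn wn].
    by have [-> -> _] := I1 _ vn.
  by apply: (preorder_interval pp I1) => // u un; apply: I2; lia.
Qed.

(** * Half-spaces of a tree *)


Section HalfSpaces.
Variables (V : finType) (T : rel V).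
Hypothesis treeT : bidirected_tree T.

Let symT : symmetric T. Proof. by case: treeT. Qed.
Let irrT : irreflexive T. Proof. by case: treeT. Qed.

Definition cut (u v : V) : rel V := fun x y =>
  [&& T x y, ~~ ((x == u) && (y == v)) & ~~ ((x == v) && (y == u))].

Definition half_space (u v : V) : {set V} := [set w | connect (cut u v) v w].

Lemma cut_sym u v : symmetric (cut u v).
Proof. by move=> x y; rewrite /cut symT; do 4![case: (_ == _)]. Qed.

Lemma cutC u v : cut u v =2 cut v u.
Proof. by move=> x y; rewrite /cut; do 4![case: (_ == _)]. Qed.

Lemma connect_cut_sym u v x y : connect (cut u v) x y = connect (cut u v) y x.
Proof. exact/sym_connect_sym/cut_sym. Qed.

Lemma half_refl u v : v \in half_space u v.
Proof. by rewrite inE connect0. Qed.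

(** Otherwise a simple path from [v] to [u] avoiding the edge closes up with it to a cycle on at
    least three vertices. *)
Lemma half_out u v : T u v -> u \notin half_space u v.
Proof.
move=> uv; apply/negP; rewrite inE => /connectP[p pth].
case/shortenP: pth => q pth uq _ Eu.
have /= : size (v :: q) <= 2.
  have [_ _ _ _ cyc] := treeT; apply: cyc; rewrite /ucycle uq andbT /=.
  rewrite rcons_path -Eu uv andbT; apply: sub_path pth => x y.
  by case/and3P.
case: q pth Eu {uq} => [|x [|]] //=; first by move=> _ Eu; rewrite Eu irrT in uv.
by move=> /andP[/and3P[_ _ h] _] Ex _; rewrite Ex !eqxx in h.
Qed.

Lemma half_step u v x y : T x y -> x \in half_space u v -> y \notin half_space u v ->
  x = v /\ y = u.
Proof.
move=> xy; rewrite !inE => vx vy.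
have : ~~ cut u v x y by apply: contra vy => /connect1; apply: connect_trans.
rewrite /cut xy /=; case: eqP => [->|_] /=.
  case: eqP => [Ey|_] /=; first by rewrite Ey connect0 in vy.
  by rewrite negbK => /andP[/eqP -> /eqP ->].
by rewrite negbK => /andP[/eqP -> /eqP ->].
Qed.

Lemma half_cover u v w : T u v -> (w \in half_space u v) || (w \in half_space v u).
Proof.
move=> uv; have [_ _ _ /(_ v w) /connectP[p pth ->] _] := treeT.
suff gen x : path T x p -> (x \in half_space u v) || (x \in half_space v u) ->
    (last x p \in half_space u v) || (last x p \in half_space v u).
  by apply: gen pth _; rewrite half_refl.
elim: p x {pth} => //= y p IH x /andP[xy pth] xin; apply: IH => //.
case/orP: xin => xin.
  have [//|yo] := boolP (y \in half_space u v).
  by have [_ ->] := half_step xy xin yo; rewrite half_refl.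
have [|yo] := boolP (y \in half_space v u); first by rewrite orbT.
by have [_ ->] := half_step xy xin yo; rewrite half_refl.
Qed.

Lemma halfC u v : T u v -> half_space v u = ~: half_space u v.
Proof.
move=> uv; apply/setP=> w; rewrite in_setC; apply/idP/idP => [wv|wu].
  apply/negP=> wu; have /negP[] := half_out uv.
  rewrite inE; move: wu wv; rewrite !inE => vw uw.
  apply: connect_trans vw _; rewrite (eq_connect (cutC u v)).
  by rewrite connect_cut_sym.
by have := half_cover w uv; rewrite (negPf wu).
Qed.

(** A walk inside the smaller half-space starts at [y] and could leave the other one only through
    [u]. *)
Lemma half_sub u v x y : y \in half_space u v -> u \notin half_space x y ->
  half_space x y \subset half_space u v.
Proof.
move=> yuv uxy; apply/subsetP=> w; rewrite inE => /connectP[p pth ->].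
have := half_refl x y.
suff gen y0 : path (cut x y) y0 p -> y0 \in half_space u v -> y0 \in half_space x y ->
  last y0 p \in half_space u v by apply: gen.
elim: p y0 {pth} => //= z p IH y0 /andP[yz pth] y0uv y0xy.
have zxy : z \in half_space x y.
  by move: y0xy; rewrite !inE => /connect_trans; apply; apply: connect1.
apply: IH => //; apply: contraNT uxy => zo.
by have [|_ <-] := half_step _ y0uv zo; first by case/and3P: yz.
Qed.

(** The positions of [y] with respect to the first edge, and of [u] or [v] with respect to the
    second, select one of four cases; each is [half_sub] for the half-spaces or their
    complements. *)
Lemma half_crossfree u v x y : T u v -> T x y ->
  [\/ half_space x y \subset half_space u v, half_space u v \subset half_space x y,
      half_space u v :&: half_space x y = set0 | half_space u v :|: half_space x y = setT].
Proof.
move=> uv xy; have vu : T v u by rewrite symT.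
have [yuv|yuv] := boolP (y \in half_space u v).
  have [uxy|uxy] := boolP (u \in half_space x y); last by constructor 1; apply: half_sub.
  constructor 4; apply/eqP; rewrite -subTset -(setUCr (half_space u v)) setUS //.
  rewrite -halfC //; apply: half_sub => //; rewrite (halfC uv) in_setC negbK.
  apply: contraTT uxy => xo.
  have [-> ->] : y = v /\ x = u by apply: half_step yuv xo; rewrite symT.
  exact: half_out.
have yvu : y \in half_space v u by rewrite halfC // in_setC.
have [vxy|vxy] := boolP (v \in half_space x y).
  constructor 2; apply: half_sub => //; apply: contraTN vxy => xo.
  have [-> ->] : x = v /\ y = u by apply: half_step yuv.
  exact: half_out.
constructor 3; apply/eqP; rewrite setI_eq0 disjoint_sym disjoints_subset.
by rewrite -halfC //; apply: half_sub.
Qed.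

Lemma path_cut u v x p : path T x p -> u \notin x :: p -> path (cut u v) x p.
Proof.
elim: p x => //= y p IH x /andP[xy pth]; rewrite !inE !negb_or => /and3P[ux uy up].
rewrite /cut xy (eq_sym x u) (eq_sym y u) (negPf ux) (negPf uy) /= andbF /=.
by apply: IH; rewrite // inE negb_or uy.
Qed.

(** * The sides a_r ([tail_side]) and b_r ([head_side]) of a request, and interference *)

Definition tail_side (r : dpath V) : {set V} :=
  half_space (emission_arc r).2 (emission_arc r).1.

Definition head_side (r : dpath V) : {set V} :=
  half_space (reception_arc r).1 (reception_arc r).2.

Lemma emission_arcT r : request T r -> T (emission_arc r).1 (emission_arc r).2.
Proof.
by case: r => s [|v p] //= /andP[/andP[/andP[]]].
Qed.

Lemma reception_arc_rcons (s : V) p t : reception_arc (s, rcons p t) = (last s p, t).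
Proof.
rewrite /reception_arc /target /verts size_rcons last_rcons -rcons_cons nth_rcons.
by rewrite [_.-1]/= [size (s :: p)]/= ltnSn -last_nth.
Qed.

Lemma reception_arcT r : request T r -> T (reception_arc r).1 (reception_arc r).2.
Proof.
case: r => s p; case/lastP: p => [|p t]; first by rewrite /request andbF.
rewrite reception_arc_rcons => /andP[/andP[/=]].
by rewrite rcons_path => /andP[].
Qed.

Lemma tail_sideE r : request T r ->
  tail_side r = ~: half_space (emission_arc r).1 (emission_arc r).2.
Proof. by move=> /emission_arcT /halfC. Qed.

Lemma target_emission r : request T r ->
  target r \in half_space (emission_arc r).1 (emission_arc r).2.
Proof.
case: r => s [|v p] //= /andP[/andP[/=/andP[sv pth] /andP[snp _]] _].
by rewrite inE; apply: (path_connect (path_cut v pth snp)); exact: (mem_last v p).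
Qed.

Lemma source_reception r : request T r -> source r \notin head_side r.
Proof.
case: r => s p; case/lastP: p => [|p t]; first by rewrite /request andbF.
rewrite /head_side reception_arc_rcons => /andP[/andP[]].
rewrite [path _ _ _]rcons_path [uniq _](rcons_uniq (s :: p) t).
move=> /andP[pth lt] /andP[tn _] _.
rewrite (halfC (u := t)) ?(symT t) // in_setC negbK inE connect_cut_sym.
by apply: (path_connect (path_cut (last s p) pth tn)); apply: mem_last.
Qed.

(** An interfering path has its target beyond the emission arc and its source outside
    [head_side r'], so [half_sub] applies. Conversely, with [(u, v)] the emission arc of [r] and
    [(x, y)] the reception arc of [r'], prepend [u] to a simple path from [v] to [y] avoiding the
    edge [uv]. *)
Lemma interferes_onP r r' : request T r -> request T r' ->
  interferes_on T r r' <-> tail_side r :&: head_side r' = set0.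
Proof.
move=> rT r'T; split=> [[q [qT sq tq eq rq]]|].
  apply/eqP; rewrite tail_sideE // setIC setI_eq0 disjoints_subset setCK.
  rewrite -eq /head_side -rq; apply: half_sub; last exact: source_reception.
  exact: target_emission.
move/eqP; rewrite tail_sideE // setIC setI_eq0 disjoints_subset setCK => sub.
have eT := emission_arcT rT; have fT := reception_arcT r'T.
move: eT sub; rewrite /head_side; set u := (emission_arc r).1.
set v := (emission_arc r).2; set x := (reception_arc r').1.
set y := (reception_arc r').2 => eT sub; rewrite -/x -/y in fT.
have yuv : y \in half_space u v by apply: (subsetP sub); apply: half_refl.
move: (yuv); rewrite inE => /connectP[p pth Ey].
case/shortenP: pth Ey => {}p pth up _ Ey.
have unp : u \notin v :: p.
  by apply: contra (half_out eT) => uin; rewrite inE; apply: (path_connect pth).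
have pT : path T v p by apply: sub_path pth => ? ? /and3P[].
have qT : request T (u, v :: p).
  apply/andP; split=> //.
  apply/andP; split; first by rewrite /= eT.
  by rewrite /verts cons_uniq unp.
exists (u, v :: p); split=> //.
have {}Ey : y = last u (v :: p) by [].
have [p' [t Ep]] : exists p' t, v :: p = rcons p' t.
  by exists (belast v p), (last v p); rewrite -lastI.
rewrite Ep last_rcons in qT Ey *.
rewrite reception_arc_rcons -Ey [RHS]surjective_pairing -/x -/y; congr (_, _).
have := reception_arcT qT; rewrite reception_arc_rcons /= -Ey => zy.
(* If the path entered [y] from another vertex than [x], it would link [u] to [y] without the edge
   [xy], putting [u] in [half_space x y] and hence beyond its own arc. *)
case: (eqVneq (last u p') x) => // zx.
have : u \notin half_space x y.
  by apply: contra (half_out eT) => /(subsetP sub).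
case/negP; rewrite inE connect_cut_sym.
case/andP: qT => /andP[]; rewrite [path _ _ _]rcons_path [uniq _](rcons_uniq (u :: p')) -Ey.
move=> /andP[pth' _] /andP[yn _] _.
apply: (@connect_trans _ _ (last u p')).
  rewrite (eq_connect (cutC x y)).
  by apply: (path_connect (path_cut x pth' yn)); apply: mem_last.
apply: connect1; rewrite /cut zy (negPf zx) /=.
by case: eqP => //= Ez; rewrite Ez irrT in zy.
Qed.

Lemma tail_head_disjoint r : request T r -> tail_side r :&: head_side r = set0.
Proof. by move=> rT; apply/(interferes_onP rT rT); exists r. Qed.


(** * Half-spaces as sets of labels *)

Section Rooted.
Variables (l : V -> nat) (g : nat -> V) (n : nat) (p out : nat -> nat).
Hypothesis lg : forall i, i < n -> l (g i) = i.
Hypothesis gl : forall x, g (l x) = x.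
Hypothesis l_lt : forall x, l x < n.
Hypothesis pp : preorder n p.
Hypothesis gT : forall i, 0 < i < n -> T (g (p i)) (g i).
Hypothesis ancP :
  forall v w, v < n -> w < n -> anc p v w <-> v <= w < out v.

Lemma parent_lt i : 0 < i < n -> p i < i.
Proof. by case: pp => _ H /H[]. Qed.

(** After removal of the edge above [v], each descendant of [v] still climbs to [v], and every other
    vertex still climbs to the root. *)
Lemma half_parent v : 0 < v < n ->
  half_space (g (p v)) (g v) = [set w | v <= l w < out v].
Proof.
move=> vn; have /andP[v0 vltn] := vn; have pv := parent_lt vn.
have E i j : i < n -> j < n -> (g i == g j) = (i == j).
  by move=> iN jN; apply/eqP/eqP => [/(congr1 l)|->//]; rewrite !lg.
have step i : 0 < i < n -> i != v -> cut (g (p v)) (g v) (g (p i)) (g i).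
  move=> iN iv; have ip := parent_lt iN; rewrite /cut gT //.
  rewrite !E ?(ltn_trans ip) ?(ltn_trans pv) //; lia.
apply/eqP; rewrite eqEsubset; apply/andP; split; apply/subsetP=> w; last first.
  rewrite inE => /(ancP vltn (l_lt w)) [k Ek].
  rewrite -[w]gl; move: (l w) (l_lt w) Ek; elim: k => [|k IH] i iN.
    by move=> /= ->; apply: half_refl.
  rewrite iterSr => Ek; have [->|iv] := eqVneq i v; first exact: half_refl.
  have i0 : 0 < i.
    case: (posnP i) Ek => // ->; case: pp => -> _ Ek.
    by have := iter_fix k (proj1 pp); rewrite Ek => v00; rewrite v00 in v0.
  have ip := parent_lt (i := i) ltac:(lia).
  have := IH (p i) ltac:(lia) Ek; rewrite !inE => /connect_trans; apply.
  by apply/connect1/step; rewrite ?i0.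
have root i : i < n -> ~ anc p v i -> connect (cut (g (p v)) (g v)) (g i) (g 0).
  elim/ltn_ind: i => i IH iN ni; have [->//|i0] := posnP i.
  have ip := parent_lt (i := i) ltac:(lia).
  apply: (@connect_trans _ _ (g (p i))).
    rewrite connect_cut_sym; apply/connect1/step; first by lia.
    by apply/eqP => Ei; apply: ni; rewrite Ei; apply: anc_refl.
  apply: IH; [by []|by lia|]; move=> an; apply: ni; apply: anc_trans an _.
  exact: anc_parent.
apply: contraTT => wo; rewrite -in_setC -halfC ?gT // inE.
rewrite (eq_connect (cutC _ _)) -[w]gl.
apply: (@connect_trans _ _ (g 0)); first (apply: root; first by lia).
  by move=> an; have := ancP vltn (ltn_trans pv vltn); case=> /(_ an); lia.
rewrite connect_cut_sym; apply: root => // /(ancP vltn (l_lt w)) H.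
by rewrite inE H in wo.
Qed.

(** If [xy] were not an edge to a parent, all edges to parents would survive its removal and join
    [x] and [y] through the root, against [half_out]. *)
Lemma tree_arc x y : T x y ->
  (0 < l y) && (x == g (p (l y))) || (0 < l x) && (y == g (p (l x))).
Proof.
move=> xy; apply/negPn/negP; rewrite negb_or => /andP[nxy nyx].
have root i : i < n -> connect (cut x y) (g i) (g 0).
  elim/ltn_ind: i => i IH iN; have [->//|i0] := posnP i.
  have ip := parent_lt (i := i) ltac:(lia).
  apply: (@connect_trans _ _ (g (p i))); last by apply: IH => //; lia.
  rewrite connect_cut_sym; apply: connect1; rewrite /cut gT ?i0 //=.
  apply/andP; split; apply/negP => /andP[/eqP Ex /eqP Ey].
    by move: nxy; rewrite -Ey lg // i0 Ex eqxx.
  by move: nyx; rewrite -Ey lg // i0 Ex eqxx.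
have root' z : connect (cut x y) z (g 0) by rewrite -[z]gl; apply: root.
have /negP[] := half_out xy; rewrite inE.
by apply: connect_trans (root' y) _; rewrite connect_cut_sym.
Qed.

(** This turns the cost of the search, linear in the number of arcs, into O(n). *)
Lemma size_arcs (A : seq (V * V)) : arc_list T A -> size A <= n + n.
Proof.
move=> [uA memA].
pose B := [seq (g (p i), g i) | i <- iota 0 n] ++ [seq (g i, g (p i)) | i <- iota 0 n].
have -> : n + n = size B by rewrite size_cat !size_map size_iota.
apply: uniq_leq_size => // -[x y]; rewrite memA => /tree_arc.
rewrite mem_cat => /orP[]/andP[_ /eqP E]; apply/orP; [left|right]; apply/mapP.
  by exists (l y); rewrite ?mem_iota ?gl -?E //= l_lt.
by exists (l x); rewrite ?mem_iota ?gl -?E //= l_lt.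
Qed.

(* The half-spaces as sets of labels: [k] tells a complement from a subtree. *)
Definition sector (k v w : nat) : bool :=
  if k == 0 then v <= w < out v else ~~ (v <= w < out v).

(* What the search for the first arc of [T[s, t]] returns, [s] and [t] being
   given by their labels. *)
Definition side_spec (s t k v : nat) : Prop :=
  if s <= t < out s then [/\ k = 1, 0 < v < n, p v = s & v <= t < out v]
  else k = 0 /\ v = s.

(** Here [s'] is the second vertex of the path to [t]. If it is a child of [s], the side is the
    complement of its subtree; otherwise it is the parent of [s], and the side is the subtree of
    [s]. *)
Lemma side_half s t s' k v : T s s' -> t \in half_space s s' ->
  side_spec (l s) (l t) k v ->
  0 < v < n /\ half_space s' s = [set w | sector k v (l w)].
Proof.
move=> ss' tin; rewrite /side_spec.
have arc x y : T x y -> 0 < l y -> x = g (p (l y)) ->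
    half_space x y = [set w | l y <= l w < out (l y)].
  by move=> xy y0 ->; rewrite -{2}[y]gl half_parent // y0 l_lt.
have /orP[/andP[s'0 /eqP Es]|/andP[s0 /eqP Es']] := tree_arc ss'.
  have H := arc _ _ ss' s'0 Es.
  have Ep : p (l s') = l s by rewrite Es lg // (ltn_trans (parent_lt _)) ?s'0 // l_lt.
  move: tin; rewrite H inE => ts'.
  have as' : anc p (l s) (l s') by rewrite -Ep; apply: anc_parent.
  have ast : anc p (l s) (l t) by apply: anc_trans as' _; apply/ancP.
  have /(ancP (l_lt s) (l_lt t)) -> := ast; move=> [-> v0 pv tv]; split=> //.
  (* Both are children of [s] with [t] below them; their intervals meet, so one would be an ancestor
     of the other. *)
  suff -> : v = l s'.
    by rewrite halfC // H; apply/setP=> w; rewrite !inE.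
  have vn : v < n by lia.
  have s'n := l_lt s'; have pvlt := parent_lt v0.
  have ps'lt : l s < l s' by rewrite -Ep; apply: parent_lt; lia.
  have [vs'|s'v] := leqP v (l s').
    have /anc_step[//|] : anc p v (l s') by apply/ancP => //; lia.
    by rewrite Ep => /(ancP vn (l_lt s)); lia.
  have /anc_step[//|] : anc p (l s') v by apply/ancP => //; lia.
  by rewrite pv => /(ancP s'n (l_lt s)); lia.
have H : half_space s' s = [set w | l s <= l w < out (l s)] by apply: arc => //; rewrite symT.
have -> : (l s <= l t < out (l s)) = false.
  by apply/negbTE; move: tin; rewrite -[half_space s s']setCK -halfC // H !inE.
by move=> [-> ->]; rewrite s0 l_lt H.
Qed.
End Rooted.
End HalfSpaces.

(** * Independent sets of at least three requests *)


Section ThreeRequests.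
(** [E i] stands for the complement of a_i and [F i] for b_i. Then [FE] says that a request
    interferes on itself, and [FEn] that distinct requests of [S] do not interfere. *)
Variables (V : finType) (I : eqType) (E F : I -> {set V}) (S : seq I).
Hypothesis FE : forall i, i \in S -> F i \subset E i.
Hypothesis FEn : forall i j, i \in S -> j \in S -> i != j -> ~~ (F j \subset E i).

Let Z b i := if b then E i else F i.

Hypothesis crossfree : forall b c i j, i \in S -> j \in S ->
  [\/ Z c j \subset Z b i, Z b i \subset Z c j,
      Z b i :&: Z c j = set0 | Z b i :|: Z c j = setT].

Let div (X Y : {set V}) := X :&: Y == set0.
Let conv (X Y : {set V}) := X :|: Y == setT.

Let divC X Y : div X Y = div Y X. Proof. by rewrite /div setIC. Qed.
Let convC X Y : conv X Y = conv Y X. Proof. by rewrite /conv setUC. Qed.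
Let divE X Y : div X Y = (X \subset ~: Y).
Proof. by rewrite /div setI_eq0 disjoints_subset. Qed.

(** No set of one index contains a set of another, so two such sets are disjoint ([div]) or cover
    the tree ([conv]), and the alternative spreads from one pair to all. If both conclusions fail,
    the [F] are pairwise disjoint and the [E] pairwise covering, which forces two equal [E]. *)
Lemma independent_three : uniq S -> 2 < size S ->
  (forall i j, i \in S -> j \in S -> i != j -> F i :|: F j = setT) \/
  (forall i j, i \in S -> j \in S -> i != j -> E i :&: E j = set0).
Proof.
have convE X Y : conv X Y = (~: X \subset Y).
  rewrite /conv -(inj_eq (@setC_inj V)) setCU setCT setI_eq0 disjoints_subset.
  by rewrite setCK.
have inc b c i j : i \in S -> j \in S -> i != j -> ~~ (Z b i \subset Z c j).
  move=> iS jS ij; apply: contra (FEn jS iS _) => [sub|]; last by rewrite eq_sym.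
  have ZE : Z c j \subset E j by case: c {sub} => //=; apply: FE.
  have FZ : F i \subset Z b i by case: b {sub} => //=; apply: FE.
  exact: subset_trans FZ (subset_trans sub ZE).
have dc b c i j : i \in S -> j \in S -> i != j ->
    div (Z b i) (Z c j) || conv (Z b i) (Z c j).
  move=> iS jS ij; have ji : j != i by rewrite eq_sym.
  case: (crossfree b c iS jS) => [s|s|/eqP e|/eqP e].
  - by case/negP: (inc c b j i jS iS ji).
  - by case/negP: (inc b c i j iS jS ij).
  - by rewrite /div e.
  - by rewrite /conv e orbT.
(* A set disjoint from X lies in any set that covers the tree together with X. *)
have trip b c d i j k : i \in S -> j \in S -> k \in S -> j != k ->
    div (Z b i) (Z c j) -> conv (Z b i) (Z d k) -> False.
  move=> iS jS kS jk; rewrite divC divE convE => s1 s2.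
  by case/negP: (inc c d j k jS kS jk); apply: subset_trans s1 s2.
have divt b c d i j k : i \in S -> j \in S -> k \in S -> i != k -> j != k ->
    div (Z b i) (Z c j) -> div (Z b i) (Z d k).
  move=> iS jS kS ik jk dv; have /orP[//|cv] := dc b d i k iS kS ik.
  by have := trip b c d i j k iS jS kS jk dv cv.
have convt b c d i j k : i \in S -> j \in S -> k \in S -> i != k -> j != k ->
    conv (Z b i) (Z c j) -> conv (Z b i) (Z d k).
  move=> iS jS kS ik jk cv; have /orP[dv|//] := dc b d i k iS kS ik.
  by have [] := trip b d c i k j iS kS jS _ dv cv; rewrite eq_sym.
have unif (R : rel I) : symmetric R ->
    (forall i j k, i \in S -> j \in S -> k \in S -> i != k -> j != k ->
       R i j -> R i k) ->
    forall i j, i \in S -> j \in S -> R i j ->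
    forall x y, x \in S -> y \in S -> x != y -> R x y.
  move=> symR Rt i j iS jS Rij x y xS yS xy.
  have [Ex|ix] := eqVneq i x.
    rewrite -Ex in xy *; have [<-//|jy] := eqVneq j y.
    exact: Rt iS jS yS xy jy Rij.
  have Rix : R i x by have [<-//|jx] := eqVneq j x; apply: Rt iS jS xS ix jx Rij.
  have [<-|iy] := eqVneq i y; first by rewrite symR.
  by apply: (Rt x i) => //; rewrite symR.
move=> uS sS.
have [/allP cF|/allPn[i iS /allPn[j jS]]] :=
    boolP (all (fun i => all (fun j => (i != j) ==> conv (F i) (F j)) S) S).
  left=> i j iS jS ij; have /allP/(_ j jS) := cF i iS.
  by rewrite ij => /eqP.
rewrite negb_imply => /andP[ij ncv].
have dF : forall x y, x \in S -> y \in S -> x != y -> div (F x) (F y).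
  apply: (unif (fun i j => div (F i) (F j)) _ _ i j) => //.
  - by move=> x y z; apply: (divt false false false).
  - by have := dc false false i j iS jS ij; rewrite /= (negPf ncv) orbF.
have [/allP dE|/allPn[i' iS' /allPn[j' jS']]] :=
    boolP (all (fun i => all (fun j => (i != j) ==> div (E i) (E j)) S) S).
  right=> x y xS yS xy; have /allP/(_ y yS) := dE x xS.
  by rewrite xy => /eqP.
rewrite negb_imply => /andP[ij' ndv].
have cE : forall x y, x \in S -> y \in S -> x != y -> conv (E x) (E y).
  apply: (unif (fun i j => conv (E i) (E j)) _ _ i' j') => //.
  - by move=> x y z; apply: (convt true true true).
  - by have := dc true true i' j' iS' jS' ij'; rewrite /= (negPf ndv).
case ES : S uS sS => [|x [|y [|z S']]] //= /and3P[].
rewrite !inE !negb_or => /and3P[xy xz _] /andP[yz _] _ _.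
have [xS yS zS] : [/\ x \in S, y \in S & z \in S].
  by rewrite ES !inE !eqxx ?orbT.
(* The third index [w] carries disjointness from [F z, F w] to [F z, E u], and covering from
   [E u, E w] to [E u, F z]. *)
have compl u w : u \in S -> w \in S -> u != w -> u != z -> w != z -> F z = ~: E u.
  move=> uS wS uw uz wz; apply/eqP; rewrite eqEsubset -divE -convE; apply/andP; split.
    apply: (divt false false true z w u) => //; try by rewrite eq_sym.
    by apply: dF => //; rewrite eq_sym.
  by apply: (convt true true false u w z) => //; apply: cE.
have Exy : E x = E y.
  by apply: setC_inj; rewrite -(compl x y) // -(compl y x) // eq_sym.
by have := inc true true x y xS yS xy; rewrite /= Exy subxx.
Qed.
End ThreeRequests.

(** * The sides of a request *)


(** Run when the scan of labels stands at the second end (register 3) of the request. Its first end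
    is a proper ancestor iff it is at most this label and its interval exceeds it; array 19 then
    gives the child on the way down. *)
Definition side_one : cmd :=
  Seq (SetReg 5 (Minus (Reg 4) (Const 1)))
  (Seq (SetReg 6 (Cell 15 (Reg 5)))
  (If (Minus (Plus (Reg 3) (Const 1)) (Reg 6))
      (If (Minus (Cell 12 (Reg 6)) (Reg 3))
          (Seq (SetCell 17 (Reg 5) (Const 1)) (SetCell 18 (Reg 5) (Cell 19 (Reg 6))))
          (Seq (SetCell 17 (Reg 5) (Const 0)) (SetCell 18 (Reg 5) (Reg 6))))
      (Seq (SetCell 17 (Reg 5) (Const 0)) (SetCell 18 (Reg 5) (Reg 6))))).

Definition side : cmd :=
  Seq (bucket 16 5 6 3 0 2)
      (For 3 0 (Seq (SetCell 19 (Cell 10 (Reg 3)) (Reg 3))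
                    (ForList 4 (Cell 5 (Reg 3)) 6 side_one))).

Section Side.
Variables (W n m : nat) (p out X Y : nat -> nat).
Hypothesis nW : n < W.
Hypothesis mW : m <= W.
Hypothesis pp : preorder n p.
Hypothesis outP : forall v, v < n -> v < out v <= n.
Hypothesis ancP :
  forall v w, v < n -> w < n -> anc p v w <-> v <= w < out v.
Hypothesis XY : forall i, i < m -> [/\ X i < n, Y i < n & X i != Y i].

(** For every proper ancestor [s] of [v], [cur s] is its child on the branch to [v]. *)
Definition current (cur : nat -> nat) (v : nat) : Prop :=
  forall s, s < v < out s -> [/\ 0 < cur s < n, p (cur s) = s & cur s <= v < out (cur s)].

(** Any ancestor of [v] strictly above [p v] is also above [v.-1]. As [p v] is an ancestor of
    [v.-1], the child leading to [v.-1] leads to [p v] and to [v] as well. *)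
Lemma current_step cur v : v < n -> (0 < v -> current cur v.-1) ->
  current (fun s => if s == p v then v else cur s) v.
Proof.
move=> vn cP s /andP[sv vs]; have sn := ltn_trans sv vn.
have [pv apv] : p v < v /\ anc p (p v) v.-1 by case: pp => _; apply; lia.
have pvn := ltn_trans pv vn; have v1n : v.-1 < n by lia.
case: eqP => [Es|/eqP ne].
  by split; [lia|by rewrite Es|by rewrite leqnn; case/andP: (outP vn)].
have /anc_step[?|asv] : anc p s v by apply/ancP => //; lia.
  by lia.
have spv : s < p v by move/(ancP sn pvn): asv; lia.
have [|c0 pc cv] := cP ltac:(lia) s; first by lia.
split=> //; have cn : cur s < n by lia.
have [cpv|pvc] := leqP (cur s) (p v); last first.
  have lp := (ancP pvn v1n).1 apv.
  have /anc_step[?|] : anc p (p v) (cur s) by apply/ancP => //; lia.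
    by lia.
  by rewrite pc => /(ancP pvn sn); lia.
apply/(ancP cn vn); apply: anc_trans (anc_parent p v).
by apply/(ancP cn pvn); lia.
Qed.

Lemma run_side s :
  reg s 0 = n -> reg s 2 = m -> arr s 10 =1 p -> (forall v, v < n -> arr s 12 v = out v) ->
  (forall i, i < m -> arr s 15 i = X i /\ arr s 16 i = Y i) ->
  run W side s (n * 8 + m * 12 + 6) (fun s' =>
    forall i, i < m -> side_spec n p out (X i) (Y i) (arr s' 17 i) (arr s' 18 i)).
Proof.
move=> s0 s2 pE oE xyE.
have keyB i : i < m -> arr s 16 i < n by move=> im; case: (xyE i im) => _ ->; case: (XY im).
have -> : n * 8 + m * 12 + 6 = (n * 3 + m * 4 + 4) + (n * 5 + m * 8 + 2) by lia.
apply: run_seq; apply: run_mono (@run_bucket W 16 5 6 3 0 2 n m s _ isT isT s0 s2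
  (ltnW nW) mW keyB (fun s' H => H)) => //.
move=> s1 [agr1 aga1] ch.
pose bk := bucket_of (arr s 16) m; have szb : \sum_(t < n) size (bk t) = m.
  exact: sum_bucket_of.
apply: (@run_le _ _ _ (\sum_(i < n) ((1 + (size (bk i) * (6 + 2) + 2)) + 2) + 2)).
- rewrite (eq_bigr (fun i : 'I_n => 5 + size (bk i) * 8)) => [|i _]; last by lia.
  by rewrite big_split /= -big_distrl /= szb sum_nat_const card_ord; lia.
apply: (@run_for _ _ _ _ n (fun i s' => (0 < i -> current (arr s' 19) i.-1) /\
  forall j, j < m -> Y j < i ->
    side_spec n p out (X j) (Y j) (arr s' 17 j) (arr s' 18 j))
  (fun i => 1 + (size (bk i) * (6 + 2) + 2))) => //.
- by rewrite agr1.
- exact: ltnW.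
- move=> v s' vn [agr aga] s3 s'0 [cP done].
  apply: run_seq; apply: (@run_wp _ (SetCell _ _ _)); split=> /=; first by lia.
  rewrite s3 aga //= aga1 // pE.
  have cP' := current_step vn cP; set cur := fun s => _ in cP'.
  apply: (@run_forlist _ _ _ _ _ (bk v) (fun l1 s'' =>
    forall j, j < m -> (Y j < v) || (j \in l1) ->
    side_spec n p out (X j) (Y j) (arr s'' 17 j) (arr s'' 18 j))) => //=.
  + rewrite s3 aga //; apply: (@eq_chain (arr s1 6)) => [j _|]; first by rewrite aga.
    exact: ch.
  + exact: bucket_of_lt.
  + by move=> j jm; rewrite orbF; apply: done.
  + move=> l1 k l2 s4 El [agr4 aga4] s44 I4.
    have : k \in bk v by rewrite El mem_cat mem_head orbT.
    rewrite mem_bucket_of => /andP[km /eqP Ek].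
    have [xk yk] := xyE k km; have [Xn Yn xy] := XY km; rewrite yk in Ek.
    apply: (@run_wp _ side_one) => /=.
    have A12 : arr s4 12 (X k) = out (X k) by rewrite aga4 //= aga // aga1 // oE.
    have A15 : arr s4 15 k = X k by rewrite aga4 //= aga // aga1 // xk.
    have A19 : arr s4 19 (X k) = cur (X k).
      by rewrite aga4 //= aga // /cur; case: eqP.
    have R3 : reg s4 3 = v by rewrite agr4 //= s3.
    have Q k' v' : side_spec n p out (X k) (Y k) k' v' ->
        forall j, j < m -> (Y j < v) || (j \in rcons l1 k) ->
        side_spec n p out (X j) (Y j) (if j == k then k' else arr s4 17 j)
          (if j == k then v' else arr s4 18 j).
      move=> sp j jm; rewrite mem_rcons inE.
      by case: eqP => [->//|_] /=; apply: I4.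
    rewrite s44 subn1 /= A15 R3 A12; split; first by lia.
    split; first by lia.
    split=> [le|gt].
      split=> [lt|ge].
        split; first by lia.
        rewrite A19.
        have [|c0 pc cv] := cP' (X k); first by lia.
        split; first by lia.
        move=> x; apply: Q; rewrite /side_spec Ek; by case: ifP => [_|]; [split|lia].
      split; first by lia.
      split; first by lia.
      move=> x; apply: Q; rewrite /side_spec Ek; by case: ifP => [|_]; [lia|split].
    split; first by lia.
    split; first by lia.
    move=> x; apply: Q; rewrite /side_spec Ek; by case: ifP => [|_]; [lia|split].
  + move=> s4 [agr4 aga4] I4; split.
      by move=> _ u uv; rewrite /= aga4 //=; apply: cP'.
    move=> j jm; rewrite ltnS leq_eqVlt => /predU1P[Ej|lt]; apply: I4 => //.
      by apply/orP; right; rewrite mem_bucket_of jm (xyE j jm).2 Ej eqxx.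
    by rewrite lt.
- move=> s' _ _ [_ H] i im; apply: H => //; by case: (XY im).
Qed.
End Side.

(** * Largest disjoint families *)


(** Array 24 records at [v] one more than the index of some request whose set is I(v), and 0 if
    there is none. *)
Definition disj_mark : cmd :=
  Seq (SetCell 26 (Reg 3) (Const 0))
      (If (Cell 17 (Reg 3))
          (SetCell 24 (Cell 18 (Reg 3)) (Plus (Reg 3) (Const 1))) Skip).

(** Labels are treated in decreasing order, array 25 counting the chosen labels from each label on.
    A difference of two entries tells whether I(v) contains a chosen label; if not, v is chosen. *)
Definition disj_scan : cmd :=
  Seq (SetReg 5 (Minus (Minus (Reg 0) (Const 1)) (Reg 3)))
  (Seq (SetCell 25 (Reg 5) (Cell 25 (Plus (Reg 5) (Const 1))))
  (If (Cell 24 (Reg 5))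
      (If (Minus (Cell 25 (Reg 5)) (Cell 25 (Cell 12 (Reg 5)))) Skip
          (Seq (SetCell 25 (Reg 5) (Plus (Cell 25 (Reg 5)) (Const 1)))
               (SetCell 26 (Minus (Cell 24 (Reg 5)) (Const 1)) (Const 1))))
      Skip)).

(** Register 10 keeps the number of chosen intervals, and register 9 the size of the family. A
    complement is added, at most once, when its I(v) contains all chosen labels. *)
Definition disj_extra : cmd :=
  If (Cell 17 (Reg 3)) Skip
  (If (Minus (Reg 9) (Reg 10)) Skip
  (If (Minus (Reg 10)
        (Minus (Cell 25 (Cell 18 (Reg 3))) (Cell 25 (Cell 12 (Cell 18 (Reg 3))))))
      Skip
      (Seq (SetCell 26 (Reg 3) (Const 1)) (SetReg 9 (Plus (Reg 10) (Const 1)))))).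

Definition disj : cmd :=
  Seq (For 3 0 (SetCell 24 (Reg 3) (Const 0)))
  (Seq (For 3 2 disj_mark)
  (Seq (SetCell 25 (Reg 0) (Const 0))
  (Seq (For 3 0 disj_scan)
  (Seq (Seq (SetReg 9 (Cell 25 (Const 0))) (SetReg 10 (Cell 25 (Const 0))))
       (For 3 2 disj_extra))))).

Section Disj.
Variables (W n m : nat) (out K V : nat -> nat).
Hypothesis nW : n < W.
Hypothesis mW : m < W.
Hypothesis n0 : 0 < n.
Hypothesis outP : forall v, v < n -> v < out v <= n.
Hypothesis laminar : forall u v, v < n -> v <= u < out v -> out u <= out v.
Hypothesis V_lt : forall i, i < m -> 0 < V i < n.

(** The complement of a side: a nonzero [K i] makes it the interval of [V i], and [K i = 0] the
    complement of that interval. *)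
Definition region (i w : nat) : bool := ~~ sector out (K i) (V i) w.

Definition apart (i j : nat) : Prop := forall w, w < n -> ~~ (region i w && region j w).

(** State when the labels from [z] on are done, [Ch] being the chosen ones. The last clause, that
    every interval seen contains a chosen label, yields optimality. *)
Definition scan_inv (has : nat -> nat) (z : nat) (Ch : seq nat)
    (sc sel : nat -> nat) : Prop :=
  [/\ uniq Ch /\ (forall x, x \in Ch -> z <= x < n /\ has x != 0),
      forall v, z <= v <= n -> sc v = count (fun x => v <= x) Ch,
      forall j, j < m -> (sel j != 0) = (V j \in Ch) && (has (V j) == j.+1),
      forall x y, x \in Ch -> y \in Ch -> x < y -> out x <= y
    & forall v, z <= v < n -> has v != 0 -> exists2 x, x \in Ch & v <= x < out v].

Definition has_spec (has : nat -> nat) : Prop :=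
  (forall v, has v != 0 -> [/\ (has v).-1 < m, K (has v).-1 != 0 & V (has v).-1 = v]) /\
  forall j, j < m -> K j != 0 -> has (V j) != 0.

Definition disj_post (sel : nat -> nat) (tot : nat) : Prop :=
  [/\ forall i j, i < m -> j < m -> i != j -> sel i != 0 -> sel j != 0 -> apart i j,
      tot = count (fun i => sel i != 0) (iota 0 m)
    & forall J, uniq J -> all (fun i => i < m) J ->
      (forall i j, i \in J -> j \in J -> i != j -> apart i j) -> size J <= tot].


Lemma count_ge (Ch : seq nat) u v : u <= v ->
  count (fun x => u <= x) Ch =
  count (fun x => u <= x < v) Ch + count (fun x => v <= x) Ch.
Proof. by move=> uv; elim: Ch => //= x Ch ->; lia. Qed.

Lemma scan_skip has z Ch sc sel sc' sel' :
  scan_inv has z.+1 Ch sc sel -> z < n ->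
  (forall v, sc' v = if v == z then sc z.+1 else sc v) -> sel' =1 sel ->
  (has z != 0 -> exists2 x, x \in Ch & z <= x < out z) ->
  scan_inv has z Ch sc' sel'.
Proof.
move=> [[uC cC] scE selE dC mC] zn sc'E sel'E cov; split=> //.
- by split=> // x /cC[]; lia.
- move=> v zv; rewrite sc'E; case: eqP => [->|ne]; last by apply: scE; lia.
  rewrite scE; last by lia.
  by apply: eq_in_count => x /cC[]; lia.
- by move=> j jm; rewrite sel'E selE.
- move=> v zv; case: (eqVneq v z) => [->|ne]; first exact: cov.
  by apply: mC; lia.
Qed.

Lemma scan_add has z Ch sc sel sc' sel' :
  has_spec has ->
  scan_inv has z.+1 Ch sc sel -> z < n ->
  (forall v, sc' v = if v == z then sc z.+1 + 1 else sc v) ->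
  has z != 0 ->
  (forall j, sel' j = if j == (has z).-1 then 1 else sel j) ->
  (forall x, x \in Ch -> out z <= x) ->
  scan_inv has z (z :: Ch) sc' sel'.
Proof.
move=> [hS _] [[uC cC] scE selE dC mC] zn sc'E hz sel'E cov.
have [hm _ hV] := hS z hz.
split.
- split; first by rewrite cons_uniq uC andbT; apply/negP => /cC[]; lia.
  by move=> x; rewrite inE => /predU1P[->|/cC[]]; [split; lia|split; lia].
- move=> v zv; rewrite sc'E /=; case: eqP => [->|ne].
    rewrite scE ?leqnn; last by lia.
    by rewrite addnC; congr (_ + _); apply: eq_in_count => x /cC[]; lia.
  by rewrite scE; lia.
- move=> j jm; rewrite sel'E inE; have [->|ne] := eqVneq j (has z).-1.
    by rewrite hV eqxx prednK ?lt0n // eqxx.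
  rewrite selE //; case: (eqVneq (V j) z) => [Ez|//] /=.
  have -> : (has (V j) == j.+1) = false by apply/negbTE; rewrite Ez; lia.
  by rewrite andbF.
- move=> x y; rewrite !inE => /predU1P[->|xC] /predU1P[->|yC] xy.
  + by lia.
  + exact: cov.
  + by have [] := cC x xC; lia.
  + exact: dC.
- move=> v zv; case: (eqVneq v z) => [->|ne] hv.
    by exists z; rewrite ?mem_head ?leqnn //; case/andP: (outP zn).
  have [|x xC xv] := mC v _ hv; first by lia.
  by exists x; rewrite ?inE ?xC ?orbT.
Qed.

Definition inside (sc : nat -> nat) (i : nat) : nat := sc (V i) - sc (out (V i)).

Definition extra_inv (has sc : nat -> nat) (Ch : seq nat) (i : nat)
    (sel : nat -> nat) (tot : nat) : Prop :=
  (tot = size Ch /\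
   (forall j, j < m -> (sel j != 0) = (V j \in Ch) && (has (V j) == j.+1)) /\
   forall j, j < i -> K j = 0 -> inside sc j < size Ch) \/
  (tot = (size Ch).+1 /\ exists e, [/\ e < m, K e = 0, size Ch <= inside sc e &
   forall j, j < m -> (sel j != 0) = (V j \in Ch) && (has (V j) == j.+1) || (j == e)]).

(** In a disjoint family, each interval owns a chosen label, so there are at most [size Ch]
    intervals. All complements contain the label 0, so there is at most one; next to the complement
    of I(v), the intervals lie in I(v), and only the chosen labels there are available. *)
Lemma extra_post has sc Ch sel0 sel tot :
  has_spec has -> scan_inv has 0 Ch sc sel0 -> extra_inv has sc Ch m sel tot ->
  disj_post sel tot.
Proof.
move=> [hS1 hS2] [[uC cC] scE selE0 dC mC] ex.
have insE j : j < m -> inside sc j = count (fun x => V j <= x < out (V j)) Ch.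
  move=> jm; have Vj := V_lt jm; have := @outP (V j) ltac:(lia) => oV.
  by rewrite /inside !scE ?(@count_ge _ (V j) (out (V j))); lia.
have regS j w : K j != 0 -> region j w = (V j <= w < out (V j)).
  by move=> Kj; rewrite /region /sector (negPf Kj) negbK.
have regC j w : K j = 0 -> region j w = ~~ (V j <= w < out (V j)).
  by move=> Kj; rewrite /region /sector Kj.
pose ch j := (V j \in Ch) && (has (V j) == j.+1).
have chK j : ch j -> K j != 0.
  move=> /andP[VC /eqP hV]; have [|_] := hS1 (V j); first by rewrite hV.
  by rewrite hV.
have chdisj i j : i < m -> j < m -> i != j -> ch i -> ch j -> apart i j.
  move=> im jm ij ci cj w wn; rewrite !regS ?chK //.
  have /andP[Vi /eqP hi] := ci; have /andP[Vj /eqP hj] := cj.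
  have := dC _ _ Vi Vj; have := dC _ _ Vj Vi.
  have [E|ne] := eqVneq (V i) (V j); last by lia.
  by move: hi; rewrite E hj; lia.
(* Requests with equal intervals share a label; [has] selects exactly one of them. *)
have szch : count ch (iota 0 m) = size Ch.
  rewrite -size_filter -(size_map (fun x => (has x).-1) Ch); apply/perm_size/uniq_perm.
  - by rewrite filter_uniq // iota_uniq.
  - rewrite map_inj_in_uniq // => x y xC yC /= E.
    have [_ hx] := cC x xC; have [_ hy] := cC y yC.
    have [_ _ Vx] := hS1 x hx; have [_ _ Vy] := hS1 y hy.
    by rewrite -Vx E Vy.
  - move=> j; rewrite mem_filter mem_iota /= add0n; apply/idP/mapP.
      by move=> /andP[/andP[VC /eqP hj] jm]; exists (V j); rewrite ?hj.
    move=> [x xC ->]; have [_ hx] := cC x xC; have [hm _ Vx] := hS1 x hx.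
    by rewrite hm andbT /ch Vx xC prednK ?lt0n ?eqxx.
have root j : j < m -> K j = 0 -> region j 0.
  by move=> jm Kj; rewrite regC //; have := V_lt jm; lia.
(* The predicate [b] localises the intervals of [J]: it will be everything, or the interval of the
   complement in the family. *)
have bound J (b : pred nat) : uniq J -> all (fun i => i < m) J ->
    (forall i j, i \in J -> j \in J -> i != j -> apart i j) ->
    (forall i, i \in J -> K i != 0) ->
    (forall i x, i \in J -> V i <= x < out (V i) -> b x) ->
    size J <= count b Ch.
  move=> uJ /allP Jm dJ KJ bJ.
  have rep i : i \in J -> exists x, (x \in Ch) && (V i <= x < out (V i)).
    move=> iJ; have im := Jm i iJ.
    have [||x xC xi] := mC (V i); [by have := V_lt im; lia| |].
      by apply: hS2 => //; apply: KJ.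
    by exists x; rewrite xC.
  pose rp i := if (i \in J) =P true is ReflectT h then xchoose (rep i h) else 0.
  have rpP i : i \in J -> (rp i \in Ch) && (V i <= rp i < out (V i)).
    by rewrite /rp; case: eqP => // h _; apply: (xchooseP (rep i h)).
  rewrite -size_filter -(size_map rp); apply: uniq_leq_size.
    rewrite map_inj_in_uniq // => i j iJ jJ E; apply/eqP/negPn/negP=> ij.
    have /andP[iC iI] := rpP i iJ; have /andP[_ jI] := rpP j jJ.
    have rn : rp i < n by case: (cC _ iC); lia.
    by have := dJ i j iJ jJ ij _ rn; rewrite !regS ?KJ // iI E jI.
  move=> _ /mapP[i iJ ->]; have /andP[iC iI] := rpP i iJ.
  by rewrite mem_filter iC (bJ i).
have optS J : uniq J -> all (fun i => i < m) J ->
    (forall i j, i \in J -> j \in J -> i != j -> apart i j) ->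
    size J <= size Ch \/ exists e, [/\ e < m, K e = 0 & size J <= (inside sc e).+1].
  move=> uJ Jm dJ; have [/allP KJ|/allPn[e eJ]] := boolP (all (fun i => K i != 0) J).
    by left; rewrite -(count_predT Ch); apply: bound.
  rewrite negbK => /eqP Ke; right; exists e.
  have em := allP Jm e eJ; split=> //; rewrite insE // (perm_size (perm_to_rem eJ)) /= ltnS.
  have memJ i : i \in rem e J -> i \in J /\ i != e.
    by rewrite mem_rem_uniq // inE => /andP[].
  have KJ i : i \in rem e J -> K i != 0.
    move=> /memJ[iJ ie]; apply/negP => /eqP Ki; have im := allP Jm i iJ.
    by have := dJ i e iJ eJ ie 0 n0; rewrite !root.
  apply: bound => //.
  - exact: rem_uniq.
  - by apply/allP => i /memJ[iJ _]; apply: (allP Jm).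
  - by move=> i j /memJ[iJ _] /memJ[jJ _]; apply: dJ.
  - move=> i x iJ' xi; have [iJ ie] := memJ i iJ'; have im := allP Jm i iJ.
    have xn : x < n by have := @outP (V i); have := V_lt im; lia.
    have := dJ i e iJ eJ ie x xn; rewrite regS ?KJ // regC // xi /=.
    by rewrite negbK.
have insle j : j < m -> inside sc j <= size Ch by move=> jm; rewrite insE // count_size.
case: ex => [[-> [selE lt]]|[-> [e [em Ke ge selE]]]].
  split.
  - by move=> i j im jm ij; rewrite !selE //; apply: chdisj.
  - rewrite -szch; apply: eq_in_count => j; rewrite mem_iota add0n => /andP[_ jm].
    by rewrite selE.
  - move=> J uJ Jm dJ; have [//|[e [em Ke le]]] := optS J uJ Jm dJ.
    by apply: leq_trans le _; apply: lt.
have eN : ~~ ch e by apply/negP=> /chK; rewrite Ke.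
(* All chosen labels lie in the interval of [e]; by laminarity so do their whole intervals. *)
have allin : all (fun x => V e <= x < out (V e)) Ch.
  by rewrite all_count -insE // eqn_leq insle.
have che j : j < m -> ch j -> apart j e.
  move=> jm cj w wn; have /andP[VC _] := cj.
  rewrite regS ?chK // regC //; have := allP allin _ VC => /= Vj.
  have := @laminar (V j) (V e) _ Vj; have := V_lt em; lia.
split.
- move=> i j im jm ij; rewrite !selE // => /orP[ci|/eqP Ei] /orP[cj|/eqP Ej].
  + exact: chdisj.
  + by rewrite Ej; apply: che.
  + by rewrite Ei => w wn; rewrite andbC; apply: che.
  + by rewrite Ei Ej eqxx in ij.
- rewrite -szch [RHS](eq_in_count (a2 := predU (pred1 e) ch)); last first.
    by move=> j; rewrite mem_iota add0n /= => jm; rewrite selE // orbC.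
  have := count_predUI (pred1 e) ch (iota 0 m).
  rewrite (count_uniq_mem _ (iota_uniq _ _)) mem_iota add0n em /=.
  rewrite [X in _ + X](_ : _ = 0); first by lia.
  by apply/eqP; rewrite -leqn0 leqNgt -has_count; apply/hasPn => j _ /=; apply/negP => /andP[/eqP ->]; rewrite (negPf eN).
- move=> J uJ Jm dJ; have [le|[e' [em' _ le]]] := optS J uJ Jm dJ; first by lia.
  by have := insle e' em'; lia.
Qed.


Lemma scan_size has z Ch sc sel : scan_inv has z Ch sc sel -> size Ch <= n - z.
Proof.
move=> [[uC cC] _ _ _ _]; rewrite -(size_iota z (n - z)); apply: uniq_leq_size => // x xC.
by rewrite mem_iota; case: (cC x xC); lia.
Qed.

Lemma run_disj_scan has i Ch s : has_spec has -> i < n ->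
  reg s 0 = n -> reg s 3 = i -> (forall v, v < n -> arr s 24 v = has v) ->
  (forall v, v < n -> arr s 12 v = out v) ->
  scan_inv has (n - i) Ch (arr s 25) (arr s 26) ->
  run W disj_scan s 6 (fun s' => exists Ch', scan_inv has (n - i.+1) Ch' (arr s' 25) (arr s' 26)).
Proof.
move=> hS iN s0 s3 hE oE inv; apply: (@run_wp _ disj_scan) => /=.
rewrite s0 s3; set z := n - 1 - i; have zn : z < n by lia.
have Ez : n - i.+1 = z by lia.
have Ez1 : n - i = z.+1 by lia.
rewrite Ez1 Ez in inv *.
have szC := scan_size inv; have [[uC cC] scE _ _ _] := inv.
have oz := outP zn.
rewrite !eqxx oE // addn1 hE // (_ : (out z == z) = false); last by lia.
split; first by lia.
have scz : arr s 25 z.+1 <= size Ch by rewrite scE ?count_size; lia.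
split; first by rewrite ltnW // (leq_ltn_trans scz) //; lia.
(* The tested difference is thus the number of chosen labels strictly below [z]. *)
have cnt : arr s 25 z.+1 = count (fun x => z < x < out z) Ch + arr s 25 (out z).
  by rewrite !scE ?(@count_ge _ z.+1 (out z)) //; lia.
split=> [hz|hz].
  split=> [cov|ncov].
    exists Ch; apply: (scan_skip inv zn) => // _.
    have /hasP[x xC xz] : seq.has (fun x => z < x < out z) Ch by rewrite has_count; lia.
    by exists x => //; lia.
  split; first by lia.
  split; first by lia.
  exists (z :: Ch); apply: (scan_add hS inv zn) => //=.
  - by move=> v; case: (v == z).
  - by move=> j; rewrite subn1.
  - move=> x xC; rewrite leqNgt; apply/negP => xo.
    have : seq.has (fun x => z < x < out z) Ch.
      by apply/hasP; exists x => //; case: (cC x xC); lia.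
    by rewrite has_count; lia.
by exists Ch; apply: (scan_skip inv zn) => //; rewrite hz.
Qed.

Lemma run_disj s :
  reg s 0 = n -> reg s 2 = m -> (forall v, v < n -> arr s 12 v = out v) ->
  (forall i, i < m -> arr s 17 i = K i) -> (forall i, i < m -> arr s 18 i = V i) ->
  run W disj s (n * 11 + m * 12 + 11) (fun s' => disj_post (arr s' 26) (reg s' 9)).
Proof.
move=> s0 s2 oE KE VE; have -> : n * 11 + m * 12 + 11 = (n * (1 + 2) + 2) +
  ((m * (3 + 2) + 2) + (1 + ((n * (6 + 2) + 2) + (2 + (m * (5 + 2) + 2))))) by lia.
apply: run_seq; apply: (@run_for_const _ _ _ _ n (fun i s' =>
  forall v, v < i -> arr s' 24 v = 0)) => //; first exact: ltnW.
  move=> i s' iN ag s3 _ I0; apply: (@run_wp _ (SetCell _ _ _)); split=> //= v vi.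
  by rewrite s3; case: eqP => // ne; apply: I0; lia.
move=> s1 [agr1 aga1] _ z1.
apply: run_seq; apply: (@run_for_const _ _ _ _ m (fun i s' =>
  (forall v, v < n -> arr s' 24 v != 0 -> [/\ (arr s' 24 v).-1 < i,
     K (arr s' 24 v).-1 != 0 & V (arr s' 24 v).-1 = v]) /\
  forall j, j < i -> arr s' 26 j = 0 /\ (K j != 0 -> arr s' 24 (V j) != 0))) => //.
- by rewrite agr1.
- exact: ltnW.
- by split=> // v vn; rewrite z1.
- move=> i s' im [agr aga] s3 s2' [I1 I2]; apply: (@run_wp _ disj_mark) => /=.
  have K' : arr s' 17 i = K i by rewrite aga // aga1 // KE.
  have V' : arr s' 18 i = V i by rewrite aga // aga1 // VE.
  rewrite s3 K' V'; split=> //; split=> [Ki|Ki].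
    split; first by lia.
    split=> [v vn|j ji] /=.
      case: (eqVneq v (V i)) => [->|_]; first by rewrite addn1.
      by move=> /(I1 v vn)[? ? ?]; split=> //; lia.
    rewrite addn1; have [->|ne] := eqVneq j i; first by rewrite eqxx.
    by have [|-> H] := I2 j; [lia|split=> // /H; case: (V j == V i)].
  split=> [v vn|j ji] /=; first by move=> /(I1 v vn)[? ? ?]; split=> //; lia.
  have [->|ne] := eqVneq j i; first by rewrite Ki.
  by apply: I2; lia.
move=> s3 [agr3 aga3] _ [h1 h2].
(* Only the first [n] cells have been cleared; beyond them the table is read as empty. *)
pose has v := if v < n then arr s3 24 v else 0.
have hS : has_spec has.
  split=> [v|j jm Kj]; rewrite /has; first by case: ifP => // vn; apply: h1.
  by have [_ ->] := andP (V_lt jm); have [_] := h2 j jm; apply.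
have a12 v : v < n -> arr s3 12 v = out v by move=> vn; rewrite aga3 // aga1 // oE.
(* The cell at [n] is a sentinel, read for the intervals ending at [n]. *)
apply: run_seq; apply: (@run_wp _ (SetCell _ _ _)); split=> //=.
rewrite agr3 // agr1 // s0.
apply: run_seq; apply: (@run_for_const _ _ _ _ n (fun i s' =>
  exists Ch, scan_inv has (n - i) Ch (arr s' 25) (arr s' 26))) => //.
- by rewrite /= agr3 // agr1.
- exact: ltnW.
- exists [::]; rewrite subn0; split=> //=.
  + by move=> v nv; rewrite (_ : v == n) //; lia.
  + by move=> j jm; have [->] := h2 j jm.
  + by move=> v; lia.
- move=> i s' iN [agr aga] s3' s0' [Ch inv].
  apply: run_mono (run_disj_scan hS iN s0' s3' _ _ inv) => //.
  + by move=> v vn; rewrite aga //= /has vn.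
  + by move=> v vn; rewrite aga //= a12.
move=> s4 [agr4 aga4] _ [Ch]; rewrite subnn => inv.
have szC := scan_size inv; rewrite subn0 in szC.
have [[uC cC] scE selE _ _] := inv.
have sc0 : arr s4 25 0 = size Ch by rewrite scE // count_predT.
apply: run_seq; apply: (@run_wp _ (Seq _ _)) => /=; rewrite sc0.
split; first by lia.
split; first by lia.
apply: (@run_for_const _ _ _ _ m (fun i s' =>
  extra_inv has (arr s4 25) Ch i (arr s' 26) (reg s' 9))) => //.
- by rewrite /= agr4 //= agr3 // agr1.
- exact: ltnW.
- by left.
- move=> i s' im [agr aga] s3' s2' ex; apply: (@run_wp _ disj_extra) => /=.
  have K' : arr s' 17 i = K i by rewrite aga //= aga4 //= aga3 // aga1 // KE.
  have V' : arr s' 18 i = V i by rewrite aga //= aga4 //= aga3 // aga1 // VE.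
  have Vi := V_lt im.
  have O' : arr s' 12 (V i) = out (V i) by rewrite aga //= aga4 //= a12 //; lia.
  have T' : reg s' 10 = size Ch by rewrite agr.
  rewrite s3' K' V' O' T' !(aga 25) //= -/(inside (arr s4 25) i).
  have skip : (reg s' 9 = size Ch -> K i = 0 -> inside (arr s4 25) i < size Ch) ->
      extra_inv has (arr s4 25) Ch i.+1 (arr s' 26) (reg s' 9).
    case: ex => [[E [sE lt]] H|]; last by right.
    left; split=> //; split=> // j; rewrite ltnS leq_eqVlt => /predU1P[->|]; last exact: lt.
    exact: H.
  split=> [Ki|Ki]; first by apply: skip => _ K0; rewrite K0 in Ki.
  split=> [Ti|Ti]; first by apply: skip; lia.
  split=> [Ii|Ii]; first by apply: skip; lia.
  split; first by lia.
  split; first by lia.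
  right; split; first by rewrite addn1.
  exists i; split=> //; first by lia.
  move=> j jm; case: ex => [[_ [sE _]]|[E _]]; last by lia.
  by rewrite /=; case: (j == i) => /=; rewrite ?orbT // orbF sE.
- by move=> s5 _ _; apply: extra_post hS inv.
Qed.

End Disj.

(** * Counting dominated points *)


(** Climbs from the leaf to the root 1 and stops at its half, 0. Array 34 replaces division by 2. *)
Definition tree_insert (e : expr) : cmd :=
  Seq (SetReg 15 (Plus (Reg 11) e))
      (While (Reg 15)
        (Seq (SetCell 35 (Reg 15) (Plus (Cell 35 (Reg 15)) (Const 1)))
             (SetReg 15 (Cell 34 (Reg 15))))).

(** The test computes the parity of the node: an odd node is a right child, and the counter of its
    left sibling is added. *)
Definition tree_rank (e : expr) : cmd :=
  Seq (Seq (SetReg 15 (Plus (Reg 11) e)) (SetReg 16 (Const 0)))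
      (While (Minus (Reg 15) (Const 1))
        (Seq (If (Minus (Minus (Reg 15) (Cell 34 (Reg 15))) (Cell 34 (Reg 15)))
                 (SetReg 16 (Plus (Reg 16) (Cell 35 (Minus (Reg 15) (Const 1)))))
                 Skip)
             (SetReg 15 (Cell 34 (Reg 15))))).

Definition dom_query : cmd :=
  Seq (tree_rank (Cell 39 (Minus (Reg 4) (Const 1))))
      (SetCell 42 (Minus (Reg 4) (Const 1)) (Reg 16)).

Definition dom_insert : cmd := tree_insert (Cell 37 (Minus (Reg 4) (Const 1))).

(** At each key, queries come before insertions, so that domination is strict in both
    coordinates. *)
Definition dom : cmd :=
  Seq (For 3 12 (SetCell 35 (Reg 3) (Const 0)))
  (Seq (bucket 36 5 6 3 13 14)
  (Seq (bucket 38 40 41 3 13 14)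
       (For 3 13 (Seq (ForList 4 (Cell 40 (Reg 3)) 41 dom_query)
                      (ForList 4 (Cell 5 (Reg 3)) 6 dom_insert))))).

Section Dom.
Variables (W H M B : nat) (key val qk qv : nat -> nat).
Let N := 2 ^ H.
Hypothesis NW : N + N <= W.
Hypothesis MW : M * H.+2 < W.
Hypothesis BW : B <= W.
Hypothesis key_lt : forall k, k < M -> key k < B.
Hypothesis qk_lt : forall k, k < M -> qk k < B.
Hypothesis val_lt : forall k, k < M -> val k < N.
Hypothesis qv_lt : forall k, k < M -> qv k < N.

(** The ancestor at height [l] of the leaf of [x], in the numbering where [j] is the parent of [2j]
    and [2j + 1]. *)
Definition node (x l : nat) : nat := (N + x) %/ 2 ^ l.

(* In the array [f], each node of the complete binary tree with leaves
   [N, ..., 2N - 1] counts the elements of [ins] below it. *)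
Definition tree_of (ins : seq nat) (f : nat -> nat) : Prop :=
  forall j, 0 < j < N + N ->
    f j = \sum_(x <- ins) \sum_(l < H.+1) (node x l == j).

Definition halves (f : nat -> nat) : Prop := forall j, j < N + N -> f j = j./2.

Lemma N_gt0 : 0 < N. Proof. by rewrite expn_gt0. Qed.

Lemma nodeS x l : node x l.+1 = (node x l)./2.
Proof. by rewrite /node expnS mulnC divnMA divn2. Qed.

Lemma node_lt x l : x < N -> node x l < N + N.
Proof. by move=> xN; apply: leq_ltn_trans (leq_div _ _) _; lia. Qed.

Lemma node_bounds x l : x < N -> l <= H -> 2 ^ (H - l) <= node x l < 2 ^ (H - l).+1.
Proof.
move=> xN lH; have E : N = 2 ^ (H - l) * 2 ^ l by rewrite -expnD subnK.
have l0 : 0 < 2 ^ l by rewrite expn_gt0.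
by rewrite leq_divRL // ltn_divLR // expnS -mulnA -E; lia.
Qed.

Lemma node_level x l l' : x < N -> l <= H -> l' <= H ->
  2 ^ (H - l') <= node x l < 2 ^ (H - l').+1 -> l = l'.
Proof.
move=> xN lH l'H /andP[c d]; have /andP[a b] := node_bounds xN lH.
have := leq_ltn_trans a d; have := leq_ltn_trans c b.
by rewrite !ltn_exp2l //; lia.
Qed.

Lemma node_top x : x < N -> node x H = 1 /\ node x H.+1 = 0.
Proof.
move=> xN; have := node_bounds xN (leqnn H); rewrite subnn nodeS => b.
by have -> : node x H = 1 by lia.
Qed.

Lemma node_gt0 x l : x < N -> l <= H -> 0 < node x l.
Proof.
move=> xN lH; have /andP[a _] := node_bounds xN lH.
by apply: leq_trans a; rewrite expn_gt0.
Qed.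

(** An element contributes at most one per level. The summand [M] leaves room for the increment of
    an insertion. *)
Lemma tree_of_le ins f j : tree_of ins f -> size ins <= M -> 0 < j < N + N ->
  f j + M <= M * H.+2.
Proof.
move=> tf sM jN; rewrite tf // mulnS addnC leq_add2l.
apply: (@leq_trans (\sum_(x <- ins) H.+1)); last first.
  by rewrite big_const_seq count_predT iter_addn_0 [M * _]mulnC leq_mul.
apply: leq_sum => x _; apply: (@leq_trans (\sum_(l < H.+1) 1)).
  by apply: leq_sum => l _; case: eqP.
by rewrite sum_nat_const card_ord muln1.
Qed.

Lemma run_insert e x ins s :
  reg s 11 = N -> eval s e = x -> x < N -> halves (arr s 34) ->
  tree_of ins (arr s 35) -> size ins < M ->
  run W (tree_insert e) s (H * 3 + 5) (fun s' => tree_of (x :: ins) (arr s' 35)).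
Proof.
move=> sN ex xN hv tr sz; have -> : H * 3 + 5 = 1 + (H * 3 + 4) by lia.
apply: run_seq; apply: (@run_wp _ (SetReg _ _)) => /=; rewrite sN ex.
split; first by lia.
apply: (@run_while _ _ _ (fun b s' => exists l, [/\ l <= H.+1, b = 1 + (H.+1 - l) * 3,
  reg s' 15 = node x l, halves (arr s' 34) &
  forall j, 0 < j < N + N -> arr s' 35 j = arr s 35 j + \sum_(i < l) (node x i == j)])).
- exists 0; split=> //=; [by lia|by rewrite /node divn1|].
  by move=> j jN; rewrite big_ord0 addn0.
- move=> b s' [l [lH -> r15 _ Hs]] /=; rewrite r15 => n0.
  have {}n0 : l = H.+1.
    apply/eqP; rewrite eqn_leq lH ltnNge; apply/negP => lH'.
    by have := node_gt0 xN lH'; rewrite n0.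
  split; first by lia.
  by move=> j jN; rewrite Hs // big_cons -tr // n0 addnC.
- move=> b s' [l [lH -> r15 hv' Hs]] /=; rewrite r15 => n0.
  have {}lH : l <= H.
    move: n0; rewrite leqNgt; apply: contraNN => lH'.
    by have -> : l = H.+1 by [lia]; case: (node_top xN) => _ ->.
  exists 2, (1 + (H.+1 - l.+1) * 3); split; first by lia.
  have nN : 0 < node x l < N + N by rewrite lt0n n0 node_lt.
  apply: (@run_wp _ (Seq _ _)) => /=; rewrite r15 hv' ?node_lt //.
  split.
    rewrite Hs //; have := tree_of_le tr (ltnW sz) nN.
    have : \sum_(i < l) (node x i == node x l) = 0.
      apply: big1 => i _; have il := ltn_ord i; case: eqP => // E.
      have := @node_level x i l xN _ lH; rewrite E node_bounds // => Ei.
      by have := Ei ltac:(lia) isT; lia.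
    by move=> ->; lia.
  split; first by have := node_lt l xN; lia.
  exists l.+1; split=> //; first by rewrite nodeS.
  move=> j jN /=; rewrite big_ord_recr /= Hs // (eq_sym (node x l)).
  by case: eqP => [->|_]; rewrite ?Hs // ?addn0 // addnA.
Qed.

Lemma run_rank e q ins s :
  reg s 11 = N -> eval s e = q -> q < N -> halves (arr s 34) ->
  tree_of ins (arr s 35) -> all (fun x => x < N) ins -> size ins <= M ->
  run W (tree_rank e) s (H * 4 + 3)
    (fun s' => reg s' 16 = count (fun x => x < q) ins).
Proof.
move=> sN eq qN hv tr insN sz; have -> : H * 4 + 3 = 2 + (H * 4 + 1) by lia.
apply: run_seq; apply: (@run_wp _ (Seq _ _)) => /=; rewrite sN eq.
split; first by lia.
split=> //.
(* The elements still to be counted are those whose ancestor at height [l] is strictly to the left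
   of that of [q]; at the root none is left. *)
apply: (@run_while _ _ _ (fun b s' => exists l, [/\ l <= H, b = 1 + (H - l) * 4,
  reg s' 15 = node q l, arr s' 34 =1 arr s 34 /\ arr s' 35 =1 arr s 35 &
  reg s' 16 + count (fun x => node x l < node q l) ins = count (fun x => x < q) ins])).
- exists 0; split=> //=; [by lia|by rewrite /node divn1|].
  by rewrite add0n; apply: eq_count => x; rewrite /node !divn1 ltn_add2l.
- move=> b s' [l [lH -> r15 _ Hs]] /=; rewrite r15 => n0.
  split; first by lia.
  rewrite -Hs (_ : count _ _ = 0) ?addn0 //; apply/eqP; rewrite -leqn0 leqNgt -has_count.
  apply/hasPn => x xi; have xN := allP insN x xi.
  by have := node_gt0 xN lH; lia.
- move=> b s' [l [lH -> r15 [hv' tr'] Hs]] /=; rewrite r15 => n0.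
  have {}lH : l < H.
    rewrite ltn_neqAle lH andbT; apply: contraNneq n0 => ->.
    by case: (node_top qN) => ->.
  exists 3, (1 + (H - l.+1) * 4); split; first by lia.
  apply: (@run_wp _ (Seq _ _)) => /=; rewrite r15 hv' hv ?node_lt //.
  have nq := node_lt l qN.
  (* Passing to parents loses exactly the elements below the left sibling of [node q l], which
     exists when this node is odd. *)
  have cntS : count (fun x => node x l < node q l) ins =
    (if odd (node q l) then arr s 35 (node q l - 1) else 0) +
    count (fun x => node x l.+1 < node q l.+1) ins.
    have -> : (if odd (node q l) then arr s 35 (node q l - 1) else 0) =
       count (fun x => odd (node q l) && (node x l == node q l - 1)) ins.
      case: ifP => od; last by rewrite -(eq_count (a1 := pred0)) ?count_pred0 // => x; rewrite od.
      rewrite tr; last by lia.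
      rewrite -sum1_count [RHS]big_mkcond; apply: eq_big_seq => x xi.
      have xN := allP insN x xi; rewrite /=.
      have lH1 : l < H.+1 by lia.
      rewrite (bigD1 (Ordinal lH1)) //= big1 ?addn0; first by case: eqP.
      move=> l' l'l; case: eqP => // E; exfalso; move/eqP: l'l; apply; apply/val_inj.
      apply: (@node_level x l' l) => //; first by rewrite -ltnS.
      have := node_bounds qN (ltnW lH); rewrite E; case: (H - l) (subn_gt0 l H) => [|d _].
        by rewrite lH.
      by rewrite !expnS; lia.
    rewrite -count_predUI [X in _ = _ + X](_ : _ = 0) ?addn0; last first.
      apply/eqP; rewrite -leqn0 leqNgt -has_count; apply/hasPn => x _ /=.
      by rewrite !nodeS; apply/negP; lia.
    apply: eq_count => x /=; rewrite !nodeS.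
    by apply/idP/idP; lia.
  have le16 : reg s' 16 + (if odd (node q l) then arr s 35 (node q l - 1) else 0) <= M.
    apply: leq_trans sz; apply: leq_trans (count_size (fun x => x < q) ins).
    by rewrite -Hs cntS; lia.
  have MW' : M < W by apply: leq_ltn_trans MW; lia.
  split=> [od|ev].
    have {}od : odd (node q l) by lia.
    rewrite od in cntS le16.
    rewrite tr'; split; first by lia.
    split; first by lia.
    exists l.+1; split=> //; first by rewrite nodeS.
    by rewrite /= -Hs cntS addnA.
  have {}ev : odd (node q l) = false by lia.
  rewrite ev in cntS.
  split; first by lia.
  exists l.+1; split=> //; first by rewrite nodeS.
  by rewrite /= -Hs cntS.
Qed.

Definition dominated (k : nat) : nat :=
  count (fun k' => (key k' < qk k) && (val k' < qv k)) (iota 0 M).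

(* [ins] holds the values whose keys are below [t]. *)
Definition keys_below (t : nat) (ins : seq nat) : Prop :=
  forall b : pred nat, count b ins = count (fun k => (key k < t) && b (val k)) (iota 0 M).

Lemma keys_below_size t ins : keys_below t ins -> size ins <= M /\ all (fun x => x < N) ins.
Proof.
move=> kb; split.
  by rewrite -(count_predT ins) kb -{2}(size_iota 0 M) count_size.
rewrite -[all _ _]negbK -has_predC has_count kb -leqNgt leqn0.
rewrite -(eq_in_count (a1 := pred0)) ?count_pred0 // => k.
by rewrite mem_iota add0n /= => /val_lt ->; rewrite andbF.
Qed.

Lemma count_keyS (key' : nat -> nat) t (b : pred nat) : (forall k, k < M -> key' k = key k) ->
  count (fun k => (key k < t) && b (val k)) (iota 0 M) +
  count (fun k => b (val k)) (bucket_of key' M t) =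
  count (fun k => (key k < t.+1) && b (val k)) (iota 0 M).
Proof.
move=> keyE; rewrite /bucket_of count_rev count_filter -count_predUI.
rewrite [X in _ + X](_ : _ = 0) ?addn0.
  apply: eq_in_count => k; rewrite mem_iota add0n => /andP[_ kM] /=.
  by rewrite keyE //; case: (b _); rewrite ?andbT ?andbF //=; lia.
apply/eqP; rewrite -leqn0 leqNgt -has_count; apply/hasPn => k.
rewrite mem_iota add0n => /andP[_ kM] /=; rewrite keyE //.
by case: ltngtP; rewrite ?andbF.
Qed.

Lemma run_dom s :
  reg s 11 = N -> reg s 12 = N + N -> reg s 13 = B -> reg s 14 = M ->
  halves (arr s 34) ->
  (forall k, k < M -> arr s 36 k = key k) -> (forall k, k < M -> arr s 37 k = val k) ->
  (forall k, k < M -> arr s 38 k = qk k) -> (forall k, k < M -> arr s 39 k = qv k) ->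
  run W dom s (N * 6 + B * 12 + M * (H * 7 + 21) + 12)
    (fun s' => forall k, k < M -> arr s' 42 k = dominated k).
Proof.
move=> s11 s12 s13 s14 hv keyE valE qkE qvE.
have MW' : M < W by apply: leq_ltn_trans MW; lia.
have N0 := N_gt0.
pose bk := bucket_of (arr s 36) M; pose bq := bucket_of (arr s 38) M.
pose f t := (size (bq t) * ((H * 4 + 3 + 1) + 2) + 2) + (size (bk t) * ((H * 3 + 5) + 2) + 2).
have keyB k : k < M -> arr s 36 k < B by move=> kM; rewrite keyE ?key_lt.
have qkB k : k < M -> arr s 38 k < B by move=> kM; rewrite qkE ?qk_lt.
apply: (@run_le _ _ _ (((N + N) * (1 + 2) + 2) + ((B * 3 + M * 4 + 4) +
  ((B * 3 + M * 4 + 4) + (\sum_(t < B) (f t + 2) + 2))))).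
  have -> : \sum_(t < B) (f t + 2) = M * (H * 4 + 6) + M * (H * 3 + 7) + B * 6.
    rewrite (eq_bigr (fun t : 'I_B =>
      size (bq t) * (H * 4 + 6) + size (bk t) * (H * 3 + 7) + 6)) => [|t _]; last first.
      by rewrite /f; lia.
    rewrite !big_split /= -!big_distrl /= sum_nat_const card_ord.
    by rewrite (sum_bucket_of keyB) (sum_bucket_of qkB).
  by lia.
apply: run_seq; apply: (@run_for_const _ _ _ _ (N + N) (fun i s' =>
  forall v, v < i -> arr s' 35 v = 0)) => //.
  move=> i s' iN ag s3 _ I0; apply: (@run_wp _ (SetCell _ _ _)); split=> //= v vi.
  by rewrite s3; case: eqP => // ne; apply: I0; lia.
move=> s1 [agr1 aga1] _ z1.
have kE : arr s1 36 =1 arr s 36 by apply: aga1.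
have qE : arr s1 38 =1 arr s 38 by apply: aga1.
have bkE t : bucket_of (arr s1 36) M t = bk t.
  by congr rev; apply: eq_filter => k; rewrite kE.
have keyB1 k : k < M -> arr s1 36 k < B by rewrite kE; apply: keyB.
apply: run_seq; apply: run_mono (@run_bucket W 36 5 6 3 13 14 B M s1 _ isT isT
  _ _ BW (ltnW MW') keyB1 (fun s' H => H)) => //; try by rewrite agr1.
move=> s2 [agr2 aga2] ch2.
have qE2 : arr s2 38 =1 arr s 38 by move=> j; rewrite aga2.
have bqE t : bucket_of (arr s2 38) M t = bq t.
  by congr rev; apply: eq_filter => k; rewrite qE2.
have qkB2 k : k < M -> arr s2 38 k < B by rewrite qE2; apply: qkB.
apply: run_seq; apply: run_mono (@run_bucket W 38 40 41 3 13 14 B M s2 _ isT isT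
  _ _ BW (ltnW MW') qkB2 (fun s' H => H)) => //; try by rewrite agr2 // agr1.
move=> s3 [agr3 aga3] ch3.
have hv3 : halves (arr s3 34) by move=> j jN; rewrite aga3 // aga2 // aga1 // hv.
have z3 j : j < N + N -> arr s3 35 j = 0 by move=> jN; rewrite aga3 // aga2 // z1.
have r3 x : x \in [:: 11; 13] -> reg s3 x = reg s x.
  by rewrite !inE => /orP[]/eqP->; rewrite agr3 // agr2 // agr1.
have val3 k : k < M -> arr s3 37 k = val k.
  by move=> kM; rewrite aga3 // aga2 // aga1 // valE.
have qv3 k : k < M -> arr s3 39 k = qv k.
  by move=> kM; rewrite aga3 // aga2 // aga1 // qvE.
have ch3k t : t < B -> chain (arr s3 6) (arr s3 5 t) (bk t).
  move=> tB; rewrite -bkE aga3 //; apply: (@eq_chain (arr s2 6)) => [j _|].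
    by rewrite aga3.
  exact: ch2.
have ch3q t : t < B -> chain (arr s3 41) (arr s3 40 t) (bq t).
  by move=> tB; rewrite -bqE; apply: ch3.
apply: (@run_for _ _ _ _ B (fun t s' => exists ins, [/\ keys_below t ins,
   tree_of ins (arr s' 35) & forall k, k < M -> qk k < t -> arr s' 42 k = dominated k]) f) => //.
- by rewrite r3.
- exists [::]; split=> //.
    move=> b; rewrite /= -(eq_count (a1 := pred0)) ?count_pred0 // => k.
  by move=> j /andP[_ jN]; rewrite big_nil /= z3.
- move=> t s4 tB [agr4 aga4] s43 _ [ins [kb tr res]].
  have [szi inN] := keys_below_size kb.
  apply: run_seq.
  apply: (@run_forlist _ _ _ _ _ (bq t) (fun l1 s5 => tree_of ins (arr s5 35) /\
    forall k, k < M -> (qk k < t) || (k \in l1) -> arr s5 42 k = dominated k)) => //=.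
  + rewrite s43 aga4 //; apply: (@eq_chain (arr s3 41)) => [j _|]; first by rewrite aga4.
    exact: ch3q.
  + exact: bucket_of_lt (ltnW MW').
  + by split=> // k kM; rewrite orbF; apply: res.
  + move=> l1 k l2 s5 El [agr5 aga5] s54 [tr5 res5].
    have : k \in bq t by rewrite El mem_cat mem_head orbT.
    rewrite mem_bucket_of => /andP[kM /eqP Ek]; rewrite qkE // in Ek.
    apply: run_seq; apply: run_mono (@run_rank _ (qv k) ins s5 _ _ _ _ _ _ _) => //.
    * move=> s6 [agr6 aga6] r16; apply: (@run_wp _ (SetCell _ _ _)) => /=.
      rewrite r16 agr6 // s54 subn1 /=; split.
        by have := count_size (fun x => x < qv k) ins; lia.
      move=> x; split=> [j jN|j jM] /=; first by rewrite aga6 // tr5.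
      rewrite aga6 // mem_rcons inE; case: (eqVneq j k) => [-> _|_ /=]; last exact: res5.
      by rewrite /dominated Ek kb.
    * by rewrite agr5 //= agr4 //= r3.
    * by rewrite /= s54 subn1 /= aga5 //= aga4 //= qv3.
    * exact: qv_lt.
    * by move=> j jN; rewrite aga5 //= aga4 //= hv3.
  move=> s5 [agr5 aga5] [tr5 res5].
  apply: (@run_forlist _ _ _ _ _ (bk t) (fun l1 s6 => exists ins', tree_of ins' (arr s6 35) /\
    forall b : pred nat, count b ins' = count b ins + count (fun k => b (val k)) l1)) => //=.
  + rewrite agr5 //= s43 aga5 //= aga4 //; apply: (@eq_chain (arr s3 6)) => [j _|].
      by rewrite aga5 //= aga4.
    exact: ch3k.
  + exact: bucket_of_lt (ltnW MW').
  + by exists ins; split=> // b; rewrite addn0.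
  + move=> l1 k l2 s6 El [agr6 aga6] s64 [ins' [tr6 cnt6]].
    have : k \in bk t by rewrite El mem_cat mem_head orbT.
    rewrite mem_bucket_of => /andP[kM _].
    apply: run_mono (@run_insert _ (val k) ins' s6 _ _ _ _ _ _) => //.
    * move=> s7 _ tr7 x; exists (val k :: ins'); split=> // b.
      by rewrite /= cnt6 -cats1 count_cat /= addn0; lia.
    * by rewrite agr6 //= agr5 //= agr4 //= r3.
    * by rewrite /= s64 subn1 /= aga6 //= aga5 //= aga4 //= val3.
    * exact: val_lt.
    * by move=> j jN; rewrite aga6 //= aga5 //= aga4 //= hv3.
    (* There is room for one more element: [k] itself is among the [M] points and not yet
       inserted. *)
    * have E1 := count_keyS t xpredT keyE; rewrite -/(bk t) El count_cat in E1.
      have E2 := kb xpredT; have E3 := cnt6 xpredT.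
      have E4 := count_size (fun k => (key k < t.+1) && xpredT (val k)) (iota 0 M).
      rewrite size_iota in E4; rewrite !count_predT in E1 E2 E3 *; cbn in *.
      by lia.
  move=> s6 [agr6 aga6] [ins' [tr6 cnt6]]; exists ins'; split=> //.
    by move=> b; rewrite cnt6 kb; apply: count_keyS.
  move=> k kM /=; rewrite ltnS leq_eqVlt aga6 //= => /predU1P[E|lt]; apply: res5 => //.
    by rewrite mem_bucket_of kM qkE // E eqxx orbT.
  by rewrite lt.
- by move=> s4 _ _ [ins [_ _ res]] k kM; apply: res => //; apply: qk_lt.
Qed.
End Dom.

(** * Compatible pairs *)


(** Doubling finds the first power of two that is at least [n + 3]: interval ends go up to [n + 1]
    and queries add 1. The table of halves is filled by writing [i] at [2i] and [2i + 1]; register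
    14 is the number of rectangles, four per request. *)
Definition setup : cmd :=
  Seq (SetReg 11 (Const 1))
  (Seq (While (Minus (Plus (Reg 0) (Const 3)) (Reg 11))
         (SetReg 11 (Plus (Reg 11) (Reg 11))))
  (Seq (Seq (SetReg 12 (Plus (Reg 11) (Reg 11)))
       (Seq (SetReg 13 (Plus (Reg 0) (Const 3)))
            (SetReg 14 (Plus (Plus (Reg 2) (Reg 2)) (Plus (Reg 2) (Reg 2))))))
       (For 3 11
         (Seq (SetCell 34 (Plus (Reg 3) (Reg 3)) (Reg 3))
              (SetCell 34 (Plus (Plus (Reg 3) (Reg 3)) (Const 1)) (Reg 3)))))).

Lemma run_setup W n m s :
  reg s 0 = n -> reg s 2 = m -> 4 * n + 10 <= W -> 4 * m <= W ->
  run W setup s (n * 16 + 40) (fun s' =>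
    exists H, [/\ n + 3 <= 2 ^ H <= 2 * n + 5, reg s' 11 = 2 ^ H,
      reg s' 12 = 2 ^ H + 2 ^ H, reg s' 13 = n + 3 /\ reg s' 14 = 4 * m
    & halves H (arr s' 34)]).
Proof.
move=> s0 s2 nW mW.
have -> : n * 16 + 40 = 1 + ((1 + (2 * n + 4) * 2) + (3 + (n * 12 + 27))) by lia.
apply: run_seq; apply: (@run_wp _ (SetReg _ _)); split=> /=; first by lia.
apply: run_seq; apply: (@run_while _ _ _ (fun b s' => exists H,
  [/\ reg s' 11 = 2 ^ H, reg s' 0 = n, reg s' 2 = m, 2 ^ H <= 2 * n + 5 &
  b = 1 + (2 * n + 5 - 2 ^ H) * 2])); first last.
- move=> b s1 [H [s11 s10 s12 le ->]] /=; rewrite s11 s10 => lt.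
  have H0 : 0 < 2 ^ H by rewrite expn_gt0.
  exists 1, (1 + (2 * n + 5 - 2 ^ H.+1) * 2); rewrite expnS; split; first by lia.
  apply: (@run_wp _ (SetReg _ _)); rewrite /= s11; split; first by lia.
  by exists H.+1; rewrite /= expnS; split=> //; lia.
- move=> b s1 [H [s11 s10 s12 le ->]] /=; rewrite s11 s10 => ge; split; first by lia.
  apply: run_seq; apply: (@run_wp _ (Seq _ _)) => /=; rewrite s11 s10 s12.
  split; first by lia.
  split; first by lia.
  split; first by lia.
  apply: (@run_le _ _ _ (2 ^ H * (2 + 2) + 2)); first by lia.
  apply: (@run_for_const _ _ _ _ (2 ^ H) (fun i s' =>
    forall j, j < i + i -> arr s' 34 j = j./2)) => //; first by lia.
    move=> i s3 iH ag s33 _ I0; apply: (@run_wp _ (Seq _ _)) => /=; rewrite s33.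
    split; first by lia.
    split; first by lia.
    move=> j jN /=; case: eqP => [->|ne1]; first by lia.
    case: eqP => [->|ne2]; first by lia.
    by apply: I0; lia.
  move=> s3 [agr aga] _ hv; exists H.
  rewrite !agr //= s11; split=> //; first by lia.
  by split=> //; lia.
- by exists 0; split=> //=; [lia|rewrite expn0; lia].
Qed.

Section Pairs.
Variables (W n m : nat) (out ka va kb vb : nat -> nat).
Hypothesis outP : forall v, v < n -> v < out v <= n.
Hypothesis va_lt : forall i, i < m -> 0 < va i < n.
Hypothesis vb_lt : forall i, i < m -> 0 < vb i < n.
Hypothesis nW : n + n + 20 <= W.
Hypothesis mW : 4 * m + 4 <= W.

(* Each sector is covered by two nonempty intervals, possibly equal. The dummy
   label [n], added to every complement, makes the second interval nonempty; as
   all complements contain the root [0], it creates no new intersection. *)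
Definition piece_lo (k v : nat) (c : bool) : nat :=
  if k == 0 then v else if c then out v else 0.
Definition piece_hi (k v : nat) (c : bool) : nat :=
  if k == 0 then out v else if c then n.+1 else v.

Lemma piece_bounds k v c : 0 < v < n ->
  piece_lo k v c < piece_hi k v c /\ piece_hi k v c <= n.+1.
Proof.
move=> vn; have := @outP v ltac:(lia).
by rewrite /piece_lo /piece_hi; case: eqP; case: c; lia.
Qed.

(** Reduces the intersection of two sectors to that of two intervals, despite the dummy label. *)
Lemma piece_overlap k v k' v' : 0 < v < n -> 0 < v' < n ->
  (exists c c', piece_lo k v c < piece_hi k' v' c' /\ piece_lo k' v' c' < piece_hi k v c)
  <-> exists2 w, w < n & sector out k v w && sector out k' v' w.
Proof.
move=> vn vn'; have ov := @outP v ltac:(lia); have ov' := @outP v' ltac:(lia).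
rewrite /piece_lo /piece_hi /sector; split.
  move=> [c [c' ov2]].
  (* Two complements may overlap only in the dummy label, but they share the root. Otherwise one
     piece is a subtree, and the larger left end is a genuine common label. *)
  have [/andP[k0 k0']|both] := boolP ((k != 0) && (k' != 0)).
    by exists 0; [lia|rewrite (negPf k0) (negPf k0'); lia].
  exists (maxn (piece_lo k v c) (piece_lo k' v' c'));
    move: ov2 both; rewrite /piece_lo;
    by case: (k == 0); case: (k' == 0); case: c; case: c' => //=; lia.
(* A label outside the interval of [v] is in the second piece iff it is at least [v]. *)
move=> [w wn wX]; exists (v <= w), (v' <= w).
by move: wX; case: (k == 0); case: (k' == 0); case: (leqP v w); case: (leqP v' w) => //=; lia.
Qed.

(** The four rectangles of request [i] are numbered from [4 * i]: the lowest bit selects the piece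
    of the tail side, the next one that of the head side. The rectangle is the product of [[rect_p],
    [rect_q]) and [[rect_u], [rect_w]). *)
Definition owner (k : nat) : nat := k./2./2.
Definition rect_p k := piece_lo (ka (owner k)) (va (owner k)) (odd k).
Definition rect_q k := piece_hi (ka (owner k)) (va (owner k)) (odd k).
Definition rect_u k := piece_lo (kb (owner k)) (vb (owner k)) (odd k./2).
Definition rect_w k := piece_hi (kb (owner k)) (vb (owner k)) (odd k./2).

Definition rects (K : nat) (s : store) : Prop :=
  forall k, k < K -> [/\ arr s 29 k = rect_p k, arr s 30 k = rect_q k,
    arr s 31 k = rect_u k, arr s 32 k = rect_w k & arr s 33 k = owner k].

Lemma owner_lt k : k < 4 * m -> owner k < m.
Proof. by rewrite /owner; lia. Qed.

Lemma rect_bounds k : k < 4 * m ->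
  [/\ rect_p k < rect_q k, rect_q k <= n.+1, rect_u k < rect_w k & rect_w k <= n.+1].
Proof.
move=> /owner_lt ok; have [? ?] := piece_bounds (ka (owner k)) (odd k) (va_lt ok).
by have [? ?] := piece_bounds (kb (owner k)) (odd k./2) (vb_lt ok).
Qed.

Definition pieces_of (arrk arrv r1 r2 r3 r4 : nat) : cmd :=
  Seq (SetReg 25 (Cell arrv (Reg 3)))
  (If (Cell arrk (Reg 3))
     (Seq (Seq (SetReg r1 (Const 0)) (SetReg r2 (Reg 25)))
          (Seq (SetReg r3 (Cell 12 (Reg 25))) (SetReg r4 (Plus (Reg 0) (Const 1)))))
     (Seq (Seq (SetReg r1 (Reg 25)) (SetReg r2 (Cell 12 (Reg 25))))
          (Seq (SetReg r3 (Reg 25)) (SetReg r4 (Cell 12 (Reg 25)))))).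

Definition append (r1 r2 r3 r4 : nat) : cmd :=
  Seq (Seq (SetCell 29 (Reg 26) (Reg r1)) (SetCell 30 (Reg 26) (Reg r2)))
  (Seq (Seq (SetCell 31 (Reg 26) (Reg r3)) (SetCell 32 (Reg 26) (Reg r4)))
  (Seq (SetCell 33 (Reg 26) (Reg 3)) (SetReg 26 (Plus (Reg 26) (Const 1))))).

Definition pieces : cmd :=
  Seq (SetReg 26 (Const 0))
  (For 3 2
    (Seq (pieces_of 20 21 17 18 19 20)
    (Seq (pieces_of 22 23 21 22 23 24)
    (Seq (append 17 18 21 22)
    (Seq (append 19 20 21 22)
    (Seq (append 17 18 23 24)
         (append 19 20 23 24))))))).

Lemma run_append r1 r2 r3 r4 s K :
  [&& r1 != 26, r2 != 26, r3 != 26 & r4 != 26] ->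
  rects K s -> reg s 26 = K -> K < 4 * m ->
  reg s r1 = rect_p K -> reg s r2 = rect_q K -> reg s r3 = rect_u K ->
  reg s r4 = rect_w K -> reg s 3 = owner K ->
  run W (append r1 r2 r3 r4) s 6 (fun s' => rects K.+1 s' /\ reg s' 26 = K.+1).
Proof.
move=> _ rc sK Km E1 E2 E3 E4 E5; have [? ? ? ?] := rect_bounds Km.
have okm := owner_lt Km.
apply: (@run_wp _ (append r1 r2 r3 r4)) => /=; rewrite sK E1 E2 E3 E4 E5.
do 6![split; first by lia].
split; last by rewrite /= addn1.
move=> k; rewrite ltnS leq_eqVlt => /predU1P[->|kK] /=; first by rewrite eqxx.
by rewrite (_ : (k == K) = false); [exact: rc|lia].
Qed.

Lemma run_pieces s :
  reg s 0 = n -> reg s 2 = m -> (forall v, v < n -> arr s 12 v = out v) ->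
  (forall i, i < m -> arr s 20 i = ka i /\ arr s 21 i = va i) ->
  (forall i, i < m -> arr s 22 i = kb i /\ arr s 23 i = vb i) ->
  run W pieces s (m * 38 + 3) (rects (4 * m)).
Proof.
move=> s0 sm oE aE bE; have -> : m * 38 + 3 = 1 + (m * (6 + (6 + (6 + (6 + (6 + 6)))) + 2) + 2) by lia.
apply: run_seq; apply: (@run_wp _ (SetReg _ _)); split=> //=.
apply: (@run_for_const _ _ _ _ m (fun i s' => rects (4 * i) s' /\ reg s' 26 = 4 * i)) => //.
- by lia.
- move=> i s1 im [agr aga] s13 _ [rc s26].
  have [aK aV] := aE i im; have [bK bV] := bE i im.
  have van := va_lt im; have vbn := vb_lt im.
  have ova := @outP (va i) ltac:(lia); have ovb := @outP (vb i) ltac:(lia).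
  have R1 : run W (pieces_of 20 21 17 18 19 20) s1 6 (fun s2 =>
     [/\ reg s2 17 = piece_lo (ka i) (va i) false, reg s2 18 = piece_hi (ka i) (va i) false,
         reg s2 19 = piece_lo (ka i) (va i) true & reg s2 20 = piece_hi (ka i) (va i) true]).
    apply: (@run_wp _ (pieces_of 20 21 17 18 19 20)) => /=.
    rewrite s13 !aga //= aK aV oE ?agr //= ?s0; last by lia.
    rewrite /piece_lo /piece_hi.
    split; first by lia.
    by split=> [|->]; [case: (ka i) => //= k _|]; rewrite ?addn1; do 4![split; first by lia].
  apply: run_seq; apply: run_mono R1 => // s2 [agr2 aga2] [a17 a18 a19 a20].
  have R2 : run W (pieces_of 22 23 21 22 23 24) s2 6 (fun s2 =>
     [/\ reg s2 21 = piece_lo (kb i) (vb i) false, reg s2 22 = piece_hi (kb i) (vb i) false,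
         reg s2 23 = piece_lo (kb i) (vb i) true & reg s2 24 = piece_hi (kb i) (vb i) true]).
    apply: (@run_wp _ (pieces_of 22 23 21 22 23 24)) => /=.
    rewrite agr2 //= s13 !aga2 //= !aga //= bK bV oE ?agr2 //= ?agr //= ?s0; last by lia.
    rewrite /piece_lo /piece_hi.
    split; first by lia.
    by split=> [|->]; [case: (kb i) => //= k _|]; rewrite ?addn1; do 4![split; first by lia].
  apply: run_seq; apply: run_mono R2 => // s3 [agr3 aga3] [b21 b22 b23 b24].
  have s326 : reg s3 26 = 4 * i by rewrite agr3 //= agr2.
  have rc3 : rects (4 * i) s3.
    by move=> k kK; rewrite !aga3 //= !aga2 //=; apply: rc.
  pose regs s' := [/\ reg s' 3 = i,
    forall c, reg s' (if c then 19 else 17) = piece_lo (ka i) (va i) c,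
    forall c, reg s' (if c then 20 else 18) = piece_hi (ka i) (va i) c,
    forall c, reg s' (if c then 23 else 21) = piece_lo (kb i) (vb i) c &
    forall c, reg s' (if c then 24 else 22) = piece_hi (kb i) (vb i) c].
  have regs3 : regs s3.
    split; first by rewrite agr3 //= agr2.
    + by case; rewrite agr3.
    + by case; rewrite agr3.
    + by case.
    + by case.
  have app c1 c2 K s' : [/\ rects K s', reg s' 26 = K & regs s'] ->
      [/\ K < 4 * m, owner K = i, odd K = c1 & odd K./2 = c2] ->
      run W (append (if c1 then 19 else 17) (if c1 then 20 else 18)
        (if c2 then 23 else 21) (if c2 then 24 else 22)) s' 6
        (fun s'' => [/\ rects K.+1 s'', reg s'' 26 = K.+1 & regs s'']).
    move=> [rcs s'26 [r3 rlo rhi ulo uhi]] [Km Ko o1 o2].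
    apply: run_mono (run_append _ rcs s'26 Km _ _ _ _ _) => //.
    + move=> s'' [agr'' _] [rc'' ->]; split=> //; split.
      * by rewrite agr''.
      * by case; rewrite agr'' //; [apply: (rlo true)|apply: (rlo false)].
      * by case; rewrite agr'' //; [apply: (rhi true)|apply: (rhi false)].
      * by case; rewrite agr'' //; [apply: (ulo true)|apply: (ulo false)].
      * by case; rewrite agr'' //; [apply: (uhi true)|apply: (uhi false)].
    + by case: (c1) (c2) => -[].
    + by rewrite /rect_p Ko o1 rlo.
    + by rewrite /rect_q Ko o1 rhi.
    + by rewrite /rect_u Ko o2 ulo.
    + by rewrite /rect_w Ko o2 uhi.
    + by rewrite Ko.
  have st3 : [/\ rects (4 * i) s3, reg s3 26 = 4 * i & regs s3] by split.
  apply: run_seq; apply: run_mono (app false false _ s3 st3 _) => //; last by rewrite /owner; split; lia.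
  move=> s4 _ st4; apply: run_seq.
  apply: run_mono (app true false _ s4 st4 _) => //; last by rewrite /owner; split; lia.
  move=> s5 _ st5; apply: run_seq.
  apply: run_mono (app false true _ s5 st5 _) => //; last by rewrite /owner; split; lia.
  move=> s6 _ st6.
  apply: run_mono (app true true _ s6 st6 _) => //; last by rewrite /owner; split; lia.
  by move=> s7 _ [rc7 s726 _]; rewrite /= mulnS.
- by move=> s1 _ _ [].
Qed.

Definition meets (k k' : nat) : bool :=
  [&& rect_p k < rect_w k', rect_u k' < rect_q k,
      rect_u k < rect_q k' & rect_p k' < rect_w k].

(** For nonempty intervals, [p, q) meets [u', w') iff u' < q and not w' <= p, and w' <= p implies u'
    < q: the indicator is [u' < q] - [w' <= p]. The product of two such differences gives the four
    counts; the added 1 makes inequalities strict. *)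
Lemma count_meets k : k < 4 * m ->
  let c f := count f (iota 0 (4 * m)) in
  c (fun k' => (rect_u k' < rect_q k) && (rect_p k' < rect_w k)) +
  c (fun k' => (rect_w k' < rect_p k + 1) && (rect_q k' < rect_u k + 1)) =
  c (fun k' => (rect_u k' < rect_q k) && (rect_q k' < rect_u k + 1)) +
  c (fun k' => (rect_w k' < rect_p k + 1) && (rect_p k' < rect_w k)) +
  c (meets k).
Proof.
move=> km c; have [? _ ? _] := rect_bounds km.
have : all (fun k' => k' < 4 * m) (iota 0 (4 * m)).
  by apply/allP => k'; rewrite mem_iota.
rewrite {}/c; elim: (iota _ _) => //= k' l IH /andP[k'm /IH].
have [? _ ? _] := rect_bounds k'm; rewrite {}/meets.
do 4![move: (count _ l) => ?].
case: (ltnP (rect_u k') (rect_q k)) => ?; case: (ltnP (rect_p k') (rect_w k)) => ?;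
  case: (ltnP (rect_w k') (rect_p k + 1)) => ?;
  case: (ltnP (rect_q k') (rect_u k + 1)) => ?;
  case: (ltnP (rect_p k) (rect_w k')) => ?; case: (ltnP (rect_u k) (rect_q k')) => ? //=; lia.
Qed.

Definition count_pass (ka1 va1 qa1 qd1 wa1 wd1 acc : nat) : cmd :=
  Seq (For 3 14
        (Seq (SetCell 36 (Reg 3) (Cell ka1 (Reg 3)))
        (Seq (SetCell 37 (Reg 3) (Cell va1 (Reg 3)))
        (Seq (SetCell 38 (Reg 3) (Plus (Cell qa1 (Reg 3)) (Const qd1)))
             (SetCell 39 (Reg 3) (Plus (Cell wa1 (Reg 3)) (Const wd1)))))))
  (Seq dom
       (For 3 14 (SetCell acc (Reg 3) (Plus (Cell acc (Reg 3)) (Cell 42 (Reg 3)))))).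

Lemma run_count_pass H M B k1 v1 q1 d1 w1 e1 acc (f : nat -> nat) s :
  [&& 28 < k1 < 33, 28 < v1 < 33, 28 < q1 < 33 & 28 < w1 < 33] -> 42 < acc < 45 ->
  2 ^ H + 2 ^ H <= W -> M * H.+2 < W -> B <= W ->
  reg s 11 = 2 ^ H -> reg s 12 = 2 ^ H + 2 ^ H -> reg s 13 = B -> reg s 14 = M ->
  halves H (arr s 34) ->
  (forall k, k < M -> [/\ arr s k1 k < B, arr s v1 k < 2 ^ H,
     arr s q1 k + d1 < B, arr s w1 k + e1 < 2 ^ H & f k <= M]) ->
  2 * M <= W ->
  (forall k, k < M -> arr s acc k = f k) ->
  run W (count_pass k1 v1 q1 d1 w1 e1 acc) s
    (2 ^ H * 6 + B * 12 + M * (H * 7 + 30) + 16)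
    (fun s' => forall k, k < M -> arr s' acc k = f k +
      count (fun k' => (arr s k1 k' < arr s q1 k + d1) &&
                       (arr s v1 k' < arr s w1 k + e1)) (iota 0 M)).
Proof.
move=> /and4P[k1b v1b q1b w1b] accb NW MW BW s11 s12 s13 s14 hv bd M2 accE.
have ne x y : 28 < x < 33 -> 35 < y -> (x == y) = false by lia.
have -> : 2 ^ H * 6 + B * 12 + M * (H * 7 + 30) + 16 = (M * (4 + 2) + 2) +
  ((2 ^ H * 6 + B * 12 + M * (H * 7 + 21) + 12) + (M * (1 + 2) + 2)) by lia.
have MW' : M <= W by apply: leq_trans (ltnW MW); rewrite leq_pmulr.
apply: run_seq; apply: (@run_for_const _ _ _ _ M (fun i s' => forall j, j < i ->
  [/\ arr s' 36 j = arr s k1 j, arr s' 37 j = arr s v1 j,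
      arr s' 38 j = arr s q1 j + d1 & arr s' 39 j = arr s w1 j + e1])) => //.
  move=> i s' iM [agr aga] s'3 _ I0; have [? ? ? ? _] := bd i iM.
  have ag x : 28 < x < 33 -> arr s' x =1 arr s x by move=> xb; apply: aga; rewrite !inE; lia.
  apply: (@run_wp _ (Seq _ _)) => /=; rewrite s'3 !(ne v1) // !(ne q1) // !(ne w1) //= (ag k1) // (ag v1) // (ag q1) // (ag w1) //.
  do 3![split; first by lia].
  split; first by lia.
  move=> j ji /=; case: (eqVneq j i) => [->|ji'] //; by apply: I0; lia.
move=> s1 [agr1 aga1] _ pr.
have ag1 x : 28 < x < 33 -> arr s1 x =1 arr s x by move=> xb; apply: aga1; rewrite !inE; lia.
apply: run_seq; apply: run_mono (@run_dom W H M B (arr s k1) (arr s v1)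
   (fun k => arr s q1 k + d1) (fun k => arr s w1 k + e1) NW MW BW _ _ _ _ s1 _ _ _ _ _ _ _ _ _) => //.
- move=> s2 [agr2 aga2] res.
  have acc1 : arr s2 acc =1 arr s acc.
    by move=> j; rewrite aga2 ?aga1 // !inE; lia.
  have a42 : (acc == 42) = false by lia.
  apply: (@run_for_const _ _ _ _ M (fun i s' => forall j, j < M ->
    arr s' acc j = if j < i then f j + dominated M (arr s k1) (arr s v1)
      (fun k => arr s q1 k + d1) (fun k => arr s w1 k + e1) j else f j)) => //.
  + by rewrite agr2 // agr1.
  + by move=> j jM; rewrite acc1 accE.
  + move=> i s' iM [agr aga] s'3 _ I0; apply: (@run_wp _ (SetCell _ _ _)) => /=.
    have [? ? ? ? fM] := bd i iM.
    have dM : dominated M (arr s k1) (arr s v1)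
      (fun k => arr s q1 k + d1) (fun k => arr s w1 k + e1) i <= M.
      by apply: leq_trans (count_size _ _) _; rewrite size_iota.
    rewrite s'3 I0 // ltnn aga; last by rewrite inE eq_sym a42.
    rewrite res //; split; first by lia.
    move=> j jM /=; rewrite eqxx /= I0 //; case: (eqVneq j i) => [->|ji].
      by rewrite ltnSn.
      by rewrite (_ : (j < i.+1) = (j < i)) //; lia.
  + by move=> s3 _ _ I3 j jM; rewrite I3 // jM.
- by move=> k /bd[].
- by move=> k /bd[].
- by move=> k /bd[].
- by move=> k /bd[].
- by rewrite agr1.
- by rewrite agr1.
- by rewrite agr1.
- by rewrite agr1.
- by move=> j jN; rewrite aga1 // hv.
- by move=> k /pr[].
- by move=> k /pr[].
- by move=> k /pr[].
- by move=> k /pr[].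
Qed.

Definition find_check : cmd :=
  If (Minus (Cell 32 (Reg 3)) (Cell 29 (Reg 28)))
  (If (Minus (Cell 30 (Reg 28)) (Cell 31 (Reg 3)))
  (If (Minus (Cell 30 (Reg 3)) (Cell 31 (Reg 28)))
  (If (Minus (Cell 32 (Reg 28)) (Cell 29 (Reg 3)))
      (SetReg 27 (Plus (Reg 3) (Const 1))) Skip) Skip) Skip) Skip.

(** The counts reveal one rectangle that meets some other transposed one; a single further scan then
    finds its partner. Both are stored with 1 added. *)
Definition find_pair : cmd :=
  Seq (Seq (SetReg 26 (Const 0)) (SetReg 27 (Const 0)))
  (Seq (For 3 14 (If (Minus (Cell 43 (Reg 3)) (Cell 44 (Reg 3)))
                     (SetReg 26 (Plus (Reg 3) (Const 1))) Skip))
  (Seq (SetReg 28 (Minus (Reg 26) (Const 1)))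
       (For 3 14 find_check))).

Definition compatible (i j : nat) : Prop :=
  (exists2 w, w < n & sector out (ka i) (va i) w && sector out (kb j) (vb j) w) /\
  (exists2 w, w < n & sector out (ka j) (va j) w && sector out (kb i) (vb i) w).

Lemma meets_compatible k k' : k < 4 * m -> k' < 4 * m -> meets k k' ->
  compatible (owner k) (owner k').
Proof.
move=> km k'm /and4P[h1 h2 h3 h4]; have ok := owner_lt km; have ok' := owner_lt k'm.
split; apply/piece_overlap; rewrite ?va_lt ?vb_lt //.
  by exists (odd k), (odd k'./2).
by exists (odd k'), (odd k./2).
Qed.

Lemma compatible_meets i j : i < m -> j < m -> compatible i j ->
  exists k k', [/\ k < 4 * m, k' < 4 * m & meets k k'].
Proof.
move=> im jm [] /piece_overlap[||c [c' [h1 h2]]]; rewrite ?va_lt ?vb_lt //.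
move=> /piece_overlap[||d [d' [h3 h4]]]; rewrite ?va_lt ?vb_lt //.
pose ix i (c d : bool) := 4 * i + c + d.*2.
have ixP i' (c1 c2 : bool) : [/\ owner (ix i' c1 c2) = i', odd (ix i' c1 c2) = c1 &
    odd (ix i' c1 c2)./2 = c2].
  by rewrite /ix /owner; case: c1; case: c2; split; lia.
have ixm i' (c1 c2 : bool) : i' < m -> ix i' c1 c2 < 4 * m.
  by rewrite /ix; case: c1; case: c2; lia.
(* The overlap of a_i and b_j fixes the pieces [c] and [c'], that of a_j and b_i the pieces [d] and
   [d']. *)
exists (ix i c d'), (ix j d c'); split; rewrite ?ixm //.
have [o1 p1 q1] := ixP i c d'; have [o2 p2 q2] := ixP j d c'.
rewrite /meets /rect_p /rect_q /rect_u /rect_w o1 o2 p1 p2 q1 q2.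
by apply/and4P.
Qed.

Lemma run_find_pair s :
  rects (4 * m) s -> reg s 14 = 4 * m ->
  (forall k, k < 4 * m -> arr s 43 k = arr s 44 k + count (meets k) (iota 0 (4 * m))) ->
  run W find_pair s (m * 44 + 7) (fun s' =>
    (reg s' 26 = 0 /\ forall i j, i < m -> j < m -> ~ compatible i j) \/
    [/\ reg s' 26 != 0, arr s' 33 (reg s' 26).-1 < m, arr s' 33 (reg s' 27).-1 < m
      & compatible (arr s' 33 (reg s' 26).-1) (arr s' 33 (reg s' 27).-1)]).
Proof.
move=> rc s14 cnt; have -> : m * 44 + 7 =
  2 + ((4 * m * (2 + 2) + 2) + (1 + (4 * m * (5 + 2) + 2))) by lia.
have M4 : 4 * m <= W by lia.
apply: run_seq; apply: (@run_wp _ (Seq _ _)) => /=; split=> //; split=> //.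
have hasE k : k < 4 * m -> (arr s 43 k - arr s 44 k != 0) =
    seq.has (meets k) (iota 0 (4 * m)).
  by move=> km; rewrite cnt // has_count addKn lt0n.
apply: run_seq; apply: (@run_for_const _ _ _ _ (4 * m) (fun i s' =>
  (reg s' 26 = 0 /\ forall k, k < i -> ~~ seq.has (meets k) (iota 0 (4 * m))) \/
  exists2 k, k < 4 * m & reg s' 26 = k.+1 /\ seq.has (meets k) (iota 0 (4 * m)))) => //.
- by left.
- move=> i s' im [agr aga] s'3 s'14 I0; apply: (@run_wp _ (If _ _ _)) => /=.
  rewrite s'3 !aga //= hasE //; split=> [h|/eqP].
    by split; [lia|right; exists i => //=; rewrite addn1].
  rewrite -[_ == 0]negbK hasE // => h.
  case: I0 => [[r26 no]|?]; last by right.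
  left; split=> //= k; rewrite ltnS leq_eqVlt => /predU1P[->//|]; exact: no.
move=> s1 [agr1 aga1] _ I1.
have rc1 : rects (4 * m) s1 by move=> k km; rewrite !aga1 //=; apply: rc.
apply: run_seq; apply: (@run_wp _ (SetReg _ _)) => /=.
split.
  by case: I1 => [[-> _]|[k km [-> _]]]; lia.
case: I1 => [[r26 no]|[k km [r26 /hasP[k0]]]].
  (* With nothing found, truncated subtraction makes the scan compare with rectangle 0; register 26
     keeps its value. *)
  apply: (@run_for_const _ _ _ _ (4 * m) (fun i s' => reg s' 26 = 0)) => //.
  - by rewrite /= agr1.
  - move=> i s' im [agr aga] s'3 _ I2; apply: (@run_le _ _ _ (cost find_check)) => //.
    by apply: run_wp; rewrite /= s'3; do 4?[split=> // _]; split=> //; lia.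
  move=> s2 _ _ r2; left; split=> // i j im jm /(compatible_meets im jm) [k [k' [km k'm h]]].
  by case/negP: (no k km); apply/hasP; exists k' => //; rewrite mem_iota.
rewrite mem_iota add0n => /andP[_ k0m] hk0.
(* [k0] is a partner known to exist; once it has been passed, some partner is recorded. *)
apply: (@run_for_const _ _ _ _ (4 * m) (fun i s' =>
  (k0 < i -> exists2 k', k' < 4 * m & reg s' 27 = k'.+1 /\ meets k k'))) => //.
- by rewrite /= agr1.
- move=> i s' im [agr aga] s'3 _ I2; apply: (@run_wp _ find_check) => /=.
  have [p1 q1 u1 w1 _] := rc1 k km; have [p2 q2 u2 w2 _] := rc1 i im.
  have r28 : reg s' 28 = k by rewrite agr //= r26 subn1.
  rewrite s'3 r28 !aga //= p1 q1 u1 w1 p2 q2 u2 w2.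
  have keep : ~~ meets k i -> k0 < i.+1 ->
      exists2 k', k' < 4 * m & reg s' 27 = k'.+1 /\ meets k k'.
    rewrite ltnS leq_eqVlt => nm /predU1P[E|]; last exact: I2.
    by rewrite -E hk0 in nm.
  split=> [h1|h1]; last by apply: keep; rewrite /meets; lia.
  split=> [h2|h2]; last by apply: keep; rewrite /meets; lia.
  split=> [h3|h3]; last by apply: keep; rewrite /meets; lia.
  split=> [h4|h4]; last by apply: keep; rewrite /meets; lia.
  split; first by lia.
  by move=> _; exists i => //=; rewrite addn1; split=> //; rewrite /meets; lia.
move=> s2 [agr2 aga2] _ [//|k' k'm [r27 mk]]; right.
have o1 : arr s2 33 k = owner k by rewrite aga2 //=; case: (rc1 k km).
have o2 : arr s2 33 k' = owner k' by rewrite aga2 //=; case: (rc1 k' k'm).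
have r226 : reg s2 26 = k.+1 by rewrite agr2.
rewrite r226 r27 /= o1 o2 !owner_lt //; split=> //; exact: meets_compatible.
Qed.

(** Positive and negative terms are accumulated in separate arrays, since subtraction is
    truncated. *)
Definition pair_search : cmd :=
  Seq setup
  (Seq pieces
  (Seq (count_pass 31 29 30 0 32 0 43)
  (Seq (count_pass 32 30 29 1 31 1 43)
  (Seq (count_pass 31 30 30 0 31 1 44)
  (Seq (count_pass 32 29 29 1 32 0 44)
       find_pair))))).

Lemma run_pair_search s :
  4 * n + 10 <= W -> 4 * m * (2 * n + 8) < W -> 8 * m <= W ->
  reg s 0 = n -> reg s 2 = m -> (forall v, v < n -> arr s 12 v = out v) ->
  (forall i, i < m -> arr s 20 i = ka i /\ arr s 21 i = va i) ->
  (forall i, i < m -> arr s 22 i = kb i /\ arr s 23 i = vb i) ->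
  arr s 43 =1 (fun=> 0) -> arr s 44 =1 (fun=> 0) ->
  run W pair_search s (n * 112 + m * (trunc_log 2 (2 * n + 5) * 112 + 562) + 378) (fun s' =>
    (reg s' 26 = 0 /\ forall i j, i < m -> j < m -> ~ compatible i j) \/
    [/\ reg s' 26 != 0, arr s' 33 (reg s' 26).-1 < m, arr s' 33 (reg s' 27).-1 < m
      & compatible (arr s' 33 (reg s' 26).-1) (arr s' 33 (reg s' 27).-1)]).
Proof.
move=> nW4 mnW m8 s0 sm oE aE bE z43 z44; set L := trunc_log _ _.
have -> : n * 112 + m * (L * 112 + 562) + 378 =
  (n * 16 + 40) + ((m * 38 + 3) + (n * 96 + m * (L * 112 + 524) + 335)) by lia.
apply: run_seq; apply: run_mono (run_setup s0 sm nW4 _) => //; last by lia.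
move=> s1 [agr1 aga1] [H [Hn r11 r12 [r13 r14] hv]].
have HL : H <= L by apply: trunc_log_max => //; case/andP: Hn.
apply: run_seq; apply: run_mono (@run_pieces s1 _ _ _ _ _) => //; first last.
- by move=> i im; rewrite !aga1 //=; apply: bE.
- by move=> i im; rewrite !aga1 //=; apply: aE.
- by move=> v vn; rewrite aga1 //= oE.
- by rewrite agr1.
- by rewrite agr1.
move=> s2 [agr2 aga2] rc.
have hv2 : halves H (arr s2 34) by move=> j jN; rewrite aga2 // hv.
have R2 x : x \in [:: 11; 12; 13; 14] -> reg s2 x = reg s1 x.
  by rewrite !inE => /or4P[]/eqP->; rewrite agr2.
pose c := 2 ^ H * 6 + (n + 3) * 12 + 4 * m * (H * 7 + 30) + 16.
apply: (@run_le _ _ _ (c + (c + (c + (c + (m * 44 + 7)))))).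
  have : 2 ^ H <= 2 * n + 5 by case/andP: Hn.
  have : m * H <= m * L by rewrite leq_mul.
  by rewrite /c; lia.
have bnd s' x1 x2 x3 x4 (d1 e1 : bool) (f : nat -> nat) :
  rects (4 * m) s' -> x1 \in [:: 31; 32] -> x2 \in [:: 29; 30] ->
  (x3, d1) \in [:: (30, false); (29, true)] -> (x4, e1) \in [:: (32, false); (31, true)] ->
  (forall k, k < 4 * m -> f k <= 4 * m) ->
  forall k, k < 4 * m -> [/\ arr s' x1 k < n + 3, arr s' x2 k < 2 ^ H,
     arr s' x3 k + d1 < n + 3, arr s' x4 k + e1 < 2 ^ H & f k <= 4 * m].
  move=> rc' i1 i2 i3 i4 fM k km; have [p1 q1 u1 w1 _] := rc' k km.
  have [? ? ? ?] := rect_bounds km; have := fM k km.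
  by move: i1 i2 i3 i4; rewrite !inE !xpair_eqE => /orP[]/eqP-> /orP[]/eqP-> /orP[]/andP[/eqP-> /eqP->] /orP[]/andP[/eqP-> /eqP->]; rewrite ?p1 ?q1 ?u1 ?w1; split; lia.
pose base s' := [/\ rects (4 * m) s', halves H (arr s' 34) &
  [/\ reg s' 11 = 2 ^ H, reg s' 12 = 2 ^ H + 2 ^ H, reg s' 13 = n + 3 & reg s' 14 = 4 * m]].
have base2 : base s2 by split=> //; rewrite !R2.
have HH : H < 2 ^ H by apply: ltn_expl.
have NW : 2 ^ H + 2 ^ H <= W by lia.
have MHW : 4 * m * H.+2 < W.
  by apply: leq_ltn_trans mnW; rewrite leq_mul //; lia.
have BW : n + 3 <= W by lia.
have pass s' x1 x2 x3 x4 (d1 e1 : bool) acc (f : nat -> nat) :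
    x1 \in [:: 31; 32] -> x2 \in [:: 29; 30] ->
    (x3, d1) \in [:: (30, false); (29, true)] ->
    (x4, e1) \in [:: (32, false); (31, true)] -> acc \in [:: 43; 44] ->
    base s' -> (forall k, k < 4 * m -> f k <= 4 * m) ->
    (forall k, k < 4 * m -> arr s' acc k = f k) ->
    run W (count_pass x1 x2 x3 d1 x4 e1 acc) s' c (fun s'' =>
      [/\ base s'', forall k, k < 4 * m -> arr s'' acc k = f k +
        count (fun k' => (arr s' x1 k' < arr s' x3 k + d1) &&
                         (arr s' x2 k' < arr s' x4 k + e1)) (iota 0 (4 * m))
      & forall a, a \in [:: 43; 44] -> a != acc -> arr s'' a =1 arr s' a]).
  move=> i1 i2 i3 i4 iacc [rc' hv' [q11 q12 q13 q14]] fM accE.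
  have bd := bnd s' x1 x2 x3 x4 d1 e1 f rc' i1 i2 i3 i4 fM.
  have rg : [/\ 28 < x1 < 33, 28 < x2 < 33, 28 < x3 < 33 & 28 < x4 < 33].
    by move: i1 i2 i3 i4; rewrite !inE !xpair_eqE; split; lia.
  have [g1 g2 g3 g4] := rg.
  have accb : 42 < acc < 45 by move: iacc; rewrite !inE; lia.
  apply: run_mono (run_count_pass (f := f) _ accb NW MHW BW q11 q12 q13 q14 hv' bd _ accE) => //.
  - move=> s3 [agr3 aga3] cnt; split=> //.
      have aw a : 28 < a < 35 -> arr s3 a =1 arr s' a.
        by move=> ab; apply: aga3; rewrite /= !inE; lia.
      split; [|by move=> j jN; rewrite aw ?hv'|by rewrite !agr3].
      by move=> k km; rewrite !aw //; apply: rc'.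
    move=> a a43 ne; apply: aga3; move: a43; rewrite /= !inE (negPf ne) !orbF.
    by lia.
  - by rewrite g1 g2 g3.
  - by lia.
have cM (b : pred nat) : count b (iota 0 (4 * m)) <= 4 * m.
  by apply: leq_trans (count_size _ _) _; rewrite size_iota.
have z43' k : arr s2 43 k = 0 by rewrite aga2 // aga1 // z43.
have z44' k : arr s2 44 k = 0 by rewrite aga2 // aga1 // z44.
pose f1 k := count (fun k' => (rect_u k' < rect_q k) && (rect_p k' < rect_w k)) (iota 0 (4 * m)).
pose f2 k := count (fun k' => (rect_w k' < rect_p k + 1) && (rect_q k' < rect_u k + 1)) (iota 0 (4 * m)).
pose f3 k := count (fun k' => (rect_u k' < rect_q k) && (rect_q k' < rect_u k + 1)) (iota 0 (4 * m)).
pose f4 k := count (fun k' => (rect_w k' < rect_p k + 1) && (rect_p k' < rect_w k)) (iota 0 (4 * m)).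
have cE s' x1 x2 x3 x4 (d1 e1 : bool) (g1 g2 g3 g4 : nat -> nat) k :
    (forall k, k < 4 * m -> [/\ arr s' x1 k = g1 k, arr s' x2 k = g2 k,
       arr s' x3 k = g3 k & arr s' x4 k = g4 k]) -> k < 4 * m ->
    count (fun k' => (arr s' x1 k' < arr s' x3 k + d1) &&
                     (arr s' x2 k' < arr s' x4 k + e1)) (iota 0 (4 * m)) =
    count (fun k' => (g1 k' < g3 k + d1) && (g2 k' < g4 k + e1)) (iota 0 (4 * m)).
  move=> gE km; have [_ _ -> ->] := gE k km; apply: eq_in_count => k'.
  by rewrite mem_iota add0n => /andP[_ k'm]; have [-> -> _ _] := gE k' k'm.
apply: run_seq.
apply: run_mono (pass s2 31 29 30 32 false false 43 (fun=> 0) isT isT isT isT isT base2 _ _) => //.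
move=> s3 _ [base3 acc3 oth3]; have [rc3 _ _] := base3.
have {}acc3 k : k < 4 * m -> arr s3 43 k = f1 k.
  move=> km; rewrite acc3 // add0n (@cE _ _ _ _ _ _ _ rect_u rect_p rect_q rect_w) //.
    by apply: eq_count => k'; rewrite !addn0.
  by move=> k' /rc[].
apply: run_seq.
apply: run_mono (pass s3 32 30 29 31 true true 43 f1 isT isT isT isT isT base3 _ _) => //;
  last by move=> k km; apply: cM.
move=> s4 _ [base4 acc4 oth4]; have [rc4 _ _] := base4.
have {}acc4 k : k < 4 * m -> arr s4 43 k = f1 k + f2 k.
  move=> km; rewrite acc4 // (@cE _ _ _ _ _ _ _ rect_w rect_q rect_p rect_u) //.
  by move=> k' /rc3[].
apply: run_seq.
apply: run_mono (pass s4 31 30 30 31 false true 44 (fun=> 0) isT isT isT isT isT base4 _ _) => //.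
- move=> s5 _ [base5 acc5 oth5]; have [rc5 _ _] := base5.
  have {}acc5 k : k < 4 * m -> arr s5 44 k = f3 k.
    move=> km; rewrite acc5 // add0n (@cE _ _ _ _ _ _ _ rect_u rect_q rect_q rect_u) //.
      by apply: eq_count => k'; rewrite !addn0.
    by move=> k' /rc4[].
  apply: run_seq.
  apply: run_mono (pass s5 32 29 29 32 true false 44 f3 isT isT isT isT isT base5 _ _) => //;
    last by move=> k km; apply: cM.
  move=> s6 _ [[rc6 _ [_ _ _ r614]] acc6 oth6].
  apply: run_find_pair => // k km.
  rewrite acc6 // (@cE _ _ _ _ _ _ _ rect_w rect_p rect_p rect_w) //; last by move=> k' /rc5[].
  rewrite oth6 // oth5 // acc4 // count_meets // /f3; congr (_ + _ + _).
  by apply: eq_count => k'; rewrite addn0.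
- by move=> k km; rewrite oth4 // oth3.
Qed.
End Pairs.

(** * The whole program *)


Definition relabel : cmd :=
  For 3 2 (Seq (SetCell 13 (Reg 3) (Cell 9 (Cell 2 (Reg 3))))
               (SetCell 14 (Reg 3) (Cell 9 (Cell 3 (Reg 3))))).

Definition copy (a b a' b' : nat) : cmd :=
  For 3 2 (Seq (SetCell a' (Reg 3) (Cell a (Reg 3)))
               (SetCell b' (Reg 3) (Cell b (Reg 3)))).

Lemma run_copy W m a b a' b' (f g : nat -> nat) s :
  [&& a' != b', a' != a, a' != b, b' != a & b' != b] -> reg s 2 = m -> m <= W ->
  (forall i, i < m -> arr s a i = f i /\ arr s b i = g i) ->
  (forall i, i < m -> f i <= W /\ g i <= W) ->
  run W (copy a b a' b') s (m * 4 + 2)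
    (fun s' => forall i, i < m -> arr s' a' i = f i /\ arr s' b' i = g i).
Proof.
move=> /and5P[h1 h2 h3 h4 h5] sm mW fg fgW.
apply: (@run_for_const _ _ _ _ m (fun i s' => forall j, j < i ->
  arr s' a' j = f j /\ arr s' b' j = g j) 2) => //.
move=> i s' im [agr aga] s'3 _ I0; apply: (@run_wp _ (Seq _ _)) => /=.
have [fi gi] := fg i im; have [? ?] := fgW i im.
have Ea : arr s' a i = f i.
  by rewrite aga // !inE negb_or eq_sym h2 eq_sym h4.
have Eb : arr s' b i = g i.
  by rewrite aga // !inE negb_or eq_sym h3 eq_sym h5.
rewrite s'3 Ea (eq_sym b) (negPf h3) /= Eb; do 2![split; first by []].
move=> j ji /=; rewrite !eqxx (negPf h1) /=.
by case: (eqVneq j i) => [->|ne] //=; rewrite andbF; apply: I0; lia.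
Qed.

(** The pair is returned only if both families have fewer than two members; register 31 records this
    choice. *)
Definition choose_output : cmd :=
  Seq (Seq (SetReg 31 (Const 0))
      (If (Minus (Const 2) (Reg 29))
      (If (Minus (Const 2) (Reg 30))
      (If (Reg 26) (SetReg 31 (Const 1)) Skip) Skip) Skip))
  (Seq (For 3 2
         (If (Reg 31) (SetCell 4 (Reg 3) (Const 0))
         (If (Minus (Reg 30) (Reg 29)) (SetCell 4 (Reg 3) (Cell 28 (Reg 3)))
                                       (SetCell 4 (Reg 3) (Cell 27 (Reg 3))))))
       (If (Reg 31)
          (Seq (SetCell 4 (Cell 33 (Minus (Reg 26) (Const 1))) (Const 1))
               (SetCell 4 (Cell 33 (Minus (Reg 27) (Const 1))) (Const 1)))
          Skip)).

Lemma run_choose_output W m (selA selB : nat -> nat) s :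
  reg s 2 = m -> 0 < W -> m <= W ->
  (forall i, i < m -> arr s 27 i = selA i /\ selA i <= W) ->
  (forall i, i < m -> arr s 28 i = selB i /\ selB i <= W) ->
  run W choose_output s (m * 5 + 10) (fun s' =>
    (reg s 29 < 2 /\ reg s 30 < 2 /\ reg s 26 != 0 /\
     forall i, i < m -> (arr s' 4 i != 0) =
       (i == arr s 33 (reg s 26).-1) || (i == arr s 33 (reg s 27).-1)) \/
    ([\/ 2 <= reg s 29, 2 <= reg s 30 | reg s 26 = 0] /\
     forall i, i < m -> arr s' 4 i = if reg s 29 < reg s 30 then selB i else selA i)).
Proof.
move=> sm W0 mW aE bE; have -> : m * 5 + 10 = 5 + ((m * (3 + 2) + 2) + 3) by lia.
pose c := [&& reg s 29 < 2, reg s 30 < 2 & reg s 26 != 0].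
have R1 : run W (Seq (SetReg 31 (Const 0))
      (If (Minus (Const 2) (Reg 29))
      (If (Minus (Const 2) (Reg 30))
      (If (Reg 26) (SetReg 31 (Const 1)) Skip) Skip) Skip)) s 5
   (fun s' => reg s' 31 = c).
  apply: (@run_wp _ (Seq _ _)); rewrite /c /=; split=> //.
  by split=> [?|?]; [split=> [?|?]; [split=> [?|?]|]|]; rewrite /=; lia.
apply: run_seq; apply: run_mono R1 => // s1 [agr1 aga1] r31.
have r1 x : x != 31 -> reg s1 x = reg s x by move=> ne; apply: agr1; rewrite !inE; lia.
apply: run_seq; apply: (@run_for_const _ _ _ _ m (fun i s' => forall j, j < i ->
  arr s' 4 j = if c then 0 else if reg s 29 < reg s 30 then selB j else selA j)) => //.
- by rewrite r1.
- move=> i s' im [agr aga] s'3 _ I0.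
  have [a27 ?] := aE i im; have [b28 ?] := bE i im.
  have I1 x : x = (if c then 0 else if reg s 29 < reg s 30 then selB i else selA i) ->
    forall j, j < i.+1 -> (if j == i then x else arr s' 4 j) =
     if c then 0 else if reg s 29 < reg s 30 then selB j else selA j.
    by move=> -> j ji; case: (eqVneq j i) => [->|ne] //; apply: I0; lia.
  apply: (@run_wp _ (If _ _ _)) => /=.
  rewrite s'3 !agr //= r31 !r1 // !aga //= !aga1 //= a27 b28.
  split=> [cc|cc].
    by split=> //; apply: I1; move: cc; case: (c).
  have {}cc : c = false by move: cc; case: (c).
  split=> [lt|ge]; split=> //; apply: I1; rewrite cc.
    by rewrite ifT //; lia.
  by rewrite ifF //; lia.
move=> s2 [agr2 aga2] _ I2; apply: (@run_wp _ (If _ _ _)) => /=.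
rewrite !agr2 //= r31 !r1 // !aga2 //= !aga1 //= !subn1.
split=> [cc|cc].
  have {}cc : c by move: cc; case: (c).
  split=> //; split=> //; left; have /and3P[h1 h2 h3] := cc; split=> //; split=> //; split=> //.
  move=> i im /=; rewrite orbC; case: (i == _) => //=; case: (i == _) => //=.
  by rewrite I2 // cc.
have {}cc : c = false by move: cc; case: (c).
right; split; last by move=> i im; rewrite I2 // cc.
move: cc; rewrite /c; case: (ltnP (reg s 29)) => [_|h] /=; last by constructor 1.
case: (ltnP (reg s 30)) => [_|h] /=; last by constructor 2.
by case: eqP => // h _; constructor 3.
Qed.

(** [disj_post] only tells which entries are nonzero; as 0 and 1 they surely fit in a word when
    copied to the output. *)
Definition normalize (b : nat) : cmd :=
  For 3 2 (If (Cell 26 (Reg 3)) (SetCell b (Reg 3) (Const 1)) (SetCell b (Reg 3) (Const 0))).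

Lemma run_normalize W m b s :
  b != 26 -> reg s 2 = m -> 0 < W -> m <= W ->
  run W (normalize b) s (m * 4 + 2) (fun s' => forall i, i < m ->
    arr s' b i = (arr s 26 i != 0)).
Proof.
move=> b26 sm W0 mW.
apply: (@run_for_const _ _ _ _ m (fun i s' => forall j, j < i ->
  arr s' b j = (arr s 26 j != 0)) 2) => //.
move=> i s' im [agr aga] s'3 _ I0; apply: (@run_wp _ (If _ _ _)) => /=.
rewrite s'3 aga; last by rewrite /= !inE orbb eq_sym.
have I1 x : x = (arr s 26 i != 0) :> nat -> forall j, j < i.+1 ->
  (if (b == b) && (j == i) then x else arr s' b j) = (arr s 26 j != 0).
  by rewrite eqxx => -> j ji; case: (eqVneq j i) => [->|ne] //=; apply: I0; lia.
by split=> h; split=> //; apply: I1; [rewrite h|rewrite h].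
Qed.

Lemma eq_disj_post n m out K V K' V' sel sel' tot :
  (forall i, i < m -> [/\ K' i = K i, V' i = V i & (sel' i != 0) = (sel i != 0)]) ->
  disj_post n m out K V sel tot -> disj_post n m out K' V' sel' tot.
Proof.
move=> E [dis cnt opt]; have apE i j : i < m -> j < m ->
    apart n out K' V' i j <-> apart n out K V i j.
  move=> im jm; have [Ki Vi _] := E i im; have [Kj Vj _] := E j jm.
  by rewrite /apart /region Ki Vi Kj Vj.
split.
- move=> i j im jm ij; have [_ _ ->] := E i im; have [_ _ ->] := E j jm => si sj.
  by apply/apE => //; apply: dis.
- rewrite cnt; apply: eq_in_count => i; rewrite mem_iota add0n => /andP[_ im].
  by have [_ _ ->] := E i im.
- move=> J uJ Jm dJ; apply: opt => // i j iJ jJ ij.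
  by apply/apE; [apply: (allP Jm)|apply: (allP Jm)|apply: dJ].
Qed.

Lemma agree_widen rs bs rs' bs' s s' :
  all (mem rs') rs -> all (mem bs') bs -> agree rs bs s s' -> agree rs' bs' s s'.
Proof. by move=> /allP h1 /allP h2; apply: agree_sub. Qed.

Lemma preorder_root n p i : preorder n p -> i < n -> anc p 0 i.
Proof.
move=> pp; elim/ltn_ind: i => i IH iN; have [->|i0] := posnP i; first exact: anc_refl.
have [pi _] : p i < i /\ anc p (p i) i.-1 by case: pp => _; apply; lia.
by apply: anc_trans (IH _ pi _) (anc_parent p i); lia.
Qed.

(** The label is not 0: the interval of the root holds all labels, so a path from the root falls in
    the first case. *)
Lemma side_spec_lt n p out s t k v :
  preorder n p ->
  (forall v w, v < n -> w < n -> anc p v w <-> v <= w < out v) ->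
  s < n -> t < n -> side_spec n p out s t k v -> k <= 1 /\ 0 < v < n.
Proof.
move=> pp ancP sn tn; rewrite /side_spec; case: ifP => [_ [-> ? _ _] //|out_s [-> ->]].
split=> //; rewrite sn andbT lt0n; apply: contraFneq out_s => s0.
by rewrite s0; apply/ancP => //; [lia|apply: preorder_root pp tn].
Qed.

(** The head side of a request is the tail side of the reversed path: [side] is run a second time
    with the ends exchanged. *)
Definition program : cmd :=
  Seq dfs_search (Seq outs (Seq relabel
  (Seq (copy 13 14 15 16) (Seq side (Seq (copy 17 18 20 21)
  (Seq (copy 14 13 15 16) (Seq side (Seq (copy 17 18 22 23)
  (Seq (copy 20 21 17 18) (Seq disj (Seq (normalize 27) (Seq (SetReg 29 (Reg 9))
  (Seq (copy 22 23 17 18) (Seq disj (Seq (normalize 28) (Seq (SetReg 30 (Reg 9))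
  (Seq pair_search choose_output))))))))))))))))).

Definition program_cost (n m a : nat) : nat :=
  n * 11 + a * 14 + 9 + (n * 8 + 4 + (m * 4 + 2 +
  (m * 4 + 2 + (n * 8 + m * 12 + 6 + (m * 4 + 2 +
  (m * 4 + 2 + (n * 8 + m * 12 + 6 + (m * 4 + 2 +
  (m * 4 + 2 + (n * 11 + m * 12 + 11 + (m * 4 + 2 + (1 +
  (m * 4 + 2 + (n * 11 + m * 12 + 11 + (m * 4 + 2 + (1 +
  (n * 112 + m * (trunc_log 2 (2 * n + 5) * 112 + 562) + 378 + (m * 5 + 10)))))))))))))))))).

Definition selection (n m : nat) (out ka va kb vb o : nat -> nat) : Prop :=
  exists selA totA selB totB,
  [/\ disj_post n m out ka va selA totA, disj_post n m out kb vb selB totB &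
  [/\ totA < 2, totB < 2 & exists i j, [/\ i < m, j < m,
      compatible n out ka va kb vb i j &
      forall l, l < m -> (o l != 0) = (l == i) || (l == j)]] \/
  [\/ 2 <= totA, 2 <= totB |
      forall i j, i < m -> j < m -> ~ compatible n out ka va kb vb i j] /\
  forall i, i < m -> o i = if totA < totB then selB i else selA i].

Lemma run_program W n m a tl hd src tgt s :
  (forall k, k < a -> tl k < n) -> (forall k, k < a -> hd k < n) ->
  (forall X : nat -> Prop, X 0 -> (forall x y, X x -> edge a tl hd x y -> X y) ->
     forall x, x < n -> X x) ->
  (forall i, i < m -> [/\ src i < n, tgt i < n & src i != tgt i]) ->
  0 < n -> 8 * n + 20 <= W -> 8 * m + 8 <= W -> a <= W -> 4 * m * (2 * n + 8) < W ->
  reg s 0 = n -> reg s 1 = a -> reg s 2 = m ->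
  arr s 0 =1 tl -> arr s 1 =1 hd ->
  (forall i, i < m -> arr s 2 i = src i /\ arr s 3 i = tgt i) ->
  (forall b, 4 < b -> arr s b =1 (fun=> 0)) ->
  run W program s (program_cost n m a) (fun s' =>
    exists L lab p out ka va kb vb, [/\ size L = n, labelling n a tl hd L lab p,
      (forall v, v < n -> v < out v <= n) /\
      (forall v w, v < n -> w < n -> anc p v w <-> v <= w < out v),
      forall i, i < m -> side_spec n p out (lab (src i)) (lab (tgt i)) (ka i) (va i) /\
        side_spec n p out (lab (tgt i)) (lab (src i)) (kb i) (vb i)
      & selection n m out ka va kb vb (arr s' 4)]).
Proof.
move=> tl_lt hd_lt conn st n0 nW mW aW mnW r0 r1 r2 a0 a1 a23 z.
have nW' : n < W by lia.
apply: run_seq; apply: run_mono (run_dfs tl_lt hd_lt nW' aW n0 conn r0 r1 a0 a1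
   (z 8 isT) (z 10 isT) (z 11 isT)) => // s1 [agr1 aga1] [L [szL lbl]].
have [uL ltL labE pp _] := lbl; rewrite szL in labE pp.
pose lab := arr s1 9; pose p := arr s1 10.
have inL x : x < n -> x \in L.
  have sub : {subset L <= iota 0 n}.
    by move=> y /(allP ltL) yn; rewrite mem_iota.
  have [|_ E] := uniq_min_size uL sub; first by rewrite size_iota szL.
  by rewrite E mem_iota.
have lab_lt x : x < n -> lab x < n.
  move=> /inL xL; have := xL; rewrite -index_mem szL => ix.
  by rewrite -{1}(nth_index 0 xL) /lab labE.
have lab_inj x y : x < n -> y < n -> lab x = lab y -> x = y.
  move=> /inL xL /inL yL; have := xL; have := yL; rewrite -!index_mem szL => iy ix.
  by rewrite -{1}(nth_index 0 xL) -{1}(nth_index 0 yL) /lab !labE // => E;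
    rewrite -(nth_index 0 xL) E nth_index.
apply: run_seq; apply: run_mono (run_outs (p := p) nW' _ (fun=> erefl) pp) => //; last by rewrite agr1.
move=> s2 [agr2 aga2]; set out := arr s2 12 => -[outP ancP].
have laminar u v : v < n -> v <= u < out v -> out u <= out v.
  move=> vn uv; have ovn := outP v vn; have un : u < n by lia.
  have oun := outP u un.
  have /(ancP u (out u).-1 un ltac:(lia)) A : u <= (out u).-1 < out u by lia.
  have /(ancP v u vn un) B := uv.
  have /(ancP v (out u).-1 vn ltac:(lia)) := anc_trans B A; lia.
have stl i : i < m -> [/\ lab (src i) < n, lab (tgt i) < n & lab (src i) != lab (tgt i)].
  move=> /st[h1 h2 h3]; split; try exact: lab_lt.
  by apply: contraNneq h3 => /lab_inj ->.
have R3 : run W relabel s2 (m * 4 + 2) (fun s' => forall i, i < m ->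
    arr s' 13 i = lab (src i) /\ arr s' 14 i = lab (tgt i)).
  apply: (@run_for_const _ _ _ _ m (fun i s' => forall j, j < i ->
    arr s' 13 j = lab (src j) /\ arr s' 14 j = lab (tgt j)) 2) => //.
  - by rewrite agr2 // agr1.
  - by lia.
  - move=> i s' im [agr aga] s'3 _ I0; apply: (@run_wp _ (Seq _ _)) => /=.
    have [h1 h2] := a23 i im; have [? ? _] := stl i im.
    have e2 : arr s' 9 (arr s' 2 i) = lab (src i).
      by rewrite (aga 2) // (aga2 2) // (aga1 2) // h1 (aga 9) // (aga2 9).
    have e3 : arr s' 9 (arr s' 3 i) = lab (tgt i).
      by rewrite (aga 3) // (aga2 3) // (aga1 3) // h2 (aga 9) // (aga2 9).
    rewrite s'3 e2 e3; split; first by lia.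
    split; first by lia.
    by move=> j ji /=; case: (eqVneq j i) => [->|ne] //=; apply: I0; lia.
apply: run_seq; apply: run_mono R3 => // s3 ag3 lab3.
have [agr3 aga3] := ag3.
have {}r0 : reg s3 0 = n by rewrite agr3 // agr2 // agr1.
have {}r2 : reg s3 2 = m by rewrite agr3 // agr2 // agr1.
have p3 : arr s3 10 =1 p by move=> j; rewrite aga3 // aga2.
have out3 v : v < n -> arr s3 12 v = out v by rewrite aga3.
have z3 b : b \in [:: 43; 44] -> arr s3 b =1 (fun=> 0).
  by rewrite !inE => /orP[]/eqP-> j; rewrite aga3 // aga2 // aga1 // z.
(* One frame for all programs up to the pair search: tree data, relabelled ends and the accumulators
   43 and 44 stay as in [s3]. *)
pose rs := iota 3 29; pose bs := [:: 4; 5; 6; 15; 16; 17; 18; 19; 20; 21; 22; 23; 24; 25; 26; 27; 28].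
have ext s4 s5 c : agree rs bs s3 s4 -> agree (wregs c) (warrs c) s4 s5 ->
    all (mem rs) (wregs c) -> all (mem bs) (warrs c) -> agree rs bs s3 s5.
  by move=> A B h1 h2; apply: agree_trans A _; apply: agree_widen B.
have mW' : m <= W by lia.
have mltW : m < W by lia.
have labW i : i < m -> lab (src i) <= W /\ lab (tgt i) <= W.
  by move=> /stl[? ? _]; lia.
apply: run_seq; apply: run_mono (run_copy _ r2 mW' lab3 labW) => // s4 ag4 xy4.
have K4 : agree rs bs s3 s4 by apply: (ext s3 _ _ (agree_refl _ _ _) ag4).
have side_run s' X Y : agree rs bs s3 s' ->
    (forall i, i < m -> [/\ X i < n, Y i < n & X i != Y i]) ->
    (forall i, i < m -> arr s' 15 i = X i /\ arr s' 16 i = Y i) ->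
    run W side s' (n * 8 + m * 12 + 6) (fun s'' =>
      agree rs bs s3 s'' /\
      forall i, i < m -> side_spec n p out (X i) (Y i) (arr s'' 17 i) (arr s'' 18 i)).
  move=> K XY xyE; have [agr aga] := K.
  apply: run_mono (run_side nW' mW' pp outP ancP XY _ _ _ _ xyE) => //.
  - by move=> s'' ag H; split=> //; apply: (ext s' _ _ K ag).
  - by rewrite agr.
  - by rewrite agr.
  - by move=> j; rewrite aga // p3.
  - by move=> v vn; rewrite aga // out3.
apply: run_seq; apply: run_mono (side_run s4 _ _ K4 stl xy4) => // s5 _ [K5 sd5].
have sdW X Y k v : (forall i, i < m -> X i < n /\ Y i < n) ->
    (forall i, i < m -> side_spec n p out (X i) (Y i) (k i) (v i)) ->
    forall i, i < m -> k i <= 1 /\ 0 < v i < n.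
  by move=> XY H i im; have [? ?] := XY i im; apply: side_spec_lt pp ancP _ _ (H i im).
have XY1 i : i < m -> lab (src i) < n /\ lab (tgt i) < n by case/stl.
have XY2 i : i < m -> lab (tgt i) < n /\ lab (src i) < n by case/stl.
pose ka := arr s5 17; pose va := arr s5 18.
have kva := sdW _ _ ka va XY1 sd5.
apply: run_seq; apply: run_mono (@run_copy W m 17 18 20 21 ka va s5 isT _ mW' _ _) => //; first last.
- by move=> i /kva; lia.
- by case: K5 => -> //.
move=> s6 ag6 a6; have K6 : agree rs bs s3 s6 by apply: (ext s5 _ _ K5 ag6).
apply: run_seq.
apply: run_mono (@run_copy W m 14 13 15 16 (fun i => lab (tgt i)) (fun i => lab (src i)) s6 isT _ mW' _ _) => //; first last.
- by move=> i /labW[].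
- by move=> i im; case: K6 => _ H; have [h1 h2] := lab3 i im; rewrite !H.
- by case: K6 => ->.
move=> s7 ag7 xy7; have K7 : agree rs bs s3 s7 by apply: (ext s6 _ _ K6 ag7).
have stl' i : i < m -> [/\ lab (tgt i) < n, lab (src i) < n & lab (tgt i) != lab (src i)].
  by move=> /stl[? ? ?]; rewrite eq_sym.
apply: run_seq; apply: run_mono (side_run s7 _ _ K7 stl' xy7) => // s8 ag8 [K8 sd8].
pose kb := arr s8 17; pose vb := arr s8 18.
have kvb := sdW _ _ kb vb XY2 sd8.
apply: run_seq; apply: run_mono (@run_copy W m 17 18 22 23 kb vb s8 isT _ mW' _ _) => //; first last.
- by move=> i /kvb; lia.
- by case: K8 => -> //.
move=> s9 ag9 b9; have K9 : agree rs bs s3 s9 by apply: (ext s8 _ _ K8 ag9).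
have a9 i : i < m -> arr s9 20 i = ka i /\ arr s9 21 i = va i.
  move=> im; have [_ H7] := ag7; have [_ H8] := ag8; have [_ H9] := ag9.
  by rewrite !H9 // !H8 // !H7 //; apply: a6.
(* A smaller frame, which also protects the sides stored in arrays 20 to 23. *)
pose bs9 := [:: 4; 17; 18; 24; 25; 26; 27; 28].
have ext9 s' s'' c : agree rs bs9 s9 s' -> agree (wregs c) (warrs c) s' s'' ->
    all (mem rs) (wregs c) -> all (mem bs9) (warrs c) -> agree rs bs9 s9 s''.
  by move=> A B h1 h2; apply: agree_trans A _; apply: agree_widen B.
have base9 s' : agree rs bs9 s9 s' -> [/\ reg s' 0 = n, reg s' 2 = m &
    forall v, v < n -> arr s' 12 v = out v].
  move=> [agr aga]; have [agr' aga'] := K9.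
  by rewrite !agr // !agr' //; split=> // v vn; rewrite aga // aga' // out3.
have disj_run s' K V : agree rs bs9 s9 s' -> (forall i, i < m -> 0 < V i < n) ->
    (forall i, i < m -> arr s' 17 i = K i /\ arr s' 18 i = V i) ->
    run W disj s' (n * 11 + m * 12 + 11) (fun s'' => agree rs bs9 s9 s'' /\
      disj_post n m out K V (arr s'' 26) (reg s'' 9)).
  move=> Ks Vn kvE; have [q0 q2 qo] := base9 _ Ks.
  apply: run_mono (run_disj (K := K) nW' mltW n0 outP laminar Vn q0 q2 qo _ _) => //.
  - by move=> s'' ag H; split=> //; apply: (ext9 s' _ _ Ks ag).
  - by move=> i /kvE[].
  - by move=> i /kvE[].
have [q0 q2 qo] := base9 s9 (agree_refl _ _ _).
apply: run_seq; apply: run_mono (@run_copy W m 20 21 17 18 ka va s9 isT q2 mW' a9 _) => //; last first.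
  by move=> i /kva; lia.
move=> s10 ag10 c10; have K10 : agree rs bs9 s9 s10 by apply: (ext9 s9 _ _ (agree_refl _ _ _) ag10).
have van i : i < m -> 0 < va i < n by case/kva.
have vbn i : i < m -> 0 < vb i < n by case/kvb.
apply: run_seq; apply: run_mono (disj_run s10 ka va K10 van c10) => // s11 _ [K11 d11].
have [_ q2' _] := base9 s11 K11.
apply: run_seq; apply: run_mono (@run_normalize W m 27 s11 isT q2' _ mW') => //; last by lia.
move=> s12 ag12 n12; have K12 : agree rs bs9 s9 s12 by apply: (ext9 s11 _ _ K11 ag12).
set totA := reg s11 9 in d11.
have totm sel tot K V : disj_post n m out K V sel tot -> tot <= m.
  by move=> [_ -> _]; apply: leq_trans (count_size _ _) _; rewrite size_iota.
have r9 : reg s12 9 = totA by case: ag12 => ->.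
apply: run_seq; apply: (@run_wp _ (SetReg _ _)); rewrite /= r9.
split; first by have := totm _ _ _ _ d11; lia.
set s13 := set_reg _ _ _.
have K13 : agree rs bs9 s9 s13.
  by apply: agree_trans K12 _; apply: agree_widen (agree_set_reg _ _ _).
have b13 i : i < m -> arr s13 22 i = kb i /\ arr s13 23 i = vb i.
  by move=> im; case: K13 => _ H; rewrite !H //; apply: b9.
have [_ q2'' _] := base9 s13 K13.
apply: run_seq; apply: run_mono (@run_copy W m 22 23 17 18 kb vb s13 isT q2'' mW' b13 _) => //; last first.
  by move=> i /kvb; lia.
move=> s14 ag14 c14; have K14 : agree rs bs9 s9 s14 by apply: (ext9 s13 _ _ K13 ag14).
apply: run_seq; apply: run_mono (disj_run s14 kb vb K14 vbn c14) => // s15 ag15 [K15 d15].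
have [_ q2''' _] := base9 s15 K15.
apply: run_seq; apply: run_mono (@run_normalize W m 28 s15 isT q2''' _ mW') => //; last by lia.
move=> s16 ag16 n16; have K16 : agree rs bs9 s9 s16 by apply: (ext9 s15 _ _ K15 ag16).
set totB := reg s15 9 in d15.
have r9' : reg s16 9 = totB by case: ag16 => ->.
apply: run_seq; apply: (@run_wp _ (SetReg _ _)); rewrite /= r9'.
split; first by have := totm _ _ _ _ d15; lia.
set s17 := set_reg _ _ _.
have K17 : agree rs bs9 s9 s17.
  by apply: agree_trans K16 _; apply: agree_widen (agree_set_reg _ _ _).
have [u0 u2 uo] := base9 s17 K17.
have ka17 i : i < m -> arr s17 20 i = ka i /\ arr s17 21 i = va i.
  by move=> im; case: K17 => _ H; rewrite !H //; apply: a9.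
have kb17 i : i < m -> arr s17 22 i = kb i /\ arr s17 23 i = vb i.
  by move=> im; case: K17 => _ H; rewrite !H //; apply: b9.
have z17 b : b \in [:: 43; 44] -> arr s17 b =1 (fun=> 0).
  move=> bz j; rewrite -(z3 b bz j); move: bz; rewrite !inE => /orP[]/eqP->;
    by rewrite (proj2 K17) // (proj2 K9).
apply: run_seq.
apply: run_mono (@run_pair_search W n m out ka va kb vb outP van vbn _ _ s17 _ mnW _ u0 u2 uo ka17 kb17
  (z17 43 isT) (z17 44 isT)) => //; try lia.
move=> s18 [agr18 aga18] fnd.
have r29 : reg s18 29 = totA.
  case: ag16 => agr16 _; case: ag15 => agr15 _; case: ag14 => agr14 _.
  by rewrite agr18 //= agr16 // agr15 // agr14.
have r30 : reg s18 30 = totB by rewrite agr18.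
have e27 i : i < m -> arr s18 27 i = (arr s11 26 i != 0).
  move=> im; case: ag16 => _ H16; case: ag15 => _ H15; case: ag14 => _ H14.
  by rewrite aga18 //= H16 // H15 // H14 //= n12.
have e28 i : i < m -> arr s18 28 i = (arr s15 26 i != 0).
  by move=> im; rewrite aga18 //= n16.
pose selA i : nat := arr s11 26 i != 0; pose selB i : nat := arr s15 26 i != 0.
apply: run_mono (@run_choose_output W m selA selB s18 _ _ mW' _ _) => //; first last.
- by move=> i im; rewrite e28 // /selB; split=> //; case: (_ != 0); lia.
- by move=> i im; rewrite e27 // /selA; split=> //; case: (_ != 0); lia.
- by lia.
- by rewrite agr18.
move=> s19 _; rewrite r29 r30 => res.
exists L, lab, p, out, ka, va, kb, vb; split=> //.
  by move=> i im; split; [apply: sd5|apply: sd8].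
exists selA, totA, selB, totB; split.
- by apply: eq_disj_post d11 => i im; split=> //; rewrite /selA eqb0 negbK.
- by apply: eq_disj_post d15 => i im; split=> //; rewrite /selB eqb0 negbK.
case: res => [[lA [lB [f0 o]]]|[cond o]].
  left; split=> //; case: fnd => [[E]|[_ im jm cij]]; first by rewrite E in f0.
  by exists (arr s18 33 (reg s18 26).-1), (arr s18 33 (reg s18 27).-1).
right; split=> //; case: cond => [h|h|f0]; [by constructor 1|by constructor 2|].
by case: fnd => [[_ H]|[]]; [constructor 3|rewrite f0].
Qed.

(** * Correctness and running time *)


Lemma maximum_independent_mask (X : eqType) (adj : X -> X -> Prop) (R : seq X)
    (x0 : X) (o : pred nat) :
  uniq R -> (forall x, ~ adj x x) ->
  (forall i j, i < size R -> j < size R -> i != j -> o i -> o j ->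
     ~ adj (nth x0 R i) (nth x0 R j)) ->
  (forall J, uniq J -> all (fun i => i < size R) J ->
     (forall i j, i \in J -> j \in J -> i != j -> ~ adj (nth x0 R i) (nth x0 R j)) ->
     size J <= count o (iota 0 (size R))) ->
  maximum_independent_set adj R (mask [seq o i | i <- iota 0 (size R)] R).
Proof.
move=> uR irr ind opt.
have -> : mask [seq o i | i <- iota 0 (size R)] R =
    [seq nth x0 R i | i <- iota 0 (size R) & o i].
  by rewrite -{2}(mkseq_nth x0 R) /mkseq -map_mask -filter_mask.
split; first split.
- rewrite map_inj_in_uniq ?filter_uniq ?iota_uniq // => i j.
  rewrite !mem_filter !mem_iota !add0n => /andP[_ iR] /andP[_ jR] E.
  by apply/eqP; rewrite -(nth_uniq x0 iR jR uR) E.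
- move=> x /mapP[i]; rewrite mem_filter mem_iota add0n => /andP[_ iR] ->.
  exact: mem_nth.
- move=> x y /mapP[i]; rewrite mem_filter mem_iota add0n => /andP[oi iR] ->.
  move=> /mapP[j]; rewrite mem_filter mem_iota add0n => /andP[oj jR] ->.
  by have [->|ij] := eqVneq i j; [apply: irr|apply: ind].
move=> S' [uS sS dS]; rewrite size_map size_filter -(size_map (index^~ R) S').
apply: opt.
- rewrite map_inj_in_uniq // => x y xS yS E.
  by rewrite -(nth_index x0 (sS x xS)) E nth_index ?sS.
- by apply/allP => _ /mapP[x xS ->]; rewrite index_mem sS.
- by move=> _ _ /mapP[x xS ->] /mapP[y yS ->] _; rewrite !nth_index ?sS //; apply: dS.
Qed.

(** Let l and L be the two logarithms. If L <= 2(l + 1), the first terms suffice. Otherwise L <= 2(L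
    - l - 1) <= 2 * 2^(L - l - 1), and m < 2^(l + 1) gives m * L <= 2 * 2^L <= 4n + 10. *)
Lemma mul_log_bound m n :
  m * trunc_log 2 (2 * n + 5) <= 2 * (m * trunc_log 2 m) + 2 * m + (4 * n + 10).
Proof.
have [->|m0] := posnP m; first by [].
set l := trunc_log 2 m; set L := trunc_log 2 _.
have mS : m < 2 ^ l.+1 by apply: trunc_log_ltn.
have Ln : 2 ^ L <= 2 * n + 5 by apply: trunc_logP; lia.
have [le|lt] := leqP L (2 * l.+1).
  have : m * L <= m * (2 * l.+1) by rewrite leq_mul.
  by lia.
have h : L - l.+1 < 2 ^ (L - l.+1) by apply: ltn_expl.
have : m * L <= 2 ^ l.+1 * (2 * 2 ^ (L - l.+1)) by rewrite leq_mul //; lia.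
by rewrite mulnCA -expnD subnKC; lia.
Qed.

(** Absorbs the terms linear in m. The 1 is for m = 1, whose logarithm vanishes; it is absorbed by n
    > 0. *)
Lemma mul_log_ge m : m <= m * trunc_log 2 m + 1.
Proof.
case: m => [|[|m]] //; apply: leq_trans (leq_addr _ _).
by rewrite leq_pmulr // trunc_log_gt0.
Qed.

Lemma program_cost_bound n m a : 0 < n -> a <= n + n ->
  program_cost n m a <= 4000 * (m * trunc_log 2 m + n).
Proof.
move=> n0 an; have h1 := mul_log_bound m n; have h2 := mul_log_ge m.
by rewrite /program_cost; lia.
Qed.

(** With x >= 3, the factor x^4 >= 81 pays for the constants and x^2 for the products; this is where
    the exponent 6 comes from. *)
Lemma word_bound n m : 0 < n ->
  let W := (n + m).+2 ^ 6 in
  [/\ 8 * n + 20 <= W, 8 * m + 8 <= W, n * n <= W & 4 * m * (2 * n + 8) < W].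
Proof.
move=> n0; set x := (n + m).+2 => W.
have x3 : 3 <= x by rewrite /x; lia.
have x4 : 81 <= x ^ 4 by apply: (@leq_trans (3 ^ 4)) => //; rewrite leq_exp2r.
have E : W = x ^ 4 * (x * x) by rewrite /W mulnn -expnD.
have h : 81 * (x * x) <= W by rewrite E leq_mul.
have xx : 3 * x <= x * x by rewrite leq_mul.
have hn : n * n <= x * x by rewrite leq_mul // /x; lia.
have hm : m * n <= x * x by rewrite leq_mul // /x; lia.
have hx : n + m + 2 = x by rewrite /x; lia.
by split; lia.
Qed.

Theorem theorem7 :
  exists (prog : cmd) (C K : nat),
    forall (n : nat) (T : rel 'I_n) (A : seq ('I_n * 'I_n))
           (R : seq (dpath 'I_n)),
      bidirected_tree T -> arc_list T A ->
      uniq R -> all (request T) R ->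
      exists (k : nat) (s : store),
        [/\ exec ((n + size R).+2 ^ K) prog (input A R) k s,
            k <= C * (size R * trunc_log 2 (size R) + n)
          & maximum_independent_set (interference_graph T) R (output R s)].
Proof.
exists program, 4000, 6 => n T A R treeT arcs uR reqR; have [uA memA] := arcs.
have [n0 symT irrT connT _] := treeT; rewrite card_ord in n0.
pose x0 := Ordinal n0; pose r0 : dpath 'I_n := (x0, [::]); set m := size R.
set W := _ ^ 6; have [nW mW nnW mnW] : [/\ _, _, _ & _] := word_bound m n0.
pose s := input A R; pose a := size A.
have tlE k : k < a -> arr s 0 k = (nth (x0, x0) A k).1.
  by move=> ka; rewrite /= (nth_map (x0, x0)).
have hdE k : k < a -> arr s 1 k = (nth (x0, x0) A k).2.
  by move=> ka; rewrite /= (nth_map (x0, x0)).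
have edgeP x y : edge a (arr s 0) (arr s 1) x y <->
    exists u v : 'I_n, [/\ T u v, val u = x & val v = y].
  split=> [[k [ka <- <-]]|[u [v [uv <- <-]]]].
    exists (nth (x0, x0) A k).1, (nth (x0, x0) A k).2; rewrite tlE // hdE //; split=> //.
    by rewrite -memA -surjective_pairing mem_nth.
  have uvA : (u, v) \in A by rewrite memA.
  have ia : index (u, v) A < a by rewrite index_mem.
  by exists (index (u, v) A); rewrite tlE // hdE // nth_index.
(* The bound [n + n] will come from the labels, which exist only after the run; here the arcs are
   merely distinct pairs. *)
have aW : a <= W.
  apply: leq_trans nnW; have -> : n * n = #|{: 'I_n * 'I_n}|.
    by rewrite card_prod !card_ord.
  by rewrite /a -(card_uniqP uA) max_card.
have srcE i : i < m -> arr s 2 i = source (nth r0 R i).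
  by move=> im; rewrite /= (nth_map r0).
have tgtE i : i < m -> arr s 3 i = target (nth r0 R i).
  by move=> im; rewrite /= (nth_map r0).
have reqi i : i < m -> request T (nth r0 R i).
  by move=> im; apply: (allP reqR); apply: mem_nth.
have st i : i < m -> [/\ arr s 2 i < n, arr s 3 i < n & arr s 2 i != arr s 3 i].
  move=> im; rewrite srcE // tgtE //; split=> //.
  rewrite (inj_eq val_inj); apply: contraNneq (source_reception treeT (reqi i im)) => ->.
  exact: half_refl.
have conn (X : nat -> Prop) : X 0 ->
    (forall x y, X x -> edge a (arr s 0) (arr s 1) x y -> X y) -> forall x, x < n -> X x.
  move=> X0 clos x xn; have /connectP[p pth E] := connT x0 (Ordinal xn).
  rewrite -[x]/(val (Ordinal xn)) E; have : X (val x0) by [].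
  elim: p (x0) pth {E} => //= y p IH z /andP[zy pth] Xz; apply: IH pth _.
  by apply: clos Xz _; apply/edgeP; exists z, y.
have tl_lt k : k < a -> arr s 0 k < n by move=> ka; rewrite tlE.
have hd_lt k : k < a -> arr s 1 k < n by move=> ka; rewrite hdE.
have z b : 4 < b -> arr s b =1 (fun=> 0).
  by case: b => [|[|[|[|b]]]] // _ j; rewrite /= nth_nil nth_nil.
have [k [s' [ex kc [L [lab [p [out [ka [va [kb [vb [szL lbl [outP ancP] sd sel]]]]]]]]]]]] :=
  @run_program W n m a (arr s 0) (arr s 1) (arr s 2) (arr s 3) s tl_lt hd_lt conn st
    n0 nW mW aW mnW erefl erefl erefl (fun=> erefl) (fun=> erefl)
    (fun i _ => conj erefl erefl) z.
have [uL ltL labE pp edgL] := lbl; rewrite szL in labE pp edgL.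
pose g i : 'I_n := insubd x0 (nth 0 L i); pose l (x : 'I_n) := lab x.
have gE i : i < n -> val (g i) = nth 0 L i.
  by move=> iN; rewrite val_insubd (allP ltL) // mem_nth ?szL.
have lg i : i < n -> l (g i) = i by move=> iN; rewrite /l gE ?labE.
have inL (x : 'I_n) : val x \in L.
  have sub : {subset L <= iota 0 n}.
    by move=> y /(allP ltL) yn; rewrite mem_iota.
  have [|_ E] := uniq_min_size uL sub; first by rewrite size_iota szL.
  by rewrite E mem_iota /=.
have ixE (x : 'I_n) : index (val x) L < n.
  by apply: (@leq_trans (size L)); rewrite ?index_mem // szL.
have lE x : l x = index (val x) L.
  by rewrite -(labE _ (ixE x)) nth_index.
have gl x : g (l x) = x by apply: val_inj; rewrite gE lE ?ixE // nth_index.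
have l_lt x : l x < n by rewrite lE.
have gT i : 0 < i < n -> T (g (p i)) (g i).
  move=> iN; have /edgeP[u [v [uv Eu Ev]]] := edgL i iN.
  have pi : p i < n by case: pp => _ /(_ i iN) []; lia.
  have -> : g (p i) = u by apply: val_inj; rewrite gE.
  by have -> : g i = v by apply: val_inj; rewrite gE //; case/andP: iN.
have an : a <= n + n := size_arcs treeT lg gl l_lt pp gT arcs.
exists k, s'; split=> //; first exact: leq_trans kc (program_cost_bound m n0 an).
pose r i := nth r0 R i.
have sides i : i < m -> [/\ 0 < va i < n, 0 < vb i < n,
    tail_side T (r i) = [set w | sector out (ka i) (va i) (l w)] &
    head_side T (r i) = [set w | sector out (kb i) (vb i) (l w)]].
  move=> im; have [sa sb] := sd i im; rewrite srcE // tgtE // in sa sb.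
  have rT := reqi i im.
  have [van tE] := side_half treeT lg gl l_lt pp gT ancP (emission_arcT rT)
    (target_emission rT) sa.
  have rc := reception_arcT rT; have rc' := rc; rewrite symT in rc'.
  have sin : source (r i) \in half_space T (reception_arc (r i)).2 (reception_arc (r i)).1.
    by rewrite (halfC treeT rc) in_setC; apply: source_reception.
  by have [vbn hE] := side_half treeT lg gl l_lt pp gT ancP rc' sin sb.
have compP i j : i < m -> j < m -> compatible n out ka va kb vb i j <->
    tail_side T (r i) :&: head_side T (r j) != set0 /\
    tail_side T (r j) :&: head_side T (r i) != set0.
  have H i' j' : i' < m -> j' < m ->
     (exists2 w, w < n & sector out (ka i') (va i') w && sector out (kb j') (vb j') w) <->
     tail_side T (r i') :&: head_side T (r j') != set0.
    move=> im jm; have [_ _ -> _] := sides i' im; have [_ _ _ ->] := sides j' jm.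
    split=> [[w wn wS]|/set0Pn[w]].
      by apply/set0Pn; exists (g w); rewrite !inE lg.
    by rewrite !inE => wS; exists (l w).
  by move=> im jm; rewrite /compatible !H.
have adjP i j : i < m -> j < m -> i != j ->
    compatible n out ka va kb vb i j <-> ~ interference_graph T (r i) (r j).
  move=> im jm ij; rewrite compP //.
  have i1 := interferes_onP treeT (reqi i im) (reqi j jm).
  have i2 := interferes_onP treeT (reqi j jm) (reqi i im).
  split=> [[/eqP c1 /eqP c2] [_ [/i1|/i2]] //|nadj].
  have ne : r i <> r j by move/eqP; rewrite /r nth_uniq // (negPf ij).
  by split; apply/eqP => E; apply: nadj; split=> //; [left; apply/i1|right; apply/i2].
have tail0 i : i < m -> tail_side T (r i) != set0.
  by move=> im; apply/set0Pn; exists (emission_arc (r i)).1; apply: half_refl.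
have head0 i : i < m -> head_side T (r i) != set0.
  by move=> im; apply/set0Pn; exists (reception_arc (r i)).2; apply: half_refl.
have th i : i < m -> tail_side T (r i) \subset ~: head_side T (r i).
  move=> im; rewrite -disjoints_subset -setI_eq0.
  by apply/eqP; apply: tail_head_disjoint (reqi i im).
have apA i j : i < m -> j < m -> apart n out ka va i j <->
    ~: tail_side T (r i) :&: ~: tail_side T (r j) = set0.
  move=> im jm; have [_ _ -> _] := sides i im; have [_ _ -> _] := sides j jm.
  split=> [ap|/setP E w wn].
    by apply/setP => w; rewrite !inE; apply: negbTE (ap (l w) (l_lt w)).
  by have := E (g w); rewrite !inE lg // /region => ->.
have apB i j : i < m -> j < m -> apart n out kb vb i j <->
    ~: head_side T (r i) :&: ~: head_side T (r j) = set0.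
  move=> im jm; have [_ _ _ ->] := sides i im; have [_ _ _ ->] := sides j jm.
  split=> [ap|/setP E w wn].
    by apply/setP => w; rewrite !inE; apply: negbTE (ap (l w) (l_lt w)).
  by have := E (g w); rewrite !inE lg // /region => ->.
have apartA i j : i < m -> j < m -> apart n out ka va i j ->
    compatible n out ka va kb vb i j.
  have sub i' j' : i' < m -> j' < m -> ~: tail_side T (r i') :&: ~: tail_side T (r j') = set0 ->
      tail_side T (r i') :&: head_side T (r j') != set0.
    move=> im jm /eqP; rewrite setIC setI_eq0 disjoints_subset setCK => si.
    rewrite (setIidPr _) ?head0 //; apply: subset_trans si.
    by rewrite -setCS setCK th.
  move=> im jm /(apA i j im jm) E; apply/(compP i j im jm).
  by split; apply: sub; rewrite // setIC.
have apartB i j : i < m -> j < m -> apart n out kb vb i j ->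
    compatible n out ka va kb vb i j.
  have sub i' j' : i' < m -> j' < m -> ~: head_side T (r i') :&: ~: head_side T (r j') = set0 ->
      tail_side T (r i') :&: head_side T (r j') != set0.
    move=> im jm /eqP; rewrite setI_eq0 disjoints_subset setCK => si.
    by rewrite (setIidPl _) ?tail0 //; apply: subset_trans si; apply: th.
  move=> im jm /(apB i j im jm) E; apply/(compP i j im jm).
  by split; apply: sub; rewrite // setIC.
have [selA [totA [selB [totB [dA dB out4]]]]] := sel.
have [disA cntA optA] := dA; have [disB cntB optB] := dB.
have three J : uniq J -> all (fun i => i < m) J ->
    (forall i j, i \in J -> j \in J -> i != j -> compatible n out ka va kb vb i j) ->
    2 < size J -> size J <= totA \/ size J <= totB.
  move=> uJ /allP Jm cJ J3.
  have [||b c i j iJ jJ|dF|dE] := @independent_three _ _ (fun i => ~: tail_side T (r i))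
    (fun i => head_side T (r i)) J _ _ _ uJ J3.
  - by move=> i /Jm im; rewrite -setCS setCK th.
  - move=> i j iJ jJ ij; have [c _] := (compP _ _ (Jm i iJ) (Jm j jJ)).1 (cJ i j iJ jJ ij).
    by rewrite -disjoints_subset -setI_eq0 setIC.
  - have [im jm] := (Jm i iJ, Jm j jJ); have [rTi rTj] := (reqi i im, reqi j jm).
    rewrite (tail_sideE treeT rTi) (tail_sideE treeT rTj) !setCK.
    case: b; case: c; apply: half_crossfree => //;
      by [apply: emission_arcT|apply: reception_arcT].
  - right; apply: optB => //; first exact/allP.
    move=> i j iJ jJ ij; apply/apB; rewrite ?Jm //.
    by rewrite -setCU dF // setCT.
  - left; apply: optA => //; first exact/allP.
    by move=> i j iJ jJ ij; apply/apA; rewrite ?Jm // dE.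
(* A request interferes on itself, so the pair found by the search consists of two distinct
   requests. *)
have self i : i < m -> ~ compatible n out ka va kb vb i i.
  move=> im /(compP i i im im)[/eqP c _]; apply: c.
  exact: tail_head_disjoint (reqi i im).
pose OUT i := arr s' 4 i != 0.
suff [ind opt] : (forall i j, i < m -> j < m -> i != j -> OUT i -> OUT j ->
      compatible n out ka va kb vb i j) /\
    forall J, uniq J -> all (fun i => i < m) J ->
      (forall i j, i \in J -> j \in J -> i != j -> compatible n out ka va kb vb i j) ->
      size J <= count OUT (iota 0 m).
  apply: (@maximum_independent_mask _ _ R r0 OUT) => //.
  - by move=> x [].
  - by move=> i j im jm ij oi oj; apply/adjP => //; apply: ind.
  - move=> J uJ Jm dJ; apply: opt => // i j iJ jJ ij.
    by apply/adjP; rewrite ?(allP Jm) //; apply: dJ.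
case: out4 => [[A2 B2 [i0 [j0 [im jm cij o4]]]]|[cond o4]].
  have ij : i0 != j0 by apply/eqP => E; rewrite E in cij; apply: (self j0).
  have oE l' : l' < m -> OUT l' = (l' == i0) || (l' == j0) by apply: o4.
  split=> [i j i_m j_m ne|J uJ Jm cJ].
    rewrite !oE // => /orP[]/eqP Ei /orP[]/eqP Ej; move: ne; rewrite Ei Ej ?eqxx // => _.
    by case: cij.
  have -> : count OUT (iota 0 m) = 2.
    rewrite (eq_in_count (a2 := mem [:: i0; j0])); last first.
      by move=> i; rewrite mem_iota add0n !inE => /andP[_ /oE].
    rewrite -size_filter -[2]/(size [:: i0; j0]); apply/perm_size/uniq_perm.
    - by rewrite filter_uniq ?iota_uniq.
    - by rewrite /= inE ij.
    - move=> i; rewrite mem_filter mem_iota add0n !inE /=.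
      by case: eqP => [->|_]; [rewrite im|case: eqP => [->|//]; rewrite jm].
  rewrite leqNgt; apply/negP => J3; by case: (three J uJ Jm cJ J3); lia.
have cO : count OUT (iota 0 m) = if totA < totB then totB else totA.
  case: ifP => h; rewrite ?cntA ?cntB; apply: eq_in_count => i;
    by rewrite mem_iota add0n => /andP[_ im]; rewrite /OUT o4 // h.
have [leA leB] : totA <= count OUT (iota 0 m) /\ totB <= count OUT (iota 0 m).
  by rewrite cO; case: ltnP; lia.
split=> [i j i_m j_m ne|J uJ Jm cJ].
  rewrite /OUT !o4 //; case: ifP => _ oi oj; first by apply: apartB => //; apply: disB.
  by apply: apartA => //; apply: disA.
have [J3|J2] := ltnP 2 (size J); first by case: (three J uJ Jm cJ J3); lia.
(* Settles competitors with a single request; those with two are settled by the alternatives of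
   [cond]. *)
have one x : x < m -> 1 <= totA.
  move=> xm; apply: (optA [:: x]) => //=; first by rewrite xm.
  by move=> i j; rewrite !inE => /eqP-> /eqP->; rewrite eqxx.
case: J uJ Jm cJ J2 => [|x [|y [|? ?]]] //= uJ /andP[xm Jm] cJ _.
  by have := one x xm; lia.
case: cond => [h|h|no]; [lia|lia|].
have [ym _] := andP Jm; case: (no x y xm ym); apply: cJ; rewrite ?inE ?eqxx ?orbT //.
by move: uJ; rewrite inE; case: (x == y).
Qed.
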